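(* Let $k>0$, $\mu\in(0,1)$ with $\mu<k$, $\nu\in[0,1]$, $\omega,\lambda\in\mathbb{C}$, $\alpha>0$, $\gamma,\delta\ge0$, $K\ge0$, and $f\in L^1[0,\infty)$. The solution $y$ of the Cauchy problem $${}_{k}\mathcal{D}_{\alpha,\omega,0^{+}}^{\gamma,\mu,\nu}y(x)=\lambda\,{}_{k}P_{\alpha,\mu,\omega,0^{+}}^{\delta}y(x)+f(x),\qquad x\in(0,\infty),$$ $$\Big[{}_{k}P_{\alpha,(1-\nu)(k-\mu),\omega,0^{+}}^{-\gamma(1-\nu)}y(x)\Big]_{x=0^{+}}=K,$$ is given by $$y(x)=K\sum_{n=0}^{\infty}\lambda^{n}x^{\frac{\nu(k-\mu)+\mu(1+2n)}{k}-1}E_{k,\alpha,\nu(k-\mu)+\mu(1+2n)}^{n(\delta+\gamma)-\gamma(\nu-1)}\big(\omega x^{\frac{\alpha}{k}}\big)+\sum_{n=0}^{\infty}\lambda^{n}\,{}_{k}P_{\alpha,\mu(1+2n),\omega,0^{+}}^{\gamma+n(\delta+\gamma)}f(x).$$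
   Context: The $k$-gamma function is $\Gamma_k(z)=\int_0^\infty e^{-t^k/k}t^{z-1}\,dt$ for $\operatorname{Re}z>0$, and the $k$-Pochhammer symbol is $(\gamma)_{n,k}=\gamma(\gamma+k)\cdots(\gamma+(n-1)k)$, $(\gamma)_{0,k}=1$. The $k$-Mittag-Leffler function is $E_{k,\alpha,\mu}^{\gamma}(z)=\sum_{n=0}^\infty \frac{(\gamma)_{n,k}}{\Gamma_k(\alpha n+\mu)}\frac{z^n}{n!}$. The $k$-Prabhakar integral (for $\operatorname{Re}\alpha,\operatorname{Re}\mu>0$) is $$\big({}_{k}P_{\alpha,\mu,\omega}^{\gamma}f\big)(x)=\big({}_{k}P_{\alpha,\mu,\omega,0^+}^{\gamma}f\big)(x)=\int_0^x\frac{(x-t)^{\frac{\mu}{k}-1}}{k}E_{k,\alpha,\mu}^{\gamma}\big[\omega(x-t)^{\frac{\alpha}{k}}\big]f(t)\,dt ,$$ with the convention that ${}_{k}P_{\alpha,0,\omega}^{0}$ is the identity. The $k$-Hilfer-Prabhakar fractional derivative is $${}_{k}\mathcal{D}_{\alpha,\omega,0^{+}}^{\gamma,\mu,\nu}y(x)=k\Big({}_{k}P_{\alpha,\nu(k-\mu),\omega,0^{+}}^{-\gamma\nu}\frac{d}{dx}\big({}_{k}P_{\alpha,(1-\nu)(k-\mu),\omega,0^{+}}^{-\gamma(1-\nu)}y\big)\Big)(x),$$ defined for $y$ that is integrable on bounded intervals $[0,b]$ with ${}_{k}P_{\alpha,(1-\nu)(k-\mu),\omega,0^{+}}^{-\gamma(1-\nu)}y$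 absolutely continuous on $[0,b]$. The subscript $x=0^+$ means the limit as $x\to0^+$. *)

(* Defs.v *)
From HB Require Import structures.
From mathcomp Require Import all_boot all_order all_algebra.
From mathcomp Require Import complex.
From mathcomp Require Import all_classical all_reals all_analysis.
Set Implicit Arguments.
Unset Strict Implicit.
Unset Printing Implicit Defensive.
Import Order.TTheory GRing.Theory Num.Theory.
Import numFieldNormedType.Exports.
Local Open Scope classical_set_scope.
Local Open Scope ring_scope.
Local Open Scope complex_scope.

(* The library integrates real-valued functions only, and differentiates over a
   fixed base field, so for functions R -> R[i] of a real variable both are
   taken on the real and imaginary parts. *)

Definition cintegrable (R : realType) (D : set R) (h : R -> R[i]) : Prop :=
  (@lebesgue_measure R).-integrable D (fun x => (complex.Re (h x))%:E) /\
  (@lebesgue_measure R).-integrable D (fun x => (complex.Im (h x))%:E).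

Definition cintegral (R : realType) (D : set R) (h : R -> R[i]) : R[i] :=
  (\int[@lebesgue_measure R]_(x in D) complex.Re (h x)) +i*
  (\int[@lebesgue_measure R]_(x in D) complex.Im (h x)).

Definition cderive (R : realType) (g : R -> R[i]) (x : R) : R[i] :=
  (derive1 (fun t => complex.Re (g t)) x) +i*
  (derive1 (fun t => complex.Im (g t)) x).

Definition abs_continuous (R : realType) (a b : R) (g : R -> R[i]) : Prop :=
  forall eps : R, 0 < eps ->
  exists2 delta : R, 0 < delta &
    forall (n : nat) (u v : 'I_n -> R),
      (forall i, a <= u i /\ u i <= v i /\ v i <= b) ->
      trivIset [set: 'I_n] (fun i => [set x : R | u i < x < v i]) ->
      \sum_(i < n) (v i - u i) < delta ->
      \sum_(i < n) `|g (v i) - g (u i)| < eps%:C.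

(* [R[i]^o] is [R[i]] with the topology given by its complex modulus. *)

Definition csum (R : realType) (u : nat -> R[i]) : R[i] :=
  limn (series u : nat -> R[i]^o).

Definition csummable (R : realType) (u : nat -> R[i]) : Prop :=
  cvgn (series u : nat -> R[i]^o).

(* The parameters k, z, alpha, mu, gamma below are real. *)

Definition kgamma (R : realType) (k z : R) : R :=
  \int[@lebesgue_measure R]_(t in `]0, +oo[)
    (expR (- (t `^ k / k)) * t `^ (z - 1)).

Definition kpochhammer (R : realType) (k gamma : R) (n : nat) : R :=
  \prod_(i < n) (gamma + i%:R * k).

Definition kmittag_leffler (R : realType) (k alpha mu gamma : R) (z : R[i])
    : R[i] :=
  csum (fun n : nat =>
    (kpochhammer k gamma n / kgamma k (alpha * n%:R + mu))%:C
      * (z ^+ n / (n`!)%:R)).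

(* The convention that order mu = 0 with gamma = 0 is the identity is built in.
   For mu / k < 1 the kernel is singular at t = x, hence the open interval. *)
Definition kprabhakar (R : realType) (k alpha mu : R) (omega : R[i])
    (gamma : R) (f : R -> R[i]) (x : R) : R[i] :=
  if (mu == 0) && (gamma == 0) then f x else
  cintegral `]0, x[ (fun t =>
    ((x - t) `^ (mu / k - 1) / k)%:C
      * kmittag_leffler k alpha mu gamma (omega * ((x - t) `^ (alpha / k))%:C)
      * f t).

Definition khilfer_inner (R : realType) (k alpha : R) (omega : R[i])
    (gamma mu nu : R) (y : R -> R[i]) : R -> R[i] :=
  kprabhakar k alpha ((1 - nu) * (k - mu)) omega (- (gamma * (1 - nu))) y.

Definition khilfer_prabhakar (R : realType) (k alpha : R) (omega : R[i])
    (gamma mu nu : R) (y : R -> R[i]) (x : R) : R[i] :=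
  k%:C * kprabhakar k alpha (nu * (k - mu)) omega (- (gamma * nu))
           (cderive (khilfer_inner k alpha omega gamma mu nu y)) x.

(* Absolute continuity of [khilfer_inner y] on [0, b] refers to its extension
   by continuity at 0: as an integral over an empty interval its own value at 0
   is 0, whatever its limit at 0+ is. *)
Definition khilfer_domain (R : realType) (k alpha : R) (omega : R[i])
    (gamma mu nu : R) (y : R -> R[i]) : Prop :=
  forall b : R, 0 < b ->
    cintegrable `[0, b] y /\
    exists2 g : R -> R[i], abs_continuous 0 b g &
      forall x, 0 < x <= b -> g x = khilfer_inner k alpha omega gamma mu nu y x.

Definition hom_term (R : realType) (k alpha : R) (omega lambda : R[i])
    (gamma delta mu nu : R) (x : R) (n : nat) : R[i] :=
  let m := nu * (k - mu) + mu * (1 + 2 * n%:R) in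
  lambda ^+ n * (x `^ (m / k - 1))%:C
    * kmittag_leffler k alpha m (n%:R * (delta + gamma) - gamma * (nu - 1))
        (omega * (x `^ (alpha / k))%:C).

Definition source_term (R : realType) (k alpha : R) (omega lambda : R[i])
    (gamma delta mu : R) (f : R -> R[i]) (x : R) (n : nat) : R[i] :=
  lambda ^+ n * kprabhakar k alpha (mu * (1 + 2 * n%:R)) omega
                  (gamma + n%:R * (delta + gamma)) f x.

(* Main.v *)
Require Import Defs.
From HB Require Import structures.
From mathcomp Require Import all_boot all_order all_algebra.
From mathcomp Require Import complex.
From mathcomp Require Import all_classical all_reals all_analysis.
From mathcomp Require Import measurable_realfun zify lra ring.
Set Implicit Arguments.
Unset Strict Implicit.
Unset Printing Implicit Defensive.
Import Order.TTheory GRing.Theory Num.Theory.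
Import numFieldNormedType.Exports.
Local Open Scope classical_set_scope.
Local Open Scope ring_scope.
Local Open Scope complex_scope.

(** A function that vanishes on the negative half line, called causal below,
    turns an integral over [0, x] into a convolution over the whole line.  For a
    weight parameter [s], the causal functions with a finite integral of
    |f(x)| exp(- s x) form an algebra under convolution ([wn_conv], [convA]),
    and enlarging [s] makes the norm of any fixed kernel small.

    The kernel of the Prabhakar operator of order [m] and exponent [g] is a
    series of power functions [powker]; the powers form a semigroup under
    convolution ([econv_powker]), and Vandermonde's identity for Pochhammer
    symbols then shows that orders and exponents add ([conv_mlker]):
    P(m1, g1) P(m2, g2) = P(m1 + m2, g1 + g2).  Since P(k, 0) is integration
    divided by [k], each P(m, g) with m < k is injective, because
    P(k - m, - g) P(m, g) is ([prab_inj]).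

    Let a = (1 - nu) (k - mu) and c = nu (k - mu) be the orders of the inner and
    of the outer operator of the fractional derivative, and
    e = - gamma (1 - nu), h = - gamma nu their exponents, so that
    a + c + mu = k and e + h + gamma = 0.  Absolute continuity says that the
    inner integral of y is K plus the integral of its derivative G ([cac_ftc];
    the existence of the density is proved from the Jordan decomposition and the
    Radon-Nikodym theorem, [ac_density]).  Injectivity of the inner operator
    inverts this relation ([inner_inverse]): y is k P(k - a, - e) G plus K k
    times the kernel of order k - a and exponent - e.  The differential equation
    reads k P(c, h) G = lambda P(mu, delta) y + f.  Applying P(mu, gamma) turns
    its left side into k P(k - a, - e) G, that is y minus the boundary term, and
    nothing is lost because P(mu, gamma) is injective ([equation_volterra]).
    What results is the Volterra equation

      y = (boundary term) + P(mu, gamma) f + lambda P(2 mu, gamma + delta) y,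

    whose Neumann series is the asserted one: the n-th power of the last operator
    is P(2 n mu, n (gamma + delta)).  For [s] large the norm of lambda times that
    operator is at most 1/2 ([contraction_parameter]), so the series converges
    absolutely almost everywhere, solves the equation ([neumann_fixpoint]), and
    is the only solution on each interval (0, b) ([volterra_unique], applied
    before [b] by causality, as y is integrable on bounded intervals only).
    Identities between convolutions of integrable functions hold almost everywhere,
    which is the sense in which both the equation and its solution are understood. *)

(** * Statements almost everywhere and affine changes of variable *)
Section ae.
Context d (T : measurableType d) (R : realType) (m : {measure set T -> \bar R}).
Implicit Types P Q S : T -> Prop.

(** [filterS] with the filter fixed, so that its structure is not inferred again
    at each use. *)
Lemma aeS P Q : (forall x, P x -> Q x) ->
  {ae m, forall x, P x} -> {ae m, forall x, Q x}.
Proof. exact: filterS. Qed.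

Lemma aeS2 P Q S : (forall x, P x -> Q x -> S x) ->
  {ae m, forall x, P x} -> {ae m, forall x, Q x} -> {ae m, forall x, S x}.
Proof. exact: filterS2. Qed.

Lemma ae_and P Q : {ae m, forall x, P x} -> {ae m, forall x, Q x} ->
  {ae m, forall x, P x /\ Q x}.
Proof. by move=> hP hQ; exact: aeS2 hP hQ. Qed.

Lemma ae_all P : (forall x, P x) -> {ae m, forall x, P x}.
Proof. by move=> h; apply/aeW. Qed.
End ae.

Section ae_integral.
Local Open Scope ereal_scope.
Context d (T : measurableType d) (R : realType) (m : {measure set T -> \bar R}).
Import HBNNSimple.

Let ge0_ae_le (f g : T -> \bar R) : (forall x, 0 <= f x) ->
  (forall x, 0 <= g x) -> {ae m, forall x, f x = g x} ->
  \int[m]_x f x <= \int[m]_x g x.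
Proof.
move=> f0 g0 [N [mN N0 sN]].
rewrite ge0_integralTE// ge0_integralTE//.
apply: ge_ereal_sup => _ [h /= hf <-].
pose h' := proj_nnsfun h (measurableC mN).
have -> : sintegral m h = sintegral m h'.
  rewrite -!integralT_nnsfun; apply: ge0_ae_eq_integral => //.
  - by apply/measurable_EFinP.
  - by apply/measurable_EFinP.
  - by move=> x _; rewrite lee_fin.
  - by move=> x _; rewrite lee_fin.
  exists N; split => // x /= hx; apply: contrapT => nx; apply: hx => _.
  by rewrite /= mindicE mem_set ?mulr1.
apply: ereal_sup_ubound; exists h' => //= x.
rewrite /= mindicE; case: (boolP (x \in ~` N)) => [|_] /=.
  rewrite inE => nx; rewrite mulr1; have <- : f x = g x; last exact: hf.
  by apply: contrapT => fg; apply: nx; apply: sN.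
by rewrite mulr0.
Qed.

(** Measurability of the integrands is not assumed: an integral is a supremum
    over simple functions below the integrand, and these can be cut off on the
    null set where the two integrands differ. *)
Lemma ge0_ae_integral (f g : T -> \bar R) : (forall x, 0 <= f x) ->
  (forall x, 0 <= g x) -> {ae m, forall x, f x = g x} ->
  \int[m]_x f x = \int[m]_x g x.
Proof.
move=> f0 g0 fg; apply/eqP; rewrite eq_le !ge0_ae_le//.
by apply: filterS fg => x ->.
Qed.

Lemma ae_integral (D : set T) (f g : T -> \bar R) :
  {ae m, forall x, D x -> f x = g x} ->
  \int[m]_(x in D) f x = \int[m]_(x in D) g x.
Proof.
move=> fg; rewrite integral_mkcond [RHS]integral_mkcond integralE [RHS]integralE.
have {}fg : {ae m, forall x, (f \_ D) x = (g \_ D) x}.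
  by apply: filterS fg => x; rewrite /patch; case: ifPn => //; rewrite inE => + h; exact.
by congr (_ - _); apply: ge0_ae_integral => //; apply: filterS fg => x;
  rewrite ?funeposE ?funenegE => ->.
Qed.

Lemma ae_Rintegral (D : set T) (f g : T -> R) :
  {ae m, forall x, D x -> f x = g x} ->
  (\int[m]_(x in D) f x = \int[m]_(x in D) g x)%R.
Proof.
move=> fg; rewrite /Rintegral; congr fine; apply: ae_integral.
by apply: filterS fg => x h /h ->.
Qed.
End ae_integral.

Section affine.
Local Open Scope ereal_scope.
Context {R : realType}.
Local Notation mu := (@lebesgue_measure R).

Definition aff (c e : R) : measurableTypeR R -> measurableTypeR R := fun x => (c * x + e)%R.

Lemma measurable_aff (c e : R) : measurable_fun setT (aff c e).
Proof. by apply: measurable_funD => //; apply: measurable_funM. Qed.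

Let preim (c e a b : R) : (0 < c)%R ->
  aff c e @^-1` `]a, b]%classic = `]((a - e) / c)%R, ((b - e) / c)%R]%classic.
Proof.
move=> c0; apply/seteqP; split => x /=; rewrite /aff !in_itv/=.
  by move=> /andP[h1 h2]; rewrite ltr_pdivrMr// ler_pdivlMr// mulrC; apply/andP; split; lra.
by rewrite ltr_pdivrMr// ler_pdivlMr// (mulrC x) => /andP[h1 h2]; apply/andP; split; lra.
Qed.

(** A transparent definition, so that the pushforward can be computed on sets
    while its measure structure is kept. *)
Definition pushforward_meas (f : measurableTypeR R -> measurableTypeR R)
  (mf : measurable_fun setT f) : {measure set (measurableTypeR R) -> \bar R}.
Proof. by refine (pushforward mu f : {measure set _ -> \bar R}); exact: mf. Defined.

(** Both sides are measures that agree on half-open intervals. *)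
Lemma lebesgue_aff (c e : R) (A : set R) (c0 : (0 < c)%R) : measurable A ->
  mu A = c%:E * mu (aff c e @^-1` A).
Proof.
move=> mA.
pose cn : {nonneg R} := NngNum (ltW c0).
have mf' := measurable_aff c e.
pose m : {measure set (measurableTypeR R) -> \bar R} :=
   mscale cn (pushforward_meas mf').
rewrite -[RHS]/(m A).
apply: (lebesgue_measure_unique (mu := m)) => // _ [[a b]] _ <-.
rewrite /m /= /mscale/= /pushforward preim// !lebesgue_measure_itv/= !lte_fin.
rewrite ltr_pM2r ?invr_gt0// ltrD2r; case: ifP => _; last by rewrite mule0.
by rewrite -!EFinD -EFinM; congr EFin; field; rewrite gt_eqF.
Qed.

Lemma ge0_integral_aff (c e : R) (f : R -> \bar R) : (0 < c)%R ->
  measurable_fun setT f -> (forall x, 0 <= f x) ->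
  \int[mu]_x f x = c%:E * \int[mu]_x f (c * x + e)%R.
Proof.
move=> c0 mf f0.
pose cn : {nonneg R} := NngNum (ltW c0).
have mf' := measurable_aff c e.
pose m : {measure set (measurableTypeR R) -> \bar R} :=
   mscale cn (pushforward_meas mf').
transitivity (\int[m]_x f x).
  apply: eq_measure_integral => A mA _.
  exact: (lebesgue_aff e c0 mA).
rewrite ge0_integral_mscale//; congr (_ * _).
by rewrite (ge0_integral_pushforward (measurable_aff c e)).
Qed.

Lemma ge0_integral_shift (e : R) (f : R -> \bar R) :
  measurable_fun setT f -> (forall x, 0 <= f x) ->
  \int[mu]_x f (x - e)%R = \int[mu]_x f x.
Proof.
move=> mf f0; rewrite [RHS](@ge0_integral_aff 1%R (- e) f ltr01)// mul1e.
by apply: eq_integral => x _; rewrite mul1r.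
Qed.

Lemma integral_shift (e : R) (f : R -> \bar R) :
  measurable_fun setT f -> \int[mu]_x f (x - e)%R = \int[mu]_x f x.
Proof.
move=> mf; rewrite integralE [RHS]integralE; congr (_ - _).
  rewrite -[RHS](@ge0_integral_shift e f^\+)//; last exact: measurable_funepos.
  by apply: eq_integral => x _; rewrite !funeposE.
rewrite -[RHS](@ge0_integral_shift e f^\-)//; last exact: measurable_funeneg.
by apply: eq_integral => x _; rewrite !funenegE.
Qed.

Lemma ae_reflect (x : R) (P : R -> Prop) :
  {ae mu, forall t, P t} -> {ae mu, forall t, P (x - t)%R}.
Proof.
move=> [N [mN N0 sN]].
pose N1 := aff 1 x @^-1` N.
have mN1 : measurable N1.
  by rewrite -[X in measurable X]setTI; exact: measurable_aff.
have N10 : mu N1 = 0 by rewrite -N0 (lebesgue_aff x ltr01 mN) mul1e.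
exists ((-%R : _ -> measurableTypeR R) @^-1` N1); split.
- rewrite -[X in measurable X]setTI.
  exact: (@oppr_measurable R setT measurableT N1 mN1).
- by rewrite -[RHS]N10; exact: lebesgue_measureN.
- move=> t /= Pt; rewrite /N1/= /aff mul1r addrC; apply: sN => /=; exact: Pt.
Qed.
End affine.

(** * Complex functions of a real variable *)
Section n1.
Context {R : realType}.
Local Notation Re := complex.Re.
Local Notation Im := complex.Im.
Implicit Types z w : R[i].

Lemma ReD z w : Re (z + w) = Re z + Re w. Proof. by case: z w => [? ?] []. Qed.
Lemma ImD z w : Im (z + w) = Im z + Im w. Proof. by case: z w => [? ?] []. Qed.
Lemma ReN z : Re (- z) = - Re z. Proof. by case: z. Qed.
Lemma ImN z : Im (- z) = - Im z. Proof. by case: z. Qed.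
Lemma ReB z w : Re (z - w) = Re z - Re w. Proof. by rewrite ReD ReN. Qed.
Lemma ImB z w : Im (z - w) = Im z - Im w. Proof. by rewrite ImD ImN. Qed.
Lemma ReM z w : Re (z * w) = Re z * Re w - Im z * Im w.
Proof. by case: z w => [? ?] []. Qed.
Lemma ImM z w : Im (z * w) = Re z * Im w + Im z * Re w.
Proof. by case: z w => [? ?] []. Qed.
Lemma Re_sum I (r : seq I) (P : pred I) (F : I -> R[i]) :
  Re (\sum_(i <- r | P i) F i) = \sum_(i <- r | P i) Re (F i).
Proof. by elim/big_rec2: _ => // i y1 y2 _ <-; rewrite ReD. Qed.
Lemma Im_sum I (r : seq I) (P : pred I) (F : I -> R[i]) :
  Im (\sum_(i <- r | P i) F i) = \sum_(i <- r | P i) Im (F i).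
Proof. by elim/big_rec2: _ => // i y1 y2 _ <-; rewrite ImD. Qed.
Lemma complex_ext z w : Re z = Re w -> Im z = Im w -> z = w.
Proof. by case: z w => [? ?] [? ?] /= -> ->. Qed.

(** The taxicab norm on complex numbers. It is real-valued, submultiplicative,
    and its integral is the sum of those of the real and imaginary parts, which
    makes it more convenient than the complex-valued modulus. *)
Definition n1 z : R := `|Re z| + `|Im z|.

Lemma n1_ge0 z : 0 <= n1 z. Proof. exact: addr_ge0. Qed.
Lemma n1_0 : n1 0 = 0. Proof. by rewrite /n1 /= normr0 addr0. Qed.
Lemma n1_eq0 z : n1 z = 0 -> z = 0.
Proof.
move=> /eqP; rewrite paddr_eq0// !normr_eq0 => /andP[/eqP h1 /eqP h2].
exact: complex_ext.
Qed.
Lemma n1N z : n1 (- z) = n1 z. Proof. by rewrite /n1 ReN ImN !normrN. Qed.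
Lemma n1D z w : n1 (z + w) <= n1 z + n1 w.
Proof.
by rewrite /n1 ReD ImD addrACA lerD// ler_normD.
Qed.
Lemma n1B z w : n1 (z - w) <= n1 z + n1 w.
Proof. by rewrite -(n1N w) n1D. Qed.
Lemma n1M z w : n1 (z * w) <= n1 z * n1 w.
Proof.
rewrite /n1 ReM ImM mulrDl !mulrDr.
have h1 := ler_normB (Re z * Re w) (Im z * Im w).
have h2 := ler_normD (Re z * Im w) (Im z * Re w).
by rewrite !normrM in h1 h2; lra.
Qed.
Lemma n1_real (r : R) : n1 r%:C = `|r|. Proof. by rewrite /n1 /= normr0 addr0. Qed.
Lemma n1_sum I (r : seq I) (P : pred I) (F : I -> R[i]) :
  n1 (\sum_(i <- r | P i) F i) <= \sum_(i <- r | P i) n1 (F i).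
Proof.
elim/big_rec2: _ => [|i y1 y2 _ h]; first by rewrite n1_0.
by apply: le_trans (n1D _ _) _; rewrite lerD2l.
Qed.
Lemma n1X z n : n1 (z ^+ n) <= n1 z ^+ n.
Proof.
elim: n => [|n ih]; first by rewrite !expr0 /n1 /= normr1 normr0 addr0.
by rewrite !exprS (le_trans (n1M _ _))// ler_wpM2l// n1_ge0.
Qed.
Lemma Re_le_n1 z : `|Re z| <= n1 z. Proof. by rewrite lerDl. Qed.
Lemma Im_le_n1 z : `|Im z| <= n1 z. Proof. by rewrite lerDr. Qed.
End n1.

Section cmeasurable.
Context d (T : measurableType d) {R : realType}.
Local Notation Re := complex.Re.
Local Notation Im := complex.Im.
Implicit Types f g : T -> R[i].

Definition cmeas f := measurable_fun setT (fun x => Re (f x)) /\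
  measurable_fun setT (fun x => Im (f x)).

Lemma cmeas_cst z : cmeas (fun=> z).
Proof. by split; exact: measurable_cst. Qed.
Lemma cmeasD f g : cmeas f -> cmeas g -> cmeas (fun x => f x + g x).
Proof.
move=> [f1 f2] [g1 g2]; split.
  by under eq_fun do rewrite ReD; exact: measurable_funD.
by under eq_fun do rewrite ImD; exact: measurable_funD.
Qed.
Lemma cmeasN f : cmeas f -> cmeas (fun x => - f x).
Proof.
move=> [f1 f2]; split.
  by under eq_fun do rewrite ReN; exact: measurableT_comp.
by under eq_fun do rewrite ImN; exact: measurableT_comp.
Qed.
Lemma cmeasB f g : cmeas f -> cmeas g -> cmeas (fun x => f x - g x).
Proof. by move=> mf mg; apply: cmeasD => //; exact: cmeasN. Qed.
Lemma cmeasM f g : cmeas f -> cmeas g -> cmeas (fun x => f x * g x).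
Proof.
move=> [f1 f2] [g1 g2]; split.
  by under eq_fun do rewrite ReM; apply: measurable_funB; exact: measurable_funM.
by under eq_fun do rewrite ImM; apply: measurable_funD; exact: measurable_funM.
Qed.
Lemma cmeas_real (f : T -> R) : measurable_fun setT f -> cmeas (fun x => (f x)%:C).
Proof. by move=> mf; split => //=. Qed.
Lemma cmeas_sum I (r : seq I) (P : pred I) (F : I -> T -> R[i]) :
  (forall i, cmeas (F i)) -> cmeas (fun x => \sum_(i <- r | P i) F i x).
Proof.
move=> mF; elim: r => [|i r ih].
  by under eq_fun do rewrite big_nil; exact: cmeas_cst.
under eq_fun do rewrite big_cons.
by case: (P i) => //; apply: cmeasD.
Qed.
Lemma cmeas_if f g (b : T -> bool) : measurable_fun setT b ->
  cmeas f -> cmeas g -> cmeas (fun x => if b x then f x else g x).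
Proof.
move=> mb [f1 f2] [g1 g2]; split.
  rewrite (_ : (fun x => _) = fun x => if b x then Re (f x) else Re (g x)).
    exact: measurable_fun_ifT.
  by apply/funext => x; case: (b x).
rewrite (_ : (fun x => _) = fun x => if b x then Im (f x) else Im (g x)).
  exact: measurable_fun_ifT.
by apply/funext => x; case: (b x).
Qed.
Lemma measurable_n1 f : cmeas f -> measurable_fun setT (fun x => n1 (f x)).
Proof.
by move=> [f1 f2]; apply: measurable_funD; exact: measurableT_comp.
Qed.
Lemma measurable_En1 f : cmeas f -> measurable_fun setT (fun x => (n1 (f x))%:E).
Proof. by move=> mf; apply/measurable_EFinP; exact: measurable_n1. Qed.
End cmeasurable.

Lemma cmeas_comp d1 d2 (T1 : measurableType d1) (T2 : measurableType d2)
    (R : realType) (h : T1 -> T2) (f : T2 -> R[i]) :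
  cmeas f -> measurable_fun setT h -> cmeas (fun x => f (h x)).
Proof.
move=> [f1 f2] mh; split.
  exact: (measurableT_comp (f := fun x => complex.Re (f x))).
exact: (measurableT_comp (f := fun x => complex.Im (f x))).
Qed.

Section cintegral_theory.
Context {R : realType}.
Local Notation mu := (@lebesgue_measure R).
Local Notation Re := complex.Re.
Local Notation Im := complex.Im.
Implicit Types f g h : R -> R[i].

Definition cint h : R[i] := cintegral setT h.

Definition cL1 h := cmeas h /\ (\int[mu]_x (n1 (h x))%:E < +oo)%E.

Lemma cL1_Re h : cL1 h -> mu.-integrable setT (fun x => (Re (h x))%:E).
Proof.
move=> [mh ih]; apply/integrableP; split; first by apply/measurable_EFinP; case: mh.
apply: le_lt_trans ih; apply: ge0_le_integral => //.
- by apply/measurable_EFinP/measurableT_comp => //; case: mh.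
- exact: measurable_En1.
- by move=> x _; rewrite lee_fin Re_le_n1.
Qed.

Lemma cL1_Im h : cL1 h -> mu.-integrable setT (fun x => (Im (h x))%:E).
Proof.
move=> [mh ih]; apply/integrableP; split; first by apply/measurable_EFinP; case: mh.
apply: le_lt_trans ih; apply: ge0_le_integral => //.
- by apply/measurable_EFinP/measurableT_comp => //; case: mh.
- exact: measurable_En1.
- by move=> x _; rewrite lee_fin Im_le_n1.
Qed.

Lemma cL1_le h (g : R -> R) : cmeas h -> measurable_fun setT g ->
  (forall x, n1 (h x) <= g x) -> (\int[mu]_x (g x)%:E < +oo)%E -> cL1 h.
Proof.
move=> mh mg hg ig; split => //; apply: le_lt_trans ig.
apply: ge0_le_integral => //.
- by move=> x _; rewrite lee_fin n1_ge0.
- exact: measurable_En1.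
- by apply/measurable_EFinP.
- by move=> x _; rewrite lee_fin.
Qed.

Lemma cintD f g : cL1 f -> cL1 g -> cint (fun x => f x + g x) = cint f + cint g.
Proof.
move=> If Ig; apply: complex_ext; rewrite ?ReD ?ImD /=.
  under eq_Rintegral do rewrite ReD.
  by rewrite RintegralD//; exact: cL1_Re.
under eq_Rintegral do rewrite ImD.
by rewrite RintegralD//; exact: cL1_Im.
Qed.

Lemma cintZ (c : R[i]) f : cL1 f -> cint (fun x => c * f x) = c * cint f.
Proof.
move=> If; have [I1 I2] := (cL1_Re If, cL1_Im If).
have Z (r : R) (g : R -> R) : mu.-integrable setT (fun x => (g x)%:E) ->
    mu.-integrable setT (fun x => (r * g x)%:E).
  move=> Ig; under eq_fun do rewrite EFinM; exact: integrableZl.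
apply: complex_ext; rewrite ?ReM ?ImM /=.
  under eq_Rintegral do rewrite ReM.
  by rewrite RintegralB ?RintegralZl//; exact: Z.
under eq_Rintegral do rewrite ImM.
by rewrite RintegralD ?RintegralZl//; exact: Z.
Qed.

Lemma cint_ae f g : {ae mu, forall x, f x = g x} -> cint f = cint g.
Proof.
move=> fg; congr (_ +i* _); apply: ae_Rintegral;
  by apply: aeS fg => x /= -> _.
Qed.

Lemma n1_cint f : cmeas f -> ((n1 (cint f))%:E <= \int[mu]_x (n1 (f x))%:E)%E.
Proof.
move=> mf; have [If|] := ltP (\int[mu]_x (n1 (f x))%:E)%E +oo%E; last first.
  by rewrite leye_eq => /eqP ->; rewrite leey.
have L : cL1 f := conj mf If.
have [I1 I2] := (cL1_Re L, cL1_Im L).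
rewrite /n1 EFinD.
under eq_integral do rewrite EFinD.
have [m1 m2] := mf.
rewrite ge0_integralD//; last 2 first.
- by apply/measurable_EFinP; exact: measurableT_comp.
- by apply/measurable_EFinP; exact: measurableT_comp.
apply: leeD.
  rewrite -[leRHS]fineK; last exact: (integrable_fin_num measurableT (integrable_norm I1)).
  by rewrite lee_fin; exact: le_normr_Rintegral.
rewrite -[leRHS]fineK; last exact: (integrable_fin_num measurableT (integrable_norm I2)).
by rewrite lee_fin; exact: le_normr_Rintegral.
Qed.

Lemma cint_shift (e : R) f : cmeas f -> cint (fun x => f (x - e)) = cint f.
Proof.
move=> [m1 m2]; congr (_ +i* _); rewrite /Rintegral; congr fine.
  apply: (@integral_shift _ e (fun x => (Re (f x))%:E)).
  by apply/measurable_EFinP.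
apply: (@integral_shift _ e (fun x => (Im (f x))%:E)).
by apply/measurable_EFinP.
Qed.
End cintegral_theory.

(** * Fubini's theorem and convolution of nonnegative functions *)
Section fubini.
Context {R : realType}.
Local Notation mu := (@lebesgue_measure R).
Local Notation Re := complex.Re.
Local Notation Im := complex.Im.

Lemma Rintegral_fubini (g : R * R -> R) : measurable_fun setT g ->
  (\int[mu]_x \int[mu]_y `|(g (x, y))%:E| < +oo)%E ->
  \int[mu]_x \int[mu]_y g (x, y) = \int[mu]_y \int[mu]_x g (x, y).
Proof.
move=> mg ig.
have mG : measurable_fun setT (EFin \o g) by apply/measurable_EFinP.
have IG : (mu \x mu)%E.-integrable setT (EFin \o g).
  by apply/integrable12ltyP.
rewrite /Rintegral; congr fine.
transitivity (\int[mu]_x \int[mu]_y (g (x, y))%:E)%E.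
  apply: ae_integral; apply: aeS (ae_integrable1 IG) => x Ix _.
  by rewrite fineK//; exact: (integrable_fin_num measurableT Ix).
rewrite (Fubini IG).
apply: ae_integral; apply: aeS (ae_integrable2 IG) => x Ix _.
by rewrite /= fineK//; exact: (integrable_fin_num measurableT Ix).
Qed.

Lemma cint_fubini (F : R * R -> R[i]) : cmeas F ->
  (\int[mu]_x \int[mu]_y (n1 (F (x, y)))%:E < +oo)%E ->
  cint (fun x => cint (fun y => F (x, y))) =
  cint (fun y => cint (fun x => F (x, y))).
Proof.
move=> mF iF; have [m1 m2] := mF.
have H (g : R * R -> R) : measurable_fun setT g -> (forall z, `|g z| <= n1 (F z)) ->
   (\int[mu]_x \int[mu]_y `|(g (x, y))%:E| < +oo)%E.
  move=> mg gF; apply: le_lt_trans iF; apply: ge0_le_integral => //.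
  - by move=> x _; exact: integral_ge0.
  - apply: (@measurable_fun_fubini_tonelli_F _ _ _ _ _ mu (fun z => `|(g z)%:E|)%E) => //.
    by apply/measurable_EFinP; exact: measurableT_comp.
  - apply: (@measurable_fun_fubini_tonelli_F _ _ _ _ _ mu (fun z => (n1 (F z))%:E)).
      exact: measurable_En1.
    by move=> z; rewrite lee_fin n1_ge0.
  - move=> x _; apply: ge0_le_integral => //.
    + apply/measurable_EFinP/measurableT_comp => //.
      exact: (measurableT_comp mg).
    + apply: measurable_En1; apply: cmeas_comp => //.
    + by move=> y _; rewrite lee_fin.
congr (_ +i* _) => /=.
  exact: (Rintegral_fubini m1 (H _ m1 (fun z => Re_le_n1 _))).
exact: (Rintegral_fubini m2 (H _ m2 (fun z => Im_le_n1 _))).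
Qed.
End fubini.

Section econv.
Context {R : realType}.
Local Notation mu := (@lebesgue_measure R).
Local Open Scope ereal_scope.
Implicit Types u v : R -> \bar R.

Definition econv u v (x : R) := \int[mu]_t (u (x - t)%R * v t).

Definition wt (s x : R) : R := expR (- (s * x)).

(** The Laplace transform of [u] at the real point [s]; for a nonnegative
    function it is also a weighted norm. *)
Definition ewn (s : R) u := \int[mu]_x ((wt s x)%:E * u x).

Lemma wt_gt0 s x : (0 < wt s x)%R. Proof. exact: expR_gt0. Qed.
Lemma wt_ge0 s x : (0 <= wt s x)%R. Proof. exact: expR_ge0. Qed.
Lemma wtD s x y : wt s (x + y)%R = (wt s x * wt s y)%R.
Proof. by rewrite /wt mulrDr opprD expRD. Qed.
Lemma measurable_wt s : measurable_fun setT (wt s).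
Proof.
by apply: measurableT_comp => //; apply: measurableT_comp => //.
Qed.
Lemma measurable_Ewt s : measurable_fun setT (EFin \o wt s).
Proof. by apply/measurable_EFinP; exact: measurable_wt. Qed.

Lemma measurable_subr12 : measurable_fun setT (fun z : R * R => z.1 - z.2)%R.
Proof. exact: measurable_funB. Qed.

Lemma measurable_econv_body u v : measurable_fun setT u -> measurable_fun setT v ->
  measurable_fun setT (fun z : R * R => u (z.1 - z.2)%R * v z.2).
Proof.
move=> mu' mv; apply: emeasurable_funM.
  exact: (measurableT_comp mu' measurable_subr12).
exact: (measurableT_comp mv).
Qed.

Lemma measurable_econv u v : measurable_fun setT u -> measurable_fun setT v ->
  (forall x, 0 <= u x) -> (forall x, 0 <= v x) -> measurable_fun setT (econv u v).
Proof.
move=> mu' mv u0 v0.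
rewrite (_ : econv u v = fubini_F mu (fun z : R * R => u (z.1 - z.2)%R * v z.2))//.
apply: measurable_fun_fubini_tonelli_F; first exact: measurable_econv_body.
by move=> z; exact: mule_ge0.
Qed.

Lemma econv_ge0 u v x : (forall x, 0 <= u x) -> (forall x, 0 <= v x) ->
  0 <= econv u v x.
Proof. by move=> u0 v0; apply: integral_ge0 => t _; exact: mule_ge0. Qed.

Lemma ewn_ge0 s u : (forall x, 0 <= u x) -> 0 <= ewn s u.
Proof. by move=> u0; apply: integral_ge0 => t _; rewrite mule_ge0// lee_fin wt_ge0. Qed.

(** Tonelli's theorem: the weight is an exponential, hence multiplicative under
    the splitting x = (x - t) + t. *)
Lemma ewn_econv s u v : measurable_fun setT u -> measurable_fun setT v ->
  (forall x, 0 <= u x) -> (forall x, 0 <= v x) ->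
  ewn s (econv u v) = ewn s u * ewn s v.
Proof.
move=> mu' mv u0 v0.
pose W u x := (wt s x)%:E * u x.
have W0 u' : (forall x, 0 <= u' x) -> forall x, 0 <= W u' x.
  by move=> h x; rewrite mule_ge0// lee_fin wt_ge0.
have mW u' : measurable_fun setT u' -> measurable_fun setT (W u').
  by move=> h; apply: emeasurable_funM => //; exact: measurable_Ewt.
transitivity (\int[mu]_x \int[mu]_t (W u (x - t)%R * W v t)).
  apply: eq_integral => x _; rewrite /econv -ge0_integralZl//.
  - apply: eq_integral => t _.
    have -> : wt s x = (wt s (x - t) * wt s t)%R by rewrite -wtD subrK.
    by rewrite /W EFinM muleACA.
  - apply: (measurable_fun_pair2 (f := fun z : R * R => u (z.1 - z.2)%R * v z.2)).
    exact: measurable_econv_body.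
  - by move=> t _; exact: mule_ge0.
  - by rewrite lee_fin wt_ge0.
rewrite (@fubini_tonelli _ _ _ _ _ mu mu (fun z => W u (z.1 - z.2)%R * W v z.2)); first last.
- by move=> z; rewrite mule_ge0// W0.
- by apply: measurable_econv_body; exact: mW.
transitivity (\int[mu]_t (ewn s u * W v t)).
  apply: eq_integral => t _.
  transitivity (\int[mu]_x (W u (x - t)%R) * W v t).
    apply: (@ge0_integralZr _ _ _ mu setT measurableT (fun x => W u (x - t)%R) _ (W v t)).
    - by apply: (measurableT_comp (mW _ mu')); exact: measurable_funB.
    - by move=> x _; exact: W0.
    - exact: W0.
  congr (_ * _); rewrite (@ge0_integral_shift _ t (W u)); [by []|exact: mW|].
  exact: W0.
rewrite ge0_integralZl//; [exact: mW|by move=> t _; exact: W0|exact: ewn_ge0].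
Qed.

Lemma ewn_ae_fin s u : measurable_fun setT u -> (forall x, 0 <= u x) ->
  ewn s u < +oo -> {ae mu, forall x, u x < +oo}.
Proof.
move=> mu' u0 su.
have I : mu.-integrable setT (fun x => (wt s x)%:E * u x).
  apply/integrableP; split.
    by apply: emeasurable_funM => //; exact: measurable_Ewt.
  rewrite (_ : integral _ _ _ = ewn s u)//; apply: eq_integral => x _.
  by rewrite gee0_abs// mule_ge0// lee_fin wt_ge0.
apply: aeS (integrable_ae measurableT I) => x /(_ Logic.I).
case: (u x) (u0 x) => [r|//|//]; first by rewrite ltry.
by rewrite gt0_muley// lte_fin wt_gt0.
Qed.

Lemma ewn_eq0 s u : measurable_fun setT u -> (forall x, 0 <= u x) ->
  ewn s u = 0 -> {ae mu, forall x, u x = 0}.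
Proof.
move=> mu' u0 su.
have m : measurable_fun setT (fun x => (wt s x)%:E * u x).
  by apply: emeasurable_funM => //; exact: measurable_Ewt.
have /(ae_eq_integral_abs mu measurableT m) : \int[mu]_x `|(wt s x)%:E * u x| = 0.
  rewrite -[RHS]su; apply: eq_integral => x _.
  by rewrite gee0_abs// mule_ge0// lee_fin wt_ge0.
apply: aeS => x /(_ Logic.I)/= /eqP; rewrite mule_eq0 => /orP[|/eqP//].
by rewrite eqe gt_eqF// wt_gt0.
Qed.
End econv.

(** * The weighted convolution algebra of causal functions *)
Section Ls.
Context {R : realType}.
Local Notation mu := (@lebesgue_measure R).
Local Notation Re := complex.Re.
Local Notation Im := complex.Im.
Implicit Types f g h : R -> R[i].

Definition en f (x : R) : \bar R := (n1 (f x))%:E.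

Lemma en_ge0 f x : (0 <= en f x)%E. Proof. by rewrite lee_fin n1_ge0. Qed.
Lemma measurable_en f : cmeas f -> measurable_fun setT (en f).
Proof. exact: measurable_En1. Qed.
#[local] Hint Resolve en_ge0 measurable_en : core.

Definition wn s f := ewn s (en f).

Definition causal f := forall x, x <= 0 -> f x = 0.

(** The algebra in which all identities between operators are proved: a causal
    function of at most exponential growth, in the mean, belongs to it for [s]
    large. *)
Definition Ls s f := [/\ cmeas f, causal f & (wn s f < +oo)%E].

Definition conv f g (x : R) : R[i] := cint (fun t => f (x - t) * g t).

Lemma wn_ge0 s f : (0 <= wn s f)%E. Proof. exact: ewn_ge0. Qed.

Lemma measurable_wen s f : cmeas f ->
  measurable_fun setT (fun x => (wt s x)%:E * en f x)%E.
Proof.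
by move=> mf; apply: emeasurable_funM; [exact: measurable_Ewt|exact: measurable_en].
Qed.

Lemma wen_ge0 s f x : (0 <= (wt s x)%:E * en f x)%E.
Proof. by rewrite mule_ge0// lee_fin wt_ge0. Qed.
#[local] Hint Resolve wen_ge0 measurable_wen : core.

Lemma wn_le s f g : cmeas f -> cmeas g -> (forall x, n1 (f x) <= n1 (g x)) ->
  (wn s f <= wn s g)%E.
Proof.
move=> mf mg fg; apply: ge0_le_integral; rewrite ?measurable_wen//.
- exact: measurable_wen.
- exact: measurable_wen.
- by move=> x _; rewrite lee_wpmul2l// lee_fin// wt_ge0.
Qed.

Lemma wn_le2 s f g h : cmeas f -> cmeas g -> cmeas h ->
  (forall x, n1 (f x) <= n1 (g x) + n1 (h x)) ->
  (wn s f <= wn s g + wn s h)%E.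
Proof.
move=> mf mg mh fg.
rewrite /wn/ewn -ge0_integralD//; last 2 first.
- exact: measurable_wen.
- exact: measurable_wen.
apply: ge0_le_integral => //.
- exact: measurable_wen.
- by apply: emeasurable_funD; exact: measurable_wen.
- move=> x _; rewrite -ge0_muleDr// lee_wpmul2l//; first by rewrite lee_fin wt_ge0.
  by rewrite lee_fin.
Qed.

Lemma wnD s f g : cmeas f -> cmeas g ->
  (wn s (fun x => f x + g x)%R <= wn s f + wn s g)%E.
Proof.
by move=> mf mg; apply: wn_le2 => //; [exact: cmeasD|move=> x; exact: n1D].
Qed.

Lemma wnB s f g : cmeas f -> cmeas g ->
  (wn s (fun x => f x - g x)%R <= wn s f + wn s g)%E.
Proof.
by move=> mf mg; apply: wn_le2 => //; [exact: cmeasB|move=> x; exact: n1B].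
Qed.

Lemma wnZ s (c : R[i]) f : cmeas f ->
  (wn s (fun x => c * f x)%R <= (n1 c)%:E * wn s f)%E.
Proof.
move=> mf; rewrite /wn /ewn -ge0_integralZl_EFin//.
- apply: ge0_le_integral => //.
  + by apply: measurable_wen; apply: cmeasM => //; exact: cmeas_cst.
  + by apply: measurable_funeM; exact: measurable_wen.
  + move=> x _; rewrite muleCA lee_wpmul2l//; first by rewrite lee_fin wt_ge0.
    by rewrite -EFinM lee_fin n1M.
- exact: measurable_wen.
- exact: n1_ge0.
Qed.

Lemma wn_ae s f g : {ae mu, forall x, f x = g x} -> wn s f = wn s g.
Proof. by move=> fg; apply: ae_integral; apply: aeS fg => x; rewrite /en => ->. Qed.

Lemma wn_eq0 s f : cmeas f -> wn s f = 0%E -> {ae mu, forall x, f x = 0}.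
Proof.
move=> mf /ewn_eq0 H; apply: aeS (H _ _) => //; last exact: measurable_en.
by move=> x [] /n1_eq0.
Qed.

Lemma wn_fin s f : Ls s f -> wn s f \is a fin_num.
Proof. by move=> [_ _ h]; rewrite ge0_fin_numE// wn_ge0. Qed.

Lemma Ls0 s : Ls s (fun=> 0).
Proof.
split; [exact: cmeas_cst|by []|].
rewrite /wn /ewn (_ : (fun x => _) = cst 0%E) ?integral0//.
by apply/funext => x; rewrite /en n1_0 mule0.
Qed.

Lemma LsD s f g : Ls s f -> Ls s g -> Ls s (fun x => f x + g x).
Proof.
move=> [mf cf wf] [mg cg wg]; split; first exact: cmeasD.
  by move=> x x0; rewrite cf// cg// addr0.
by apply: le_lt_trans (wnD _ mf mg) _; exact: lte_add_pinfty.
Qed.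

Lemma LsZ s c f : Ls s f -> Ls s (fun x => c * f x).
Proof.
move=> [mf cf wf]; split.
- by apply: cmeasM => //; exact: cmeas_cst.
- by move=> x x0; rewrite cf// mulr0.
apply: le_lt_trans (wnZ _ _ mf) _; apply: lte_mul_pinfty => //.
by rewrite lee_fin n1_ge0.
Qed.

Lemma LsB s f g : Ls s f -> Ls s g -> Ls s (fun x => f x - g x).
Proof.
move=> [mf cf wf] [mg cg wg]; split; first exact: cmeasB.
  by move=> x x0; rewrite cf// cg// subr0.
by apply: le_lt_trans (wnB _ mf mg) _; exact: lte_add_pinfty.
Qed.

Lemma Ls_sum s I (r : seq I) (P : pred I) (F : I -> R -> R[i]) :
  (forall i, Ls s (F i)) -> Ls s (fun x => \sum_(i <- r | P i) F i x).
Proof.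
move=> mF; elim: r => [|i r ih].
  by under eq_fun do rewrite big_nil; exact: Ls0.
under eq_fun do rewrite big_cons.
by case: (P i) => //; apply: LsD.
Qed.

Lemma wn_sum s I (r : seq I) (P : pred I) (F : I -> R -> R[i]) :
  (forall i, cmeas (F i)) ->
  (wn s (fun x => \sum_(i <- r | P i) F i x)%R <= \sum_(i <- r | P i) wn s (F i))%E.
Proof.
move=> mF; elim: r => [|i r ih].
  rewrite big_nil; under [X in wn s X]eq_fun do rewrite big_nil.
  rewrite /wn /ewn (_ : (fun x => _) = cst 0%E) ?integral0//.
  by apply/funext => x; rewrite /en n1_0 mule0.
rewrite big_cons; under [X in wn s X]eq_fun do rewrite big_cons.
case: (P i) => //; apply: (le_trans (wnD _ _ _)); rewrite ?leeD2l//.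
exact: cmeas_sum.
Qed.

Lemma cmeas_conv_body f g : cmeas f -> cmeas g ->
  cmeas (fun z : R * R => f (z.1 - z.2) * g z.2).
Proof.
move=> mf mg; apply: cmeasM.
  exact: (cmeas_comp mf measurable_subr12).
by apply: (cmeas_comp mg).
Qed.

Lemma cmeas_conv_slice f g (x : R) : cmeas f -> cmeas g ->
  cmeas (fun t : R => f (x - t) * g t).
Proof.
move=> mf mg; apply: cmeasM => //.
by apply: (cmeas_comp mf); exact: measurable_funB.
Qed.

Lemma conv_good f g x : cmeas f -> cmeas g -> (econv (en f) (en g) x < +oo)%E ->
  cL1 (fun t => f (x - t) * g t).
Proof.
move=> mf mg fin; apply: (@cL1_le _ _ (fun t => n1 (f (x - t)) * n1 (g t))) => //.
- exact: cmeas_conv_slice.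
- apply: measurable_funM; last exact: measurable_n1.
  by apply: (measurableT_comp (measurable_n1 mf)); exact: measurable_funB.
- by move=> t; exact: n1M.
Qed.

Lemma n1_conv f g x : cmeas f -> cmeas g ->
  ((n1 (conv f g x))%:E <= econv (en f) (en g) x)%E.
Proof.
move=> mf mg; apply: le_trans (n1_cint _) _; first exact: cmeas_conv_slice.
apply: ge0_le_integral => //.
- by move=> t _; rewrite lee_fin n1_ge0.
- by apply: measurable_En1; exact: cmeas_conv_slice.
- apply: (measurable_fun_pair2 (f := fun z : R * R => en f (z.1 - z.2)%R * en g z.2)%E).
  by apply: measurable_econv_body; exact: measurable_en.
- by move=> t _; rewrite lee_fin n1M.
Qed.

Lemma measurable_Rint_slice (F : R * R -> R) : measurable_fun setT F ->
  measurable_fun setT (fun x => \int[mu]_y F (x, y)).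
Proof.
move=> mF; apply: measurableT_comp => //.
have mE : measurable_fun setT (EFin \o F) by apply/measurable_EFinP.
rewrite [X in measurable_fun _ X](_ : _ =
  fun x => fubini_F mu (EFin \o F)^\+ x - fubini_F mu (EFin \o F)^\- x)%E.
  apply: emeasurable_funB; apply: measurable_fun_fubini_tonelli_F => //.
    exact: measurable_funepos.
  exact: measurable_funeneg.
apply/funext => x; rewrite integralE; congr (_ - _)%E.
  by apply: eq_integral => y _; rewrite !funeposE.
by apply: eq_integral => y _; rewrite !funenegE.
Qed.

Lemma cmeas_conv f g : cmeas f -> cmeas g -> cmeas (conv f g).
Proof.
move=> mf mg; have [m1 m2] := cmeas_conv_body mf mg.
split.
  exact: (measurable_Rint_slice m1).
exact: (measurable_Rint_slice m2).
Qed.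

Lemma causal_conv f g : causal f -> causal g -> causal (conv f g).
Proof.
move=> cf cg x x0; rewrite /conv (_ : (fun t => _) = fun=> 0).
  by rewrite /cint /cintegral /Rintegral/= !integral0.
apply/funext => t; have [t0|t0] := leP t 0; first by rewrite cg// mulr0.
by rewrite cf ?mul0r//; lra.
Qed.

Lemma wn_conv s f g : cmeas f -> cmeas g ->
  (wn s (conv f g) <= wn s f * wn s g)%E.
Proof.
move=> mf mg; rewrite /wn -ewn_econv//; try exact: measurable_en.
apply: ge0_le_integral => //.
- by apply: measurable_wen; exact: cmeas_conv.
- apply: emeasurable_funM; first exact: measurable_Ewt.
  by apply: measurable_econv => //; exact: measurable_en.
- move=> x _; rewrite lee_wpmul2l//; first by rewrite lee_fin wt_ge0.
  exact: n1_conv.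
Qed.

Lemma Ls_conv s f g : Ls s f -> Ls s g -> Ls s (conv f g).
Proof.
move=> [mf cf wf] [mg cg wg]; split; [exact: cmeas_conv|exact: causal_conv|].
apply: le_lt_trans (wn_conv _ mf mg) _; apply: lte_mul_pinfty => //; first exact: wn_ge0.
by rewrite ge0_fin_numE// wn_ge0.
Qed.

(** The convolution integral converges absolutely at almost every point, since
    the convolution of the norms has a finite weighted integral. *)
Lemma ae_good s f g : Ls s f -> Ls s g ->
  {ae mu, forall x, (econv (en f) (en g) x < +oo)%E}.
Proof.
move=> [mf cf wf] [mg cg wg]; apply: (@ewn_ae_fin _ s).
- by apply: measurable_econv => //; exact: measurable_en.
- by move=> x; exact: econv_ge0.
rewrite ewn_econv//; try exact: measurable_en.
apply: lte_mul_pinfty => //; first exact: wn_ge0.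
by rewrite ge0_fin_numE// wn_ge0.
Qed.

Lemma convDr s f g h : Ls s f -> Ls s g -> Ls s h ->
  {ae mu, forall x, conv f (fun t => g t + h t) x = conv f g x + conv f h x}.
Proof.
move=> Lf Lg Lh; have [mf _ _] := Lf; have [mg _ _] := Lg; have [mh _ _] := Lh.
apply: aeS2 (ae_good Lf Lg) (ae_good Lf Lh) => x fg fh.
rewrite /conv -cintD; [|exact: conv_good|exact: conv_good].
by congr cint; apply/funext => t; rewrite mulrDr.
Qed.

Lemma convDl s f g h : Ls s f -> Ls s g -> Ls s h ->
  {ae mu, forall x, conv (fun t => g t + h t) f x = conv g f x + conv h f x}.
Proof.
move=> Lf Lg Lh; have [mf _ _] := Lf; have [mg _ _] := Lg; have [mh _ _] := Lh.
apply: aeS2 (ae_good Lg Lf) (ae_good Lh Lf) => x fg fh.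
rewrite /conv -cintD; [|exact: conv_good|exact: conv_good].
by congr cint; apply/funext => t; rewrite mulrDl.
Qed.

Lemma convZr s c f g : Ls s f -> Ls s g ->
  {ae mu, forall x, conv f (fun t => c * g t) x = c * conv f g x}.
Proof.
move=> Lf Lg; have [mf _ _] := Lf; have [mg _ _] := Lg.
apply: aeS (ae_good Lf Lg) => x fg.
rewrite /conv -cintZ; last exact: conv_good.
by congr cint; apply/funext => t; rewrite mulrCA.
Qed.

Lemma convZl s c f g : Ls s f -> Ls s g ->
  {ae mu, forall x, conv (fun t => c * f t) g x = c * conv f g x}.
Proof.
move=> Lf Lg; have [mf _ _] := Lf; have [mg _ _] := Lg.
apply: aeS (ae_good Lf Lg) => x fg.
rewrite /conv -cintZ; last exact: conv_good.
by congr cint; apply/funext => t; rewrite mulrA.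
Qed.

Lemma convBr s f g h : Ls s f -> Ls s g -> Ls s h ->
  {ae mu, forall x, conv f (fun t => g t - h t) x = conv f g x - conv f h x}.
Proof.
move=> Lf Lg Lh.
have E : (fun t => g t - h t) = (fun t => g t + (-1) * h t).
  by apply/funext => t; rewrite mulN1r.
apply: aeS2 (convDr Lf Lg (LsZ (-1) Lh)) (convZr (-1) Lf Lh) => x.
by rewrite E => -> ->; rewrite mulN1r.
Qed.

Lemma convBl s f g h : Ls s f -> Ls s g -> Ls s h ->
  {ae mu, forall x, conv (fun t => g t - h t) f x = conv g f x - conv h f x}.
Proof.
move=> Lf Lg Lh.
have E : (fun t => g t - h t) = (fun t => g t + (-1) * h t).
  by apply/funext => t; rewrite mulN1r.
apply: aeS2 (convDl Lf Lg (LsZ (-1) Lh)) (convZl (-1) Lh Lf) => x.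
by rewrite E => -> ->; rewrite mulN1r.
Qed.

(** At a point where the triple convolution of the norms is finite, Fubini's
    theorem and a translation of the inner variable apply. *)
Lemma convA s f g h : Ls s f -> Ls s g -> Ls s h ->
  {ae mu, forall x, conv f (conv g h) x = conv (conv f g) h x}.
Proof.
move=> Lf Lg Lh; have [mf _ wf] := Lf; have [mg _ wg] := Lg; have [mh _ wh] := Lh.
have fin u v : Ls s u -> Ls s v -> (wn s u * wn s v < +oo)%E.
  move=> Lu [mv _ wv]; apply: lte_mul_pinfty => //; first exact: wn_ge0.
  exact: wn_fin.
have : {ae mu, forall x, (econv (en f) (econv (en g) (en h)) x < +oo)%E}.
  have m : measurable_fun setT (econv (en g) (en h)).
    by apply: measurable_econv => //; exact: measurable_en.
  have e0 : forall x, (0 <= econv (en g) (en h) x)%E by move=> x; exact: econv_ge0.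
  apply: (@ewn_ae_fin _ s).
  - by apply: measurable_econv => //; exact: measurable_en.
  - by move=> x; exact: econv_ge0.
  - rewrite ewn_econv//; last exact: measurable_en.
    rewrite ewn_econv//; try exact: measurable_en.
    apply: lte_mul_pinfty; [exact: wn_ge0|exact: wn_fin|exact: fin].
apply: aeS2 (ae_good Lg Lh) => x gh fin3.
pose F (z : R * R) := f (x - z.1) * (g (z.1 - z.2) * h z.2).
have mF : cmeas F.
  apply: cmeasM.
    apply: (cmeas_comp (h := fun z : R * R => x - z.1) mf); exact: measurable_funB.
  exact: cmeas_conv_body.
have iF : (\int[mu]_t \int[mu]_s (n1 (F (t, s)))%:E < +oo)%E.
  apply: le_lt_trans fin3; apply: ge0_le_integral => //.
  - by move=> t _; apply: integral_ge0 => u _; rewrite lee_fin n1_ge0.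
  - apply: (@measurable_fun_fubini_tonelli_F _ _ _ _ _ mu (fun z => (n1 (F z))%:E)).
      exact: measurable_En1.
    by move=> z; rewrite lee_fin n1_ge0.
  - apply: emeasurable_funM.
      apply: (measurableT_comp (measurable_en mf)); exact: measurable_funB.
    by apply: measurable_econv => //; exact: measurable_en.
  - move=> t _; rewrite -ge0_integralZl//; last 2 first.
    + apply: (measurable_fun_pair2 (f := fun z : R * R => en g (z.1 - z.2)%R * en h z.2)%E).
      by apply: measurable_econv_body; exact: measurable_en.
    + by move=> u _; exact: mule_ge0.
    apply: ge0_le_integral => //.
    + by move=> u _; rewrite lee_fin n1_ge0.
    + by apply: measurable_En1; exact: (cmeas_comp mF).
    + apply: measurable_funeM.
      apply: (measurable_fun_pair2 (f := fun z : R * R => en g (z.1 - z.2)%R * en h z.2)%E).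
      by apply: measurable_econv_body; exact: measurable_en.
    + move=> u _; rewrite -!EFinM lee_fin /F/=.
      by apply: le_trans (n1M _ _) _; rewrite ler_wpM2l ?n1_ge0// n1M.
transitivity (cint (fun t => cint (fun u => F (t, u)))).
  apply: cint_ae; apply: aeS (ae_good Lg Lh) => t gt.
  by rewrite /conv -cintZ//; exact: conv_good.
rewrite (cint_fubini mF iF).
apply: cint_ae; apply: aeS (ae_reflect x (ae_good Lf Lg)) => u fgu.
rewrite mulrC -cintZ; last exact: conv_good.
rewrite -[RHS](@cint_shift _ u (fun t => h u * (f (x - u - t) * g t))).
  congr cint; apply/funext => t; rewrite /F/=.
  have -> : x - u - (t - u) = x - t by ring.
  by rewrite [RHS]mulrC mulrA.
by apply: cmeasM; [exact: cmeas_cst|exact: cmeas_conv_slice].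
Qed.

(** The value of a convolution of causal functions at [x] only sees their
    restrictions to the left of [x]. *)
Lemma conv_local (x : R) f f' g g' : causal f -> causal f' -> causal g -> causal g' ->
  {ae mu, forall t, t < x -> f t = f' t} ->
  {ae mu, forall t, t < x -> g t = g' t} -> conv f g x = conv f' g' x.
Proof.
move=> cf cf' cg cg' /(ae_reflect x) ff' gg'.
apply: cint_ae; apply: aeS2 ff' gg' => t ff' gg'.
have [t0|t0] := leP t 0; first by rewrite cg// cg'// !mulr0.
have [tx|tx] := ltP t x; last by rewrite cf ?cf' ?mul0r//; lra.
by rewrite ff' ?gg'//; lra.
Qed.

(** A null set of the left factor is reflected to a null set of the integration
    variable, so the equality holds at every point. *)
Lemma conv_ae f f' g g' : {ae mu, forall t, f t = f' t} ->
  {ae mu, forall t, g t = g' t} -> forall x, conv f g x = conv f' g' x.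
Proof.
move=> ff' gg' x; apply: cint_ae.
by apply: aeS2 (ae_reflect x ff') gg' => t -> ->.
Qed.
End Ls.

(** * Series of complex numbers *)
Section complex_limits.
Context {R : realType}.
Local Notation Re := complex.Re.
Local Notation Im := complex.Im.

Lemma norm_le_n1 (z : R[i]) : `|z| <= (n1 z)%:C.
Proof.
rewrite normc_def lecR -(ger0_norm (n1_ge0 z)) -sqrtr_sqr ler_wsqrtr//.
rewrite /n1 sqrrD !real_normK ?num_real//.
have : 0 <= `|Re z| * `|Im z| by rewrite mulr_ge0.
lra.
Qed.

Lemma Re_le_norm (z : R[i]) : `|Re z|%:C <= `|z|.
Proof. by rewrite normc_def lecR -sqrtr_sqr ler_wsqrtr// lerDl sqr_ge0. Qed.

Lemma Im_le_norm (z : R[i]) : `|Im z|%:C <= `|z|.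
Proof. by rewrite normc_def lecR -sqrtr_sqr ler_wsqrtr// lerDr sqr_ge0. Qed.

Lemma n1_le_norm (z : R[i]) : ((n1 z) / 2)%:C <= `|z|.
Proof.
have := Re_le_norm z; have := Im_le_norm z.
by rewrite normc_def !lecR /n1; lra.
Qed.

(** Limits for the modulus are limits of both parts; the error tolerance on the
    left is a complex number, positive in the partial order of the field. *)
Lemma ccvgP T (F : set_system T) {FF : ProperFilter F} (u : T -> R[i]) (l : R[i]) :
  ((u : T -> R[i]^o) x @[x --> F] --> (l : R[i]^o)) <->
  (Re (u x) @[x --> F] --> Re l /\ Im (u x) @[x --> F] --> Im l).
Proof.
split=> [/cvgrPdist_lt h|[/cvgrPdist_lt h1 /cvgrPdist_lt h2]].
  have H (e : R) : 0 < e -> \forall x \near F, n1 (l - u x) < e.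
    move=> e0; have e20 : 0 < (e / 2)%:C :> R[i] by rewrite ltcR divr_gt0.
    apply: filterS (h _ e20) => x /= hx.
    have := le_lt_trans (n1_le_norm _) hx.
    by rewrite ltcR ltr_pM2r// invr_gt0.
  split; apply/cvgrPdist_lt => e e0; apply: filterS (H e e0) => x; apply: le_lt_trans.
    by rewrite -ReN -ReD Re_le_n1.
  by rewrite -ImN -ImD Im_le_n1.
apply/cvgrPdist_lt => e e0.
have [er0 ee] : 0 < Re e /\ e = (Re e)%:C.
  move: e0; rewrite ltcE => /andP[/eqP ie re]; split => //.
  by apply: complex_ext => //=; rewrite ie.
have e20 : 0 < Re e / 2 by rewrite divr_gt0.
apply: filterS2 (h1 _ e20) (h2 _ e20) => x /= k1 k2.
apply: le_lt_trans (norm_le_n1 _) _; rewrite ee ltcR /n1 ReD ReN ImD ImN.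
lra.
Qed.

Lemma Re_series (u : nat -> R[i]) n : Re (series u n) = series (fun k => Re (u k)) n.
Proof. by rewrite /series/= Re_sum. Qed.
Lemma Im_series (u : nat -> R[i]) n : Im (series u n) = series (fun k => Im (u k)) n.
Proof. by rewrite /series/= Im_sum. Qed.

Lemma sumn1_fin (u : nat -> R[i]) n : (\sum_(0 <= k <oo) (n1 (u k))%:E < +oo)%E ->
  \sum_(0 <= k < n) n1 (u k) <= fine (\sum_(0 <= k <oo) (n1 (u k))%:E)%E.
Proof.
move=> fin; rewrite -lee_fin fineK.
  by rewrite -sumEFin; apply: nneseries_lim_ge => k _ _; rewrite lee_fin n1_ge0.
by rewrite ge0_fin_numE// nneseries_ge0// => k _ _; rewrite lee_fin n1_ge0.
Qed.

Lemma cvg_dominated_series (u : nat -> R[i]) (a : nat -> R) :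
  (forall k, `|a k| <= n1 (u k)) ->
  (\sum_(0 <= k <oo) (n1 (u k))%:E < +oo)%E -> cvgn (series a).
Proof.
move=> au fin; apply: normed_cvg; apply: nondecreasing_is_cvgn.
  by apply: nondecreasing_series => i _ _ /=.
exists (fine (\sum_(0 <= k <oo) (n1 (u k))%:E)%E) => _ [n _ <-].
by apply: le_trans (sumn1_fin n fin); rewrite /series/=; apply: ler_sum.
Qed.

Lemma csum_cvg (u : nat -> R[i]) : (\sum_(0 <= k <oo) (n1 (u k))%:E < +oo)%E ->
  (series u : nat -> R[i]^o) @ \oo -->
  ((limn (series (fun k => Re (u k))) +i* limn (series (fun k => Im (u k)))) : R[i]^o).
Proof.
move=> fin; apply/ccvgP => /=; split.
  under eq_fun do rewrite Re_series.
  by apply: (cvg_dominated_series _ fin) => k; exact: Re_le_n1.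
under eq_fun do rewrite Im_series.
by apply: (cvg_dominated_series _ fin) => k; exact: Im_le_n1.
Qed.

Lemma csummableP (u : nat -> R[i]) : (\sum_(0 <= k <oo) (n1 (u k))%:E < +oo)%E ->
  csummable u.
Proof. by move=> fin; apply/cvg_ex; eexists; exact: csum_cvg. Qed.

Lemma csumE (u : nat -> R[i]) : (\sum_(0 <= k <oo) (n1 (u k))%:E < +oo)%E ->
  csum u = limn (series (fun k => Re (u k))) +i* limn (series (fun k => Im (u k))).
Proof. by move=> fin; apply: cvg_lim (csum_cvg fin). Qed.

Lemma csumZ (c : R[i]) (u : nat -> R[i]) : csummable u ->
  csum (fun n => c * u n) = c * csum u.
Proof.
move=> cu; rewrite /csum.
have -> : series (fun n => c * u n) = fun n => c * series u n.
  by apply/funext => n; rewrite /series/= mulr_sumr.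
apply: (@cvg_lim R[i]^o) => //.
have /ccvgP[c1 c2] : (series u : nat -> R[i]^o) @ \oo --> (csum u : R[i]^o) := cu.
apply/ccvgP; split.
  under eq_fun do rewrite ReM; rewrite ReM.
  by apply: cvgB; exact: cvgMl_tmp.
under eq_fun do rewrite ImM; rewrite ImM.
by apply: cvgD; exact: cvgMl_tmp.
Qed.

Lemma csum_tail (u : nat -> R[i]) N : (\sum_(0 <= k <oo) (n1 (u k))%:E < +oo)%E ->
  ((n1 (csum u - \sum_(0 <= k < N) u k)%R)%:E <=
   \sum_(N <= k <oo) (n1 (u k))%:E)%E.
Proof.
move=> fin.
have p k : (0 <= (n1 (u k))%:E)%E by rewrite lee_fin n1_ge0.
have tfin : (\sum_(N <= k <oo) (n1 (u k))%:E \is a fin_num)%E.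
  rewrite ge0_fin_numE; last by apply: nneseries_ge0.
  apply: le_lt_trans fin; rewrite (nneseries_split 0%N N)//.
  by rewrite add0n leeDr// sume_ge0.
rewrite -[leRHS]fineK// lee_fin.
have := csum_cvg fin; rewrite -csumE// => /ccvgP[c1 c2].
have h n : (N <= n)%N -> n1 (series u n - \sum_(0 <= k < N) u k) <=
    fine (\sum_(N <= k <oo) (n1 (u k))%:E)%E.
  move=> Nn; rewrite /series/= (big_cat_nat (leq0n N) Nn)//= addrAC subrr add0r.
  apply: le_trans (n1_sum _ _ _) _.
  rewrite -lee_fin fineK// -sumEFin; apply: nneseries_lim_ge => k _ _; exact: p.
set S := \sum_(0 <= k < N) u k.
have : n1 (series u n - S) @[n --> \oo] --> n1 (csum u - S).
  rewrite /n1; under eq_fun do rewrite ReD ImD ReN ImN.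
  rewrite ReD ImD ReN ImN.
  by apply: cvgD; apply: cvg_norm; apply: cvgB => //; exact: cvg_cst.
move=> /cvgr_to_le; apply.
by exists N => // n /= /h.
Qed.
End complex_limits.

(** * Series that converge in the weighted norm *)
Section riesz_fischer.
Context {R : realType}.
Local Notation mu := (@lebesgue_measure R).
Local Notation Re := complex.Re.
Local Notation Im := complex.Im.

Section sum.
Variables (s : R) (F : nat -> R -> R[i]).
Hypothesis LF : forall n, Ls s (F n).
Hypothesis sF : (\sum_(0 <= k <oo) wn s (F k) < +oo)%E.

Definition absum (x : R) : \bar R := (\sum_(0 <= k <oo) en (F k) x)%E.

Let mF n : cmeas (F n). Proof. by have [] := LF n. Qed.

Lemma measurable_absum : measurable_fun setT absum.
Proof.
apply: ge0_emeasurable_sum => [k x _ _|k _]; first exact: en_ge0.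
exact: measurable_en.
Qed.

Lemma absum_ge0 x : (0 <= absum x)%E.
Proof. by apply: nneseries_ge0 => k _ _; exact: en_ge0. Qed.

(** Monotone convergence for the weighted measure. *)
Lemma ewn_tail N : ewn s (fun x => \sum_(N <= k <oo) en (F k) x)%E =
  (\sum_(N <= k <oo) wn s (F k))%E.
Proof.
rewrite -nneseries_addn; last by move=> k; exact: wn_ge0.
transitivity (\int[mu]_x \sum_(0 <= k <oo) (wt s x)%:E * en (F (k + N)%N) x)%E.
  apply: eq_integral => x _; rewrite -nneseries_addn; last by move=> k; exact: en_ge0.
  by rewrite nneseriesZl// => k _; exact: en_ge0.
rewrite integral_nneseries//; first by move=> n; exact: measurable_wen.
by move=> n x _; exact: wen_ge0.
Qed.

Lemma ae_absum : {ae mu, forall x, (absum x < +oo)%E}.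
Proof.
apply: (ewn_ae_fin measurable_absum absum_ge0 (s := s)).
by rewrite ewn_tail.
Qed.

(** The sum of the series where it converges absolutely, and 0 elsewhere; the
    cut-off makes it measurable and causal without exception. *)
Definition aesum (x : R) : R[i] :=
  if (absum x < +oo)%E then csum (fun n => F n x) else 0.

Lemma aesum_ae : {ae mu, forall x, aesum x = csum (fun n => F n x)}.
Proof. by apply: aeS ae_absum => x; rewrite /aesum => ->. Qed.

Lemma aesum_summable : {ae mu, forall x, csummable (fun n => F n x)}.
Proof. by apply: aeS ae_absum => x; exact: csummableP. Qed.

Lemma cmeas_aesum : cmeas aesum.
Proof.
have mb : measurable_fun setT (fun x => absum x < +oo)%E.
  apply: measurable_fun_lte => //; exact: measurable_absum.
have H (G : nat -> R -> R) : (forall n, measurable_fun setT (G n)) ->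
    (forall k x, `|G k x| <= n1 (F k x)) ->
    measurable_fun setT (fun x => if (absum x < +oo)%E then limn (series (fun n => G n x)) else 0).
  move=> mG GF.
  apply: (@measurable_fun_cvg _ _ _ setT
     (fun n x => if (absum x < +oo)%E then series (fun n => G n x) n else 0)).
    move=> n; apply: measurable_fun_ifT => //.
    by rewrite /series/=; apply: measurable_sum.
  move=> x _; case: ifPn => fin; last exact: cvg_cst.
  by apply: (@cvg_dominated_series _ (fun n => F n x)).
split.
  rewrite (_ : (fun x => _) = fun x => if (absum x < +oo)%E then
     limn (series (fun n => Re (F n x))) else 0).
    apply: H => [n|k x]; [by case: (mF n)|exact: Re_le_n1].
  by apply/funext => x; rewrite /aesum; case: ifPn => // fin; rewrite csumE.
rewrite (_ : (fun x => _) = fun x => if (absum x < +oo)%E then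
     limn (series (fun n => Im (F n x))) else 0).
  apply: H => [n|k x]; [by case: (mF n)|exact: Im_le_n1].
by apply/funext => x; rewrite /aesum; case: ifPn => // fin; rewrite csumE.
Qed.

Lemma causal_aesum : causal aesum.
Proof.
move=> x x0; rewrite /aesum; case: ifPn => // fin.
have E : (fun n => F n x) = fun=> 0.
  by apply/funext => n; have [_ c _] := LF n; rewrite c.
rewrite E csumE/=.
  have -> : series (fun=> 0 : R) = fun=> 0.
    by apply/funext => n; rewrite /series/= big1.
  by rewrite lim_cst.
by under eq_eseriesr do rewrite n1_0; rewrite eseries0// ltry.
Qed.

(** The modulus of a remainder is at most the sum of the moduli, at points of
    absolute convergence. *)
Lemma aesum_tail N : (wn s (fun x => aesum x - \sum_(0 <= k < N) F k x)%R <=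
  \sum_(N <= k <oo) wn s (F k))%E.
Proof.
rewrite -ewn_tail.
rewrite (@wn_ae _ _ _ (fun x => if (absum x < +oo)%E then
   aesum x - \sum_(0 <= k < N) F k x else 0)); last first.
  by apply: aeS ae_absum => x ->.
apply: ge0_le_integral => //.
- by move=> x _; exact: wen_ge0.
- apply: measurable_wen; apply: cmeas_if.
  + by apply: measurable_fun_lte => //; exact: measurable_absum.
  + by apply: cmeasB; [exact: cmeas_aesum|exact: cmeas_sum].
  + exact: cmeas_cst.
- apply: emeasurable_funM; first exact: measurable_Ewt.
  rewrite (_ : (fun x => _) = fun x => \sum_(0 <= k <oo) en (F (k + N)%N) x)%E; last first.
    by apply/funext => x; rewrite (nneseries_addn (f := fun k => en (F k) x))// => k; exact: en_ge0.
  apply: ge0_emeasurable_sum => [k x _ _|k _]; first exact: en_ge0.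
  exact: measurable_en.
- move=> x _; rewrite lee_wpmul2l//; first by rewrite lee_fin wt_ge0.
  rewrite /en; case: ifPn => fin; last first.
    by rewrite n1_0 nneseries_ge0// => k _ _; rewrite lee_fin n1_ge0.
  by rewrite /aesum fin; exact: csum_tail.
Qed.

Lemma Ls_aesum : Ls s aesum.
Proof.
split; [exact: cmeas_aesum|exact: causal_aesum|].
apply: le_lt_trans sF; apply: le_trans (aesum_tail 0).
apply: wn_le; [exact: cmeas_aesum| |].
  by apply: cmeasB; [exact: cmeas_aesum|exact: cmeas_sum].
by move=> x; rewrite big_geq// subr0.
Qed.

Lemma aesum_tail_cvg (e : R) : 0 < e -> exists N0, forall N, (N0 <= N)%N ->
  (\sum_(N <= k <oo) wn s (F k) < e%:E)%E.
Proof.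
move=> e0.
have := @nneseries_tail_cvg _ (fun k => wn s (F k)) xpredT sF (fun k _ => wn_ge0 _ _).
move=> /fine_cvgP[[N1 _ h1] /cvgrPdist_lt/(_ _ e0)[N2 _ h2]].
exists (maxn N1 N2) => N; rewrite geq_max => /andP[n1 n2].
have := h2 N n2; rewrite /= sub0r normrN => h.
rewrite -[ltLHS](fineK (h1 N n1)) lte_fin; apply: le_lt_trans h; exact: ler_norm.
Qed.
End sum.
End riesz_fischer.

(** * The k-gamma integral *)
Section gamma.
Context {R : realType}.
Local Notation mu := (@lebesgue_measure R).
Variable k : R.
Hypothesis k0 : 0 < k.

Lemma continuous_powR (c x : R) : 0 < x -> {for x, continuous (fun y => y `^ c)}.
Proof.
move=> x0; apply: differentiable_continuous; apply/derivable1_diffP.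
by apply: derivable_powR; rewrite in_itv/= x0.
Qed.

(** The integrand of the classical gamma integral with the variable scaled by
    [k], to which the substitution x = t^k brings [gint]. *)
Definition lint (c x : R) : R := expR (- (x / k)) * x `^ c.

Lemma lint_ge0 c x : 0 <= lint c x.
Proof. by rewrite mulr_ge0 ?expR_ge0 ?powR_ge0. Qed.

Lemma measurable_lint c : measurable_fun setT (lint c).
Proof.
apply: measurable_funM => //; apply: measurableT_comp => //.
by apply: measurableT_comp => //; apply: measurable_funM.
Qed.

Lemma continuous_lint c x : 0 < x -> {for x, continuous (lint c)}.
Proof.
move=> x0; apply: cvgM; last exact: continuous_powR.
apply: (@cvg_comp _ _ _ (fun x => - (x / k)) expR _ (nbhs (- (x / k)))).
  by apply: cvgN; apply: cvgMr_tmp; exact: cvg_id.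
exact: continuous_expR.
Qed.

(** The integrand that defines [kgamma]. *)
Definition gint (z t : R) : R := expR (- (t `^ k / k)) * t `^ (z - 1).

Lemma gint_ge0 c x : 0 <= gint c x.
Proof. by rewrite mulr_ge0 ?expR_ge0 ?powR_ge0. Qed.

Lemma measurable_gint c : measurable_fun setT (gint c).
Proof.
apply: measurable_funM => //; apply: measurableT_comp => //.
by apply: measurableT_comp => //; apply: measurable_funM.
Qed.

Let subst_itv (z a b : R) : 0 < a -> a < b ->
  (\int[mu]_(x in `[(a `^ k)%R, (b `^ k)%R]) (lint (z / k - 1) x)%:E =
   k%:E * \int[mu]_(t in `[a, b]) (gint z t)%:E)%E.
Proof.
move=> a0 ab.
have pos (x : R) : x \in `[a, b] -> 0 < x by rewrite in_itv/= => /andP[/(lt_le_trans a0)].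
have F'E (x : R) : 0 < x -> (derive1 (fun y : R => y `^ k)) x = k * x `^ (k - 1).
  by move=> x0; rewrite powR_derive1// in_itv/= x0.
have cF' (x : R) : 0 < x -> {for x, continuous (derive1 (fun y : R => y `^ k))}.
  move=> x0.
  rewrite /prop_for /continuous_at F'E//.
  have c : (fun y => k * y `^ (k - 1)) y @[y --> x] --> k * x `^ (k - 1).
    by apply: cvgMl_tmp; exact: continuous_powR.
  apply: cvg_trans c; apply: near_eq_cvg.
  near=> y; rewrite F'E//; near: y; exact: lt_nbhsr.
rewrite (@integration_by_substitution_increasing _ (fun y : R => y `^ k) (lint (z / k - 1)) a b).
- rewrite -ge0_integralZl_EFin//; last 3 first.
  + by move=> x _; rewrite lee_fin gint_ge0.
  + by apply/measurable_EFinP; apply: measurable_funTS; exact: measurable_gint.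
  + exact: ltW.
  apply: eq_integral => x; rewrite inE/= => xab; have x0 := pos _ xab.
  rewrite -EFinM; congr EFin.
  change (lint (z / k - 1) (x `^ k) * (derive1 (fun y : R => y `^ k) x) = k * gint z x).
  rewrite F'E// /lint /gint -powRrM.
  rewrite mulrACA [X in X * _]mulrC -mulrA; congr (_ * (_ * _)).
  rewrite -powRD; last by apply/implyP => _; rewrite gt_eqF.
  by congr (_ `^ _); field; rewrite gt_eqF.
- exact: ltW.
- move=> x y xab yab xy; rewrite gt0_ltr_powR//.
  + by rewrite nnegrE ltW// pos.
  + by rewrite nnegrE ltW// pos.
- by move=> x xab; apply: cF'; apply: pos; exact: subset_itv_oo_cc.
- apply/cvg_ex; exists ((derive1 (fun y : R => y `^ k)) a); apply: cvg_at_right_filter; exact: cF'.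
- apply/cvg_ex; exists ((derive1 (fun y : R => y `^ k)) b); apply: cvg_at_left_filter.
  by apply: cF'; exact: lt_trans ab.
- split.
  + by move=> x xab; apply: derivable_powR; rewrite in_itv/= pos//; exact: subset_itv_oo_cc.
  + by apply: cvg_at_right_filter; exact: continuous_powR.
  + by apply: cvg_at_left_filter; apply: continuous_powR; exact: lt_trans ab.
- apply: continuous_in_subspaceT => x; rewrite inE/= in_itv/= => /andP[ax _].
  by apply: continuous_lint; apply: lt_le_trans ax; exact: powR_gt0.
Unshelve. all: by end_near.
Qed.

Let N1 (n : nat) : R := n.+2%:R.
Let N1_gt1 n : 1 < N1 n. Proof. by rewrite ltr1n. Qed.

(* Intervals [n^-e, n^e] with n at least 2, so that they are nondegenerate
   and mapped to one another by power functions. *)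
Let cup (e : R) : 0 < e ->
  \bigcup_n `[((N1 n)^-1 `^ e)%R, ((N1 n) `^ e)%R]%classic = `]0%R, +oo[%classic.
Proof.
move=> e0; apply/seteqP; split => [x [n _]/=|x /=]; rewrite !in_itv/=.
  by move=> /andP[h _]; rewrite andbT; apply: lt_le_trans h; rewrite powR_gt0// invr_gt0 ltr0n.
rewrite andbT => x0.
have [n hn] : exists n : nat, Num.max (x `^ e^-1) ((x `^ e^-1)^-1) < n%:R.
  exists (Num.bound (Num.max (x `^ e^-1) ((x `^ e^-1)^-1))).
  by apply: archi_boundP; rewrite le_max powR_ge0.
exists n => //=; rewrite in_itv/=.
have y0 : 0 < x `^ e^-1 by exact: powR_gt0.
have xE : x = (x `^ e^-1) `^ e by rewrite -powRrM mulVf ?gt_eqF// powRr1// ltW.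
move: hn; rewrite gt_max => /andP[h1 h2].
have nN : n%:R <= N1 n by rewrite ler_nat; do 2 apply: ltnW.
have N0 : 0 < N1 n by exact: lt_trans (N1_gt1 n).
rewrite {1 2}xE !ge0_ler_powR ?nnegrE ?invr_ge0 ?powR_ge0 ?(ltW e0) ?(ltW N0)//.
  exact: le_trans (ltW h1) nN.
rewrite -[leRHS]invrK lef_pV2 ?posrE ?invr_gt0//; exact: le_trans (ltW h2) nN.
Qed.

(** The substitution x = t^k on compact intervals exhausting the half line. *)
Lemma lint_gint (z : R) :
  (\int[mu]_(x in `]0%R, +oo[) (lint (z / k - 1) x)%:E =
   k%:E * \int[mu]_(t in `]0%R, +oo[) (gint z t)%:E)%E.
Proof.
have H (e : R) (g : R -> R) : 0 < e -> measurable_fun setT g -> (forall x, 0 <= g x) ->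
  (\int[mu]_(x in `[((N1 n)^-1 `^ e)%R, ((N1 n) `^ e)%R]) (g x)%:E @[n --> \oo] -->
    \int[mu]_(x in `]0%R, +oo[) (g x)%:E)%E.
  move=> e0 mg g0; rewrite -(cup e0); apply: ge0_nondecreasing_set_cvg_integral => //.
  - move=> m n mn; rewrite subsetEset => x /=; rewrite !in_itv/= => /andP[h1 h2].
    have mn' : N1 m <= N1 n by rewrite ler_nat.
    have N0 i : 0 < N1 i by exact: lt_trans (N1_gt1 i).
    apply/andP; split.
      apply: le_trans h1; rewrite ge0_ler_powR ?nnegrE ?invr_ge0 ?(ltW (N0 _)) ?(ltW e0)//.
      by rewrite lef_pV2 ?posrE.
    by apply: le_trans h2 _; rewrite ge0_ler_powR ?nnegrE ?(ltW (N0 _)) ?(ltW e0).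
  - by move=> n; apply/measurable_EFinP; exact: measurable_funTS.
  - by move=> n x _; rewrite lee_fin.
have h1 := H k _ k0 (measurable_lint (z / k - 1)) (lint_ge0 _).
have h2 := H 1 _ ltr01 (measurable_gint z) (gint_ge0 _).
apply: (cvg_unique _ h1) => //.
have -> : (fun n => \int[mu]_(x in `[((N1 n)^-1 `^ k)%R, ((N1 n) `^ k)%R]) (lint (z / k - 1) x)%:E)%E =
   (fun n => k%:E * \int[mu]_(x in `[((N1 n)^-1 `^ 1)%R, ((N1 n) `^ 1)%R]) (gint z x)%:E)%E.
  apply/funext => n; have N0 : 0 < N1 n by exact: lt_trans (N1_gt1 n).
  rewrite !powRr1 ?invr_ge0 ?ltW//; apply: subst_itv; first by rewrite invr_gt0.
  by apply: (lt_trans _ (N1_gt1 n)); rewrite invf_lt1.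
by apply: cvgeZl.
Qed.

Lemma powR_int01 (c : R) : -1 < c ->
  (\int[mu]_(x in `]0%R, 1%R]) (x `^ c)%:E <= ((c + 1)^-1)%:E)%E.
Proof.
move=> c1; have d0 : 0 < c + 1 by lra.
have cup1 : \bigcup_n `[(N1 n)^-1, 1%R]%classic = `]0%R, 1%R]%classic.
  have := cup ltr01; under eq_bigcupr => n _.
    have N0 : 0 < N1 n by exact: lt_trans (N1_gt1 n).
    rewrite !powRr1 ?invr_ge0 ?(ltW N0)//; over.
  move=> E; apply/seteqP; split => [x [n _]/=|x /=]; rewrite !in_itv/=.
    by move=> /andP[h ->]; rewrite andbT; apply: lt_le_trans h; rewrite invr_gt0 ltr0n.
  move=> /andP[x0 x1]; have : `]0%R, +oo[%classic x by rewrite /= in_itv/= x0.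
  by rewrite -E => -[n _] /=; rewrite in_itv/= => /andP[h _]; exists n => //=; rewrite in_itv/= h.
have cv : (\int[mu]_(x in `[((N1 n)^-1)%R, 1%R]) (x `^ c)%:E @[n --> \oo] -->
    \int[mu]_(x in `]0%R, 1%R]) (x `^ c)%:E)%E.
  rewrite -cup1; apply: ge0_nondecreasing_set_cvg_integral => //.
  - move=> m n mn; rewrite subsetEset => x /=; rewrite !in_itv/= => /andP[h1 ->].
    rewrite andbT; apply: le_trans h1; rewrite lef_pV2 ?posrE ?ltr0n//.
    by rewrite ler_nat.
  - by move=> n; apply/measurable_EFinP; exact: measurable_funTS.
  - by move=> n x _; rewrite lee_fin powR_ge0.
apply: (cvge_to_le cv); apply: nearW => n.
have N0 : 0 < (N1 n)^-1 by rewrite invr_gt0 ltr0n.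
have N1' : (N1 n)^-1 < 1 by rewrite invf_lt1 ?N1_gt1// ltr0n.
have pos (x : R) : x \in `[(N1 n)^-1, 1%R] -> 0 < x by rewrite in_itv/= => /andP[/(lt_le_trans N0)].
rewrite (@continuous_FTC2 _ (fun y : R => y `^ c) (fun x : R => (c + 1)^-1 * x `^ (c + 1)))//.
- rewrite powR1 mulr1 -EFinB lee_fin lerBlDr lerDl mulr_ge0 ?powR_ge0//.
  by rewrite invr_ge0 ltW.
- apply: continuous_in_subspaceT => x; rewrite inE/= => /pos x0.
  exact: continuous_powR.
- split.
  + move=> x /subset_itv_oo_cc/pos x0.
    by apply: derivableM => //; apply: derivable_powR; rewrite in_itv/= x0.
  + by apply: cvg_at_right_filter; apply: cvgMl_tmp; exact: continuous_powR.
  + by apply: cvg_at_left_filter; apply: cvgMl_tmp; exact: continuous_powR.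
- move=> x /subset_itv_oo_cc/pos x0.
  have D := @is_deriveZ R R R (fun y : R => y `^ (c + 1)) ((c + 1)^-1) x 1 _
    (is_derive1_powR (c + 1) x0).
  rewrite derive1E.
  transitivity ((c + 1)^-1 *: ((c + 1) * x `^ (c + 1 - 1))).
    exact: (@derive_val _ _ _ _ _ _ _ D).
  by rewrite addrK /GRing.scale/= mulrA mulVf ?gt_eqF// mul1r.
Qed.

(** Near 0 the power dominates and is integrable as [c] exceeds -1; beyond 1
    half of the exponential decay absorbs the power, by the lower bound of exp by
    a monomial, and the other half is an exponential density. *)
Lemma lint_fin (c : R) : -1 < c ->
  (\int[mu]_(x in `]0%R, +oo[) (lint c x)%:E < +oo)%E.
Proof.
move=> c1.
have mE g : measurable_fun setT g -> forall D, measurable_fun D (fun x : R => (g x : R)%:E).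
  by move=> mg D; apply/measurable_EFinP; exact: measurable_funTS.
have U : (`]0%R, +oo[%classic : set R) = `]0%R, 1%R]%classic `|` `]1%R, +oo[%classic.
  apply/seteqP; split => x /=; rewrite !in_itv/= !andbT.
    by move=> ->; case: (leP x 1) => h; [left|right].
  by move=> [/andP[]//|]; exact: lt_trans.
rewrite U ge0_integral_setU//; last 3 first.
- exact: mE (measurable_lint c) _.
- by move=> x _; rewrite lee_fin lint_ge0.
- apply/disj_setPS => x /=; rewrite !in_itv/= => -[/andP[_ h1] /andP[h2 _]].
  by have := lt_le_trans h2 h1; rewrite ltxx.
apply: lte_add_pinfty.
  apply: (@le_lt_trans _ _ (\int[mu]_(x in `]0%R, 1%R]) (x `^ c)%:E)%E); last first.
    by apply: le_lt_trans (powR_int01 c1) _; rewrite ltry.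
  apply: ge0_le_integral => //.
  - by move=> x _; rewrite lee_fin lint_ge0.
  - exact: mE (measurable_lint c) _.
  - exact: mE (measurable_powR c) _.
  - move=> x; rewrite /= in_itv/= => /andP[x0 _]; rewrite lee_fin /lint.
    by rewrite ler_piMl ?powR_ge0// expR_le1 oppr_le0 divr_ge0 ?(ltW x0) ?(ltW k0).
pose N := Num.bound `|c|.
have cN : c <= N.+1%:R.
  apply: le_trans (ler_norm _) _; apply: ltW; apply: lt_trans (archi_boundP (normr_ge0 _)) _.
  by rewrite ltr_nat.
pose M : R := (N.+1`!)%:R * (2 * k) ^+ N.+1.
have M0 : 0 <= M by rewrite mulr_ge0// exprn_ge0// mulr_ge0// (ltW k0).
pose r : R := (2 * k)^-1.
have r0 : 0 < r by rewrite invr_gt0 mulr_gt0.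
have B x : 1 < x -> lint c x <= M * (2 * k) * exponential_pdf r x.
  move=> x1; have x0 : 0 < x by lra.
  rewrite exponential_pdfE ?(ltW x0)//.
  have -> : M * (2 * k) * (r * expR (- r * x)) = M * expR (- r * x).
    by rewrite /r; field; rewrite gt_eqF.
  have -> : lint c x = expR (- r * x) * (expR (- (r * x)) * x `^ c).
    rewrite /lint mulrA -expRD; congr (expR _ * _); rewrite /r; field.
    by rewrite gt_eqF.
  rewrite [leRHS]mulrC ler_wpM2l ?expR_ge0//.
  rewrite expRN mulrC ler_pdivrMr ?expR_gt0//.
  apply: le_trans (ler_powR (ltW x1) cN) _; rewrite powR_mulrn ?(ltW x0)//.
  have := @expR_ge1Dxn _ (r * x) N (mulr_ge0 (ltW r0) (ltW x0)).
  move=> h; have {}h : (r * x) ^+ N.+1 / (N.+1`!)%:R <= expR (r * x) by lra.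
  have -> : x ^+ N.+1 = M * ((r * x) ^+ N.+1 / (N.+1`!)%:R).
    have {1}-> : x = 2 * k * (r * x) by rewrite /r; field; rewrite gt_eqF.
    rewrite exprMn /M; move: ((2 * k) ^+ N.+1) ((r * x) ^+ N.+1) => a b.
    by field; rewrite pnatr_eq0 -lt0n fact_gt0.
  by rewrite ler_wpM2l.
apply: (@le_lt_trans _ _ (\int[mu]_x (M * (2 * k) * exponential_pdf r x)%:E)%E).
  rewrite integral_mkcond; apply: ge0_le_integral => //.
  - by move=> x _; rewrite patchE; case: ifP => //; rewrite lee_fin lint_ge0.
  - by apply/(measurable_restrictT _ _).1 => //; exact: mE (measurable_lint c) _.
  - apply/measurable_EFinP/measurable_funM => //; exact: measurable_exponential_pdf.
  - move=> x _; rewrite patchE; case: ifPn => [|_].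
      by rewrite inE/= in_itv/= andbT => x1; rewrite lee_fin B.
    by rewrite lee_fin mulr_ge0 ?(exponential_pdf_ge0 (ltW r0))// mulr_ge0// mulr_ge0// (ltW k0).
under eq_integral do rewrite EFinM.
rewrite ge0_integralZl_EFin//.
- by rewrite integral_exponential_pdf// mule1 ltry.
- by move=> x _; rewrite lee_fin exponential_pdf_ge0// ltW.
- by apply/measurable_EFinP; exact: measurable_exponential_pdf.
- by apply: mulr_ge0 => //; apply: mulr_ge0 => //; exact: ltW.
Qed.

Lemma lint_pos (c : R) : (0 < \int[mu]_(x in `]0%R, +oo[) (lint c x)%:E)%E.
Proof.
rewrite lt_def integral_ge0 ?andbT; last by move=> x _; rewrite lee_fin lint_ge0.
apply/eqP => I0.
have m : measurable_fun (`]0%R, +oo[%classic : set R) (fun x => (lint c x)%:E).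
  by apply/measurable_EFinP; apply: measurable_funTS; exact: measurable_lint.
have mD : measurable (`]0%R, +oo[%classic : set R) by [].
have [H _] := ae_eq_integral_abs mu mD m.
have /H : (\int[mu]_(x in `]0%R, +oo[) `|(lint c x)%:E| = 0)%E.
  rewrite -[RHS]I0; apply: eq_integral => x _.
  by rewrite gee0_abs// lee_fin lint_ge0.
move=> [Z [mZ Z0 sZ]].
have : (mu (`]0%R, +oo[%classic : set R) <= mu Z)%E.
  apply: le_measure; rewrite ?inE// => x; rewrite /= in_itv/= andbT => x0.
  apply: sZ => /= h.
  have /eqP := h ltac:(by rewrite in_itv/= x0); rewrite eqe.
  by rewrite gt_eqF// mulr_gt0 ?expR_gt0 ?powR_gt0.
by rewrite Z0 lebesgue_measure_itv/= ltry.
Qed.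
End gamma.

(** * The convolution semigroup of power kernels *)
Section power_kernel.
Context {R : realType}.
Local Notation mu := (@lebesgue_measure R).
Variable k : R.
Hypothesis k0 : 0 < k.

(** Normalized so that its Laplace transform at [s] is (s k)^(- z / k)
    ([ewn_powker]); the normalization is what makes the family a semigroup. *)
Definition powker (z x : R) : R :=
  if 0 < x then x `^ (z / k - 1) / (k * kgamma k z) else 0.

Lemma zk1 z : 0 < z -> -1 < z / k - 1.
Proof. by move=> z0; rewrite ltrBrDr addNr divr_gt0. Qed.

Lemma kgammaE z : 0 < z ->
  ((k * kgamma k z)%:E = \int[mu]_(x in `]0%R, +oo[) (lint k (z / k - 1) x)%:E)%E.
Proof.
move=> z0; have fin := lint_fin k0 (zk1 z0).
rewrite lint_gint// in fin *; rewrite EFinM; congr (_ * _)%E.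
rewrite /kgamma /Rintegral fineK//.
have g0 : (0 <= \int[mu]_(t in `]0%R, +oo[) (gint k z t)%:E)%E.
  by apply: integral_ge0 => x _; rewrite lee_fin gint_ge0.
rewrite ge0_fin_numE// ltNge leye_eq; apply/negP => /eqP E.
by move: fin; rewrite [X in (_ * X)%E]E gt0_muley ?lte_fin// ltxx.
Qed.

Lemma kgamma_gt0 z : 0 < z -> 0 < k * kgamma k z.
Proof. by move=> z0; rewrite -lte_fin kgammaE// lint_pos. Qed.

Lemma powker_ge0 z x : 0 < z -> 0 <= powker z x.
Proof.
move=> z0; rewrite /powker; case: ifP => // _.
by rewrite divr_ge0 ?powR_ge0// ltW// kgamma_gt0.
Qed.

Lemma measurable_powker z : measurable_fun setT (powker z).
Proof.
apply: measurable_fun_ifT => //; first exact: measurable_fun_ltr.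
exact: measurable_funM.
Qed.

Lemma measurable_Epowker z : measurable_fun setT (EFin \o powker z).
Proof. by apply/measurable_EFinP; exact: measurable_powker. Qed.

Lemma powker_scale z c x : 0 < c -> powker z (c * x) = c `^ (z / k - 1) * powker z x.
Proof.
move=> c0; rewrite /powker pmulr_rgt0//; case: ifPn => x0; last by rewrite mulr0.
by rewrite powRM ?(ltW c0) ?(ltW x0)// mulrA.
Qed.

Lemma ewn_powker1 z : 0 < z -> ewn k^-1 (EFin \o powker z) = 1%E.
Proof.
move=> z0; have G := kgamma_gt0 z0.
rewrite /ewn; transitivity (((k * kgamma k z)^-1)%:E *
   \int[mu]_(x in `]0%R, +oo[) (lint k (z / k - 1) x)%:E)%E; last first.
  by rewrite -kgammaE// -EFinM mulVf ?gt_eqF.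
rewrite -ge0_integralZl_EFin//.
- rewrite [RHS]integral_mkcond; apply: eq_integral => x _; rewrite patchE.
  case: ifPn => /=; rewrite ?inE ?notin_setE/= in_itv/= andbT /powker => x0.
    by rewrite x0 -!EFinM /wt /lint mulrA mulrC (mulrC k^-1).
  by move/negP : x0 => /negbTE ->; rewrite mule0.
- by move=> x _; rewrite lee_fin lint_ge0.
- by apply/measurable_EFinP/measurable_funTS; exact: measurable_lint.
- by rewrite invr_ge0 ltW.
Qed.

Lemma ewn_powker s z : 0 < s -> 0 < z ->
  ewn s (EFin \o powker z) = ((s * k) `^ (- (z / k)))%:E.
Proof.
move=> s0 z0; have sk0 : 0 < s * k by rewrite mulr_gt0.
pose c := (s * k)^-1; have c0 : 0 < c by rewrite invr_gt0.
have m s' : measurable_fun setT (fun x => (wt s' x)%:E * (EFin \o powker z) x)%E.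
  by apply: emeasurable_funM; [exact: measurable_Ewt|exact: measurable_Epowker].
have p s' x : (0 <= (wt s' x)%:E * (EFin \o powker z) x)%E.
  by rewrite /= mule_ge0// lee_fin ?wt_ge0 ?powker_ge0.
rewrite /ewn (@ge0_integral_aff _ c 0 _ c0)//.
transitivity (c%:E * (c `^ (z / k - 1))%:E * ewn k^-1 (EFin \o powker z))%E; last first.
  rewrite ewn_powker1// mule1 -EFinM mulr_powRB1 ?ltW ?divr_gt0//.
  by rewrite /c powRN -(powR_inv1 (ltW sk0)) -powRrM mulN1r powRN.
rewrite -muleA; congr (_ * _)%E.
rewrite /ewn -ge0_integralZl_EFin ?powR_ge0//; last exact: m.
apply: eq_integral => x _ /=; rewrite addr0 powker_scale// EFinM muleCA; congr (_ * (_ * _))%E.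
rewrite /wt; congr (expR (- _))%:E; rewrite /c; field.
by rewrite !gt_eqF.
Qed.

(** By homogeneity the convolution of two powers is a multiple of the power of
    order a + b; the Laplace transform, multiplicative under convolution,
    determines the factor. This is Euler's beta integral. *)
Lemma econv_powker a b x : 0 < a -> 0 < b ->
  econv (EFin \o powker a) (EFin \o powker b) x = (powker (a + b) x)%:E.
Proof.
move=> a0 b0; have ab0 := addr_gt0 a0 b0.
pose C := econv (EFin \o powker a) (EFin \o powker b) 1.
have [pa pb] : (forall x, 0 <= (EFin \o powker a) x)%E /\ (forall x, 0 <= (EFin \o powker b) x)%E.
  by split => y; rewrite lee_fin powker_ge0.
have C0 : (0 <= C)%E := econv_ge0 1 pa pb.
have E0 y : y <= 0 -> econv (EFin \o powker a) (EFin \o powker b) y = 0%E.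
  move=> y0; rewrite /econv integral0_eq// => t _ /=; rewrite /powker.
  have [t0|t0] := ltP 0 t; last by rewrite mule0.
  by rewrite ifN ?mul0e// -leNgt; lra.
pose F (y t : R) : \bar R := ((EFin \o powker a) (y - t)%R * (EFin \o powker b) t)%E.
have mF y : measurable_fun setT (F y).
  apply: (measurable_fun_pair2 (f := fun z : R * R => (EFin \o powker a) (z.1 - z.2)%R * (EFin \o powker b) z.2)%E).
  by apply: measurable_econv_body; exact: measurable_Epowker.
have F0 y t : (0 <= F y t)%E := mule_ge0 (pa _) (pb _).
have Fs y t : 0 < y -> F y (y * t + 0) = ((y `^ (a / k - 1) * y `^ (b / k - 1))%:E * F 1%R t)%E.
  move=> y0; rewrite /F /= addr0.
  have -> : y - y * t = y * (1 - t) by ring.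
  rewrite (powker_scale a _ y0) (powker_scale b _ y0) -!EFinM; congr EFin.
  by move: (y `^ _) (y `^ _) (powker a _) (powker b _) => ? ? ? ?; ring.
have E1 y : 0 < y -> econv (EFin \o powker a) (EFin \o powker b) y =
   ((y `^ ((a + b) / k - 1))%:E * C)%E.
  move=> y0.
  transitivity (y%:E * \int[mu]_t F y (y * t + 0)%R)%E.
    exact: (ge0_integral_aff 0 y0 (mF y) (F0 y)).
  transitivity (y%:E * \int[mu]_t ((y `^ (a / k - 1) * y `^ (b / k - 1))%:E * F 1%R t))%E.
    by congr (_ * _)%E; apply: eq_integral => t _; exact: Fs.
  have -> : y `^ ((a + b) / k - 1) = y * (y `^ (a / k - 1) * y `^ (b / k - 1)).
    rewrite -{2}(powRr1 (ltW y0)) -!powRD; try by apply/implyP => _; rewrite gt_eqF.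
    by congr (_ `^ _); field; rewrite gt_eqF.
  rewrite [in RHS]EFinM -muleA; congr (_ * _)%E.
  apply: (@ge0_integralZl_EFin _ _ _ mu setT measurableT (F 1)).
  - by move=> t _; exact: F0.
  - exact: mF.
  - by rewrite mulr_ge0// powR_ge0.
have E2 y : econv (EFin \o powker a) (EFin \o powker b) y =
   ((k * kgamma k (a + b))%:E * C * (EFin \o powker (a + b)) y)%E.
  have [y0|y0] := ltP 0 y; last by rewrite E0// /= /powker ltNge y0/= mule0.
  rewrite E1// /= /powker y0 muleC [(_ * C)%E]muleC -muleA -EFinM; congr (_ * _%:E)%E.
  by rewrite mulrCA mulfV ?mulr1// gt_eqF// kgamma_gt0.
have : ewn k^-1 (econv (EFin \o powker a) (EFin \o powker b)) = 1%E.
  rewrite (ewn_econv _ (measurable_Epowker a) (measurable_Epowker b) pa pb).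
  transitivity (1 * 1 : \bar R)%E; last exact: mule1.
  by congr (_ * _)%E; exact: ewn_powker1.
have -> : ewn k^-1 (econv (EFin \o powker a) (EFin \o powker b)) =
   ((k * kgamma k (a + b))%:E * C * 1)%E.
  rewrite -(ewn_powker1 ab0) /ewn -ge0_integralZl//.
  - by apply: eq_integral => y _; rewrite E2 muleCA.
  - by apply: emeasurable_funM; [exact: measurable_Ewt|exact: measurable_Epowker].
  - by move=> y _; rewrite /= mule_ge0// lee_fin ?wt_ge0 ?powker_ge0.
  - by rewrite mule_ge0// lee_fin ltW// kgamma_gt0.
by rewrite mule1 => e1; rewrite E2 e1 mul1e.
Qed.

(** Integration divided by [k] is the member of order [k] of the semigroup. *)
Lemma powkerk x : 0 < x -> powker k x = k^-1.
Proof.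
move=> x0; rewrite /powker x0 divff ?gt_eqF// subrr powRr0 mul1r.
suff -> : k * kgamma k k = k by [].
apply: EFin_inj; rewrite kgammaE//.
transitivity (k%:E * \int[mu]_x (exponential_pdf k^-1 x)%:E)%E; last first.
  by rewrite integral_exponential_pdf ?invr_gt0// mule1.
rewrite -ge0_integralZl_EFin ?(ltW k0)//; last 2 first.
- by move=> y _; rewrite lee_fin exponential_pdf_ge0// invr_ge0 ltW.
- by apply/measurable_EFinP; exact: measurable_exponential_pdf.
rewrite [LHS]integral_mkcond; apply: ae_integral.
have m0 : mu [set 0] = 0%E by rewrite lebesgue_measure_set1.
exists [set 0]; split => // y /= hy; apply: contrapT => y0; apply: hy => _.
rewrite patchE; case: ifPn; rewrite ?inE ?notin_setE/= in_itv/= andbT => h.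
  rewrite exponential_pdfE ?(ltW h)// /lint divff ?gt_eqF// subrr powRr0 mulr1.
  by rewrite -EFinM mulrA mulfV ?gt_eqF// mul1r mulNr (mulrC k^-1).
rewrite lt0_exponential_pdf ?mule0//.
by move/negP : h; rewrite -leNgt le_eqVlt => /orP[/eqP //|].
Qed.
End power_kernel.

(** * Cauchy products of series of kernels *)
Section cauchy_product.
Context {R : realType}.
Local Notation mu := (@lebesgue_measure R).

Lemma conv0l (g : R -> R[i]) x : conv (fun=> 0) g x = 0.
Proof.
rewrite /conv (_ : (fun t => _) = fun=> 0); last by apply/funext => t; rewrite mul0r.
by rewrite /cint /cintegral /Rintegral/= !integral0.
Qed.

Lemma conv0r (g : R -> R[i]) x : conv g (fun=> 0) x = 0.
Proof.
rewrite /conv (_ : (fun t => _) = fun=> 0); last by apply/funext => t; rewrite mulr0.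
by rewrite /cint /cintegral /Rintegral/= !integral0.
Qed.

Lemma conv_suml s I (r : seq I) (F : I -> R -> R[i]) g :
  (forall i, Ls s (F i)) -> Ls s g ->
  {ae mu, forall x, conv (fun t => \sum_(i <- r) F i t) g x =
                    \sum_(i <- r) conv (F i) g x}.
Proof.
move=> LF Lg; elim: r => [|i r ih].
  apply: ae_all => x; rewrite big_nil; under [X in conv X]eq_fun do rewrite big_nil.
  exact: conv0l.
have := convDl Lg (LF i) (@Ls_sum _ s _ r xpredT F LF).
apply: aeS2 ih => x ih h; rewrite big_cons -ih -h.
by congr conv; apply/funext => t; rewrite big_cons.
Qed.

Lemma conv_sumr s I (r : seq I) (F : I -> R -> R[i]) g :
  (forall i, Ls s (F i)) -> Ls s g ->
  {ae mu, forall x, conv g (fun t => \sum_(i <- r) F i t) x =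
                    \sum_(i <- r) conv g (F i) x}.
Proof.
move=> LF Lg; elim: r => [|i r ih].
  apply: ae_all => x; rewrite big_nil; under [X in conv _ X]eq_fun do rewrite big_nil.
  exact: conv0r.
have := convDr Lg (LF i) (@Ls_sum _ s _ r xpredT F LF).
apply: aeS2 ih => x ih h; rewrite big_cons -ih -h.
by congr conv; apply/funext => t; rewrite big_cons.
Qed.

Lemma ae_all_seq (I : eqType) (r : seq I) (P : I -> R -> Prop) :
  (forall i, {ae mu, forall x, P i x}) ->
  {ae mu, forall x, forall i, i \in r -> P i x}.
Proof.
move=> h; elim: r => [|i r ih]; first exact: ae_all.
apply: aeS2 ih (h i) => x ih hi j; rewrite inE => /orP[/eqP -> //|].
exact: ih.
Qed.

(** Summation over a triangle by antidiagonals or by rows. *)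
Lemma sum_triangle (V : nmodType) (N : nat) (T : nat -> nat -> V) :
  \sum_(0 <= n < N) \sum_(0 <= i < n.+1) T i (n - i)%N =
  \sum_(0 <= i < N) \sum_(0 <= j < N | (i + j < N)%N) T i j.
Proof.
transitivity (\sum_(0 <= n < N) \sum_(0 <= i < N | (i <= n)%N) T i (n - i)%N).
  apply: eq_big_nat => n /andP[_ nN].
  by rewrite (big_nat_widen _ _ N)//; apply: eq_bigl => i; rewrite ltnS.
rewrite (exchange_big_dep_nat xpredT)//=; apply: eq_big_nat => i /andP[_ iN].
rewrite (@big_cat_nat _ _ _ i)//=; last exact: ltnW.
rewrite big_nat_cond big1 ?add0r; last first.
  by move=> n /andP[/andP[_ h]]; rewrite leqNgt h.
rewrite -{1}(add0n i) big_addn.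
under eq_bigl => j do rewrite leq_addl.
under eq_bigr => j _ do rewrite addnK.
rewrite (big_nat_widen _ _ N) ?leq_subr//; apply: eq_bigl => j /=.
by rewrite ltn_subRL.
Qed.

Section product.
Variables (s : R) (F G H : nat -> R -> R[i]).
Hypotheses (LF : forall n, Ls s (F n)) (LG : forall n, Ls s (G n))
  (LH : forall n, Ls s (H n)).
Hypotheses (sF : (\sum_(0 <= k <oo) wn s (F k) < +oo)%E)
  (sG : (\sum_(0 <= k <oo) wn s (G k) < +oo)%E)
  (sH : (\sum_(0 <= k <oo) wn s (H k) < +oo)%E).
Hypothesis HFG : forall n, {ae mu, forall x,
  H n x = \sum_(0 <= i < n.+1) conv (F i) (G (n - i)%N) x}.

Let a i := fine (wn s (F i)).
Let b i := fine (wn s (G i)).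
Let aE i : wn s (F i) = (a i)%:E. Proof. by rewrite fineK// wn_fin. Qed.
Let bE i : wn s (G i) = (b i)%:E. Proof. by rewrite fineK// wn_fin. Qed.
Let a0 i : 0 <= a i. Proof. by rewrite fine_ge0// wn_ge0. Qed.
Let b0 i : 0 <= b i. Proof. by rewrite fine_ge0// wn_ge0. Qed.

Let tail_real (u : nat -> R) N M (e : R) : (forall i, 0 <= u i) ->
  (\sum_(N <= k <oo) (u k)%:E < e%:E)%E -> \sum_(N <= i < M) u i <= e.
Proof.
move=> u0 h; rewrite -lee_fin; apply: le_trans (ltW h).
by rewrite -sumEFin; apply: nneseries_lim_ge => k _ _; rewrite lee_fin.
Qed.

Let A M x := \sum_(0 <= i < M) F i x.
Let B M x := \sum_(0 <= i < M) G i x.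
Let C M x := \sum_(0 <= i < M) H i x.
Let LA M : Ls s (A M). Proof. exact: Ls_sum. Qed.
Let LB M : Ls s (B M). Proof. exact: Ls_sum. Qed.
Let LC M : Ls s (C M). Proof. exact: Ls_sum. Qed.
Let T i j := conv (F i) (G j).
Let LT i j : Ls s (T i j). Proof. exact: Ls_conv. Qed.

Let wnA M : (wn s (A M) <= (\sum_(0 <= i < M) a i)%:E)%E.
Proof.
apply: le_trans (wn_sum _ _ _ _) _; first by move=> i; have [] := LF i.
by under eq_bigr do rewrite aE; rewrite sumEFin.
Qed.

Let AB M : {ae mu, forall x, conv (A M) (B M) x =
   \sum_(0 <= i < M) \sum_(0 <= j < M) T i j x}.
Proof.
apply: aeS2 (conv_suml (index_iota 0 M) LF (LB M))
  (ae_all_seq (index_iota 0 M) (fun i => conv_sumr (index_iota 0 M) LG (LF i))) => x h1 h2.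
rewrite /A h1 big_seq [RHS]big_seq; apply: eq_bigr => i iM.
by rewrite -h2.
Qed.

Let CT M : {ae mu, forall x, C M x =
   \sum_(0 <= i < M) \sum_(0 <= j < M | (i + j < M)%N) T i j x}.
Proof.
apply: aeS (ae_all_seq (index_iota 0 M) HFG) => x h.
rewrite -(sum_triangle M (fun i j => T i j x)) /C big_seq [RHS]big_seq.
by apply: eq_bigr => i /h.
Qed.

Let square_bound M (e : R) : 0 <= e ->
  (\sum_(M <= k <oo) wn s (F k) < e%:E)%E -> (\sum_(M <= k <oo) wn s (G k) < e%:E)%E ->
  (wn s (fun x => C (M + M) x - conv (A M) (B M) x)%R <=
   (e * \sum_(0 <= i < M + M) b i + \sum_(0 <= i < M + M) a i * e)%:E)%E.
Proof.
move=> e0 tF tG.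
(* The pairs in the triangle of side 2M and outside the square of side M; one of
   their indices is at least M. *)
pose P i j := (i + j < M + M)%N && ~~ ((i < M)%N && (j < M)%N).
rewrite (@wn_ae _ _ _ (fun x => \sum_(0 <= i < M + M) \sum_(0 <= j < M + M | P i j) T i j x)); last first.
  apply: aeS2 (AB M) (CT (M + M)) => x -> ->.
  have -> : \sum_(0 <= i < M) \sum_(0 <= j < M) T i j x =
    \sum_(0 <= i < M + M) \sum_(0 <= j < M + M | (i < M)%N && (j < M)%N) T i j x.
    rewrite (big_nat_widen 0 M (M + M)) ?leq_addr// big_mkcond/=.
    apply: eq_bigr => i _; case: ifP => iM/=; last by rewrite big_pred0.
    by rewrite (big_nat_widen 0 M (M + M)) ?leq_addr.
  rewrite -sumrB; apply: eq_bigr => i _.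
  rewrite (bigID (fun j => (i < M)%N && (j < M)%N))/= addrAC -[RHS]add0r; congr (_ + _).
  apply/eqP; rewrite subr_eq0; apply/eqP; apply: eq_bigl => j.
  apply/andP/idP => [[]//|/andP[h1 h2]]; rewrite h1 h2; split => //.
  by rewrite -addSn leq_add// ltnW.
apply: le_trans (wn_sum _ _ _ _) _.
  by move=> i; apply: cmeas_sum => j; have [] := LT i j.
apply: (@le_trans _ _ (\sum_(0 <= i < M + M) \sum_(0 <= j < M + M | P i j) (a i * b j)%:E)%E).
  apply: lee_sum => i _; apply: le_trans (wn_sum _ _ _ _) _.
    by move=> j; have [] := LT i j.
  apply: lee_sum => j _; rewrite EFinM -aE -bE; apply: wn_conv.
    by have [] := LF i.
  by have [] := LG j.
under eq_bigr do rewrite sumEFin; rewrite sumEFin lee_fin.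
apply: (@le_trans _ _ (\sum_(0 <= i < M + M) \sum_(0 <= j < M + M)
    ((M <= i)%N%:R * a i * b j + a i * ((M <= j)%N%:R * b j)))).
  apply: ler_sum => i _; rewrite big_mkcond/=; apply: ler_sum => j _.
  have ab : 0 <= a i * b j by rewrite mulr_ge0.
  have ? : 0 <= (M <= i)%N%:R * a i * b j by rewrite !mulr_ge0.
  have ? : 0 <= a i * ((M <= j)%N%:R * b j) by rewrite !mulr_ge0.
  rewrite /P negb_and -!leqNgt; case: ifP => [/andP[_ /orP[] ->]|_].
  - by rewrite mul1r lerDl.
  - by rewrite mul1r lerDr.
  - exact: addr_ge0.
have tl (u : nat -> R) : (forall i, 0 <= u i) -> (\sum_(M <= k <oo) (u k)%:E < e%:E)%E ->
    \sum_(0 <= i < M + M) (M <= i)%N%:R * u i <= e.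
  move=> u0 h; apply: le_trans (tail_real (M + M) u0 h).
  rewrite (@big_cat_nat _ _ _ M) ?leq_addr//= big_nat big1 ?add0r.
    by rewrite big_nat [leRHS]big_nat; apply: ler_sum => i /andP[-> _]; rewrite mul1r.
  by move=> i /andP[_ iM]; rewrite leqNgt iM mul0r.
under eq_bigr do rewrite big_split/= -!mulr_sumr.
rewrite big_split/= -!mulr_suml; apply: lerD.
  rewrite ler_wpM2r ?sumr_ge0//; apply: tl => //.
  by under eq_eseriesr do rewrite -aE.
rewrite ler_wpM2l ?sumr_ge0//; apply: tl => //.
by under eq_eseriesr do rewrite -bE.
Qed.

(** The Cauchy product of two absolutely convergent series of convolution
    kernels: the square of side [M] and the triangle of side [2M] differ only
    by pairs with an index at least [M]. *)
Lemma conv_aesum : {ae mu, forall x, conv (aesum F) (aesum G) x = aesum H x}.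
Proof.
have Lf := Ls_aesum LF sF; have Lg := Ls_aesum LG sG; have Lh := Ls_aesum LH sH.
pose a' := fine (\sum_(0 <= k <oo) wn s (F k))%E.
pose b' := fine (\sum_(0 <= k <oo) wn s (G k))%E.
have p0 (X : nat -> R -> R[i]) : (0 <= \sum_(0 <= k <oo) wn s (X k))%E.
  by apply: nneseries_ge0 => k _ _; exact: wn_ge0.
have a'E : (\sum_(0 <= k <oo) wn s (F k))%E = a'%:E by rewrite fineK// ge0_fin_numE.
have b'E : (\sum_(0 <= k <oo) wn s (G k))%E = b'%:E by rewrite fineK// ge0_fin_numE.
have a'0 : 0 <= a' by rewrite fine_ge0.
have b'0 : 0 <= b' by rewrite fine_ge0.
have aa' M : \sum_(0 <= i < M) a i <= a'.
  rewrite -lee_fin -a'E -sumEFin; under eq_bigr do rewrite -aE.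
  by apply: nneseries_lim_ge => k _ _; exact: wn_ge0.
have bb' M : \sum_(0 <= i < M) b i <= b'.
  rewrite -lee_fin -b'E -sumEFin; under eq_bigr do rewrite -bE.
  by apply: nneseries_lim_ge => k _ _; exact: wn_ge0.
pose D x := conv (aesum F) (aesum G) x - aesum H x.
have LD : Ls s D := LsB (Ls_conv Lf Lg) Lh.
suff : wn s D = 0%E.
  move=> /(wn_eq0 (let: And3 m _ _ := LD in m)); apply: aeS => x /eqP.
  by rewrite subr_eq0 => /eqP.
suff W e : 0 < e -> (wn s D <= (e * (a' + b' + a' + b' + 1))%:E)%E.
  apply/eqP; rewrite eq_le wn_ge0 andbT; apply/lee_addgt0Pr => e e0; rewrite add0e.
  have Q0 : 0 < a' + b' + a' + b' + 1 by rewrite ltr_wpDl// !addr_ge0.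
  have := W _ (divr_gt0 e0 Q0); by rewrite divfK// gt_eqF.
move=> e0.
have [MF hF] := aesum_tail_cvg sF e0.
have [MG hG] := aesum_tail_cvg sG e0.
have [MH hH] := aesum_tail_cvg sH e0.
pose M := (MF + MG + MH)%N.
have {}hF : (\sum_(M <= k <oo) wn s (F k) < e%:E)%E by apply: hF; rewrite /M; lia.
have {}hG : (\sum_(M <= k <oo) wn s (G k) < e%:E)%E by apply: hG; rewrite /M; lia.
have {}hH : (\sum_(M + M <= k <oo) wn s (H k) < e%:E)%E by apply: hH; rewrite /M; lia.
pose f1 x := aesum F x - A M x.
pose g1 x := aesum G x - B M x.
pose h1 x := aesum H x - C (M + M) x.
pose q x := C (M + M) x - conv (A M) (B M) x.
have Lf1 : Ls s f1 by exact: LsB.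
have Lg1 : Ls s g1 by exact: LsB.
have Lh1 : Ls s h1 by exact: LsB.
have Lq : Ls s q := LsB (LC _) (Ls_conv (LA M) (LB M)).
have wf1 : (wn s f1 <= e%:E)%E by apply: le_trans (aesum_tail LF sF M) _; apply: ltW; exact: hF.
have wg1 : (wn s g1 <= e%:E)%E by apply: le_trans (aesum_tail LG sG M) _; apply: ltW; exact: hG.
have wh1 : (wn s h1 <= e%:E)%E by apply: le_trans (aesum_tail LH sH (M + M)) _; apply: ltW; exact: hH.
have wg : (wn s (aesum G) <= b'%:E)%E.
  rewrite -b'E; apply: le_trans (aesum_tail LG sG 0).
  apply: wn_le; [by case: Lg| |by move=> x; rewrite big_geq// subr0].
  by apply: cmeasB; [case: Lg|apply: cmeas_sum => i; case: (LG i)].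
have m (u : R -> R[i]) : Ls s u -> cmeas u by case.
(* The product of the sums differs from that of the partial sums by a tail of
   either factor; [q] is the gap between square and triangle, [h1] the tail of
   the third series. *)
rewrite (@wn_ae _ _ _ (fun x => (conv f1 (aesum G) x + conv (A M) g1 x) - (q x + h1 x))); last first.
  apply: aeS2 (convBl Lg Lf (LA M)) (convBr (LA M) Lg (LB M)) => x E1 E2.
  by rewrite /D /q /h1 E1 E2; ring.
apply: le_trans (wnB _ _ _) _.
- by apply: cmeasD; apply: m; exact: Ls_conv.
- by apply: cmeasD; exact: m.
have -> : e * (a' + b' + a' + b' + 1) = (e * b' + a' * e) + ((e * b' + a' * e) + e) by ring.
rewrite EFinD; apply: leeD.
  apply: le_trans (wnD _ _ _) _; try by apply: m; exact: Ls_conv.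
  rewrite EFinD; apply: leeD; apply: le_trans (wn_conv _ _ _) _; try exact: m.
    by rewrite EFinM; exact: (lee_pmul (wn_ge0 _ _) (wn_ge0 _ _) wf1 wg).
  rewrite EFinM; apply: (lee_pmul (wn_ge0 _ _) (wn_ge0 _ _) _ wg1).
  apply: le_trans (wnA M) _; rewrite lee_fin; exact: aa'.
apply: le_trans (wnD _ _ _) _; try exact: m.
rewrite EFinD; apply: leeD => //.
apply: le_trans (square_bound (ltW e0) hF hG) _.
rewrite lee_fin; apply: lerD; [apply: ler_wpM2l|rewrite -mulr_suml; apply: ler_wpM2r].
- exact: ltW.
- exact: bb'.
- exact: ltW.
- exact: aa'.
Qed.
End product.
End cauchy_product.

(** * The Mittag-Leffler kernel *)
Section pochhammer.
Context {R : realType}.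
Variable k : R.
Hypothesis k0 : 0 < k.

Lemma pochS g n : kpochhammer k g n.+1 = kpochhammer k g n * (g + n%:R * k).
Proof. by rewrite /kpochhammer big_ord_recr. Qed.

Lemma poch0 g : kpochhammer k g 0 = 1. Proof. by rewrite /kpochhammer big_ord0. Qed.

Lemma poch_zeroS n : kpochhammer k 0 n.+1 = 0.
Proof. by rewrite /kpochhammer big_ord_recl/= mul0r addr0 mul0r. Qed.

Lemma fct_neq0 n : (n`!)%:R != 0 :> R.
Proof. by rewrite pnatr_eq0 -lt0n fact_gt0. Qed.

(** The binomial coefficient of the generalized Newton series, up to sign and
    powers of [k]: the generating function of [pf g] is (1 - k x)^(- g / k). *)
Definition pf (g : R) n := kpochhammer k g n / (n`!)%:R.

Lemma pfS g n : n.+1%:R * pf g n.+1 = (g + n%:R * k) * pf g n.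
Proof.
rewrite /pf pochS factS natrM; field.
by rewrite fct_neq0 nat1r pnatr_eq0.
Qed.

(** The coefficients of a product of two Newton series, by induction with the
    recurrence [pfS]. *)
Lemma chu_vandermonde (a b : R) n :
  pf (a + b) n = \sum_(0 <= i < n.+1) pf a i * pf b (n - i).
Proof.
rewrite big_mkord; elim: n => [|n ih].
  by rewrite big_ord_recl big_ord0 /pf !poch0 fact0; field.
have n0 : n.+1%:R != 0 :> R by rewrite pnatr_eq0.
apply: (mulfI n0); rewrite pfS ih mulr_sumr.
transitivity (\sum_(i < n.+1) (i.+1%:R * pf a i.+1) * pf b (n - i) +
   \sum_(i < n.+1) pf a i * ((n - i).+1%:R * pf b (n - i).+1)).
  rewrite -big_split/=; apply: eq_bigr => i _; rewrite !pfS.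
  have : i%:R + (n - i)%:R = n%:R :> R by rewrite -natrD subnKC// -ltnS.
  by move=> <-; ring.
transitivity (\sum_(i < n.+2) (i%:R + (n.+1 - i)%:R) * (pf a i * pf b (n.+1 - i))); last first.
  rewrite mulr_sumr; apply: eq_bigr => i _; congr (_ * _).
  by rewrite -natrD subnKC// -ltnS.
under [RHS]eq_bigr do rewrite mulrDl.
rewrite big_split/=; congr (_ + _).
  rewrite [RHS]big_ord_recl/= mul0r add0r; apply: eq_bigr => i _.
  by rewrite /bump/= add1n subSS mulrA.
rewrite [RHS]big_ord_recr/= subnn mul0r addr0; apply: eq_bigr => i _.
have iN : (i <= n)%N by rewrite -ltnS.
by rewrite (subSn iN) mulrCA.
Qed.

(** The recurrence bounds the coefficient by that of an integer exponent, which
    is a binomial coefficient of a row summing to a power of 2. *)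
Lemma pf_bound (g : R) : exists2 B, 0 <= B & forall n, `|pf g n| <= B * (2 * k) ^+ n.
Proof.
(* [g] is at most [(p + 1) * k] in modulus, so each factor of the Pochhammer
   symbol is dominated by the one for that integer multiple of [k]. *)
pose p := Num.bound (`|g| / k).
have gp : `|g| <= p.+1%:R * k.
  rewrite -ler_pdivrMr//; apply: ltW; apply: lt_trans (archi_boundP _) _.
    by rewrite divr_ge0// ltW.
  by rewrite ltr_nat.
exists (2 ^+ p) => [|n]; first exact: exprn_ge0.
have h : `|pf g n| <= k ^+ n * ('C(p + n, n))%:R.
  elim: n => [|n ih]; first by rewrite /pf poch0 fact0 divr1 normr1 expr0 bin0 mulr1.
  have n0 : (0 : R) < n.+1%:R by rewrite ltr0n.
  rewrite -(ler_pM2l n0) -{1}(gtr0_norm n0) -normrM pfS normrM.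
  have -> : n.+1%:R * (k ^+ n.+1 * ('C(p + n.+1, n.+1))%:R) =
     ((p + n.+1)%:R * k) * (k ^+ n * ('C(p + n, n))%:R) :> R.
    rewrite exprS !mulrA -!(mulrC k) -!mulrA; congr (_ * _).
    rewrite [LHS]mulrCA [RHS]mulrCA; congr (_ * _); rewrite -!natrM; congr (_%:R).
    by rewrite addnS mul_bin_diag.
  apply: ler_pM => //.
  apply: le_trans (ler_normD _ _) _; rewrite [X in _ + X]ger0_norm; last first.
    by rewrite mulr_ge0// ltW.
  by rewrite addnS -addSn natrD mulrDl lerD2r.
apply: le_trans h _; rewrite exprMn mulrA -exprD [leRHS]mulrC ler_wpM2l ?exprn_ge0 ?(ltW k0)//.
rewrite -natrX ler_nat -[leqRHS]/((1 + 1) ^ (p + n))%N Pascal.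
have h : (n < (p + n).+1)%N by rewrite ltnS leq_addl.
by rewrite (bigD1 (Ordinal h))//= !exp1n !muln1 leq_addr.
Qed.
End pochhammer.

Section mlkernel.
Context {R : realType}.
Local Notation mu := (@lebesgue_measure R).
Variables (k alpha : R) (omega : R[i]).
Hypotheses (k0 : 0 < k) (alpha0 : 0 < alpha).

Definition cpowker (z : R) (x : R) : R[i] := (powker k z x)%:C.

Lemma n1_cpowker z x : 0 < z -> n1 (cpowker z x) = powker k z x.
Proof. by move=> z0; rewrite n1_real ger0_norm// powker_ge0. Qed.

Lemma wn_cpowker s z : 0 < s -> 0 < z -> wn s (cpowker z) = ((s * k) `^ (- (z / k)))%:E.
Proof.
move=> s0 z0; rewrite -(ewn_powker k0)//; congr ewn; apply/funext => x.
by rewrite /en n1_cpowker.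
Qed.

Lemma Ls_cpowker s z : 0 < s -> 0 < z -> Ls s (cpowker z).
Proof.
move=> s0 z0; split.
- by apply: cmeas_real; exact: measurable_powker.
- by move=> x x0; rewrite /cpowker /powker ltNge x0.
- by rewrite wn_cpowker// ltry.
Qed.

Lemma conv_cpowker a b x : 0 < a -> 0 < b -> conv (cpowker a) (cpowker b) x = cpowker (a + b) x.
Proof.
move=> a0 b0; apply: complex_ext; rewrite /=.
  rewrite -[RHS]/(fine (powker k (a + b) x)%:E) -(econv_powker k0)//; congr fine.
  by apply: eq_integral => t _; rewrite /= mul0r subr0 EFinM.
by rewrite /Rintegral integral0_eq// => t _; rewrite /= mulr0 mul0r addr0.
Qed.

Definition cf (g : R) n : R[i] := (pf k g n)%:C * omega ^+ n.

Definition eterm (m g : R) n (x : R) : R[i] := cf g n * cpowker (alpha * n%:R + m) x.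

(** The product of the power weight x^(m/k - 1) / k with the Mittag-Leffler
    function of order [m] and exponent [g], see [mlker_ml]. Written as a series of
    power kernels it belongs to the convolution algebra, term by term. *)
Definition mlker (m g : R) : R -> R[i] := aesum (eterm m g).

Lemma cf_add a b n : cf (a + b) n = \sum_(0 <= i < n.+1) cf a i * cf b (n - i).
Proof.
rewrite /cf chu_vandermonde rmorph_sum/= mulr_suml; apply: eq_big_nat => i /andP[_].
rewrite ltnS => iN; rewrite rmorphM/=.
have -> : omega ^+ n = omega ^+ i * omega ^+ (n - i) by rewrite -exprD subnKC.
by move: (pf _ _ _)%:C (pf _ _ _)%:C (omega ^+ _) (omega ^+ _) => ? ? ? ?; ring.
Qed.

(** For such [s] the n-th term of the series has weighted norm at most a multiple
    of 2^(- n), by [pf_bound] and the Laplace transform of the power kernel. *)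
Definition adm (s : R) := 0 < s /\ 2 * k * n1 omega * (s * k) `^ (- (alpha / k)) <= 2^-1.

Lemma powR_small (c e : R) : 0 < c -> 0 < e ->
  exists2 s0, 0 < s0 & forall s, s0 <= s -> (s * k) `^ (- c) <= e.
Proof.
move=> c0 e0; exists (e^-1 `^ c^-1 / k) => [|s hs].
  by rewrite divr_gt0// powR_gt0// invr_gt0.
have sk : e^-1 `^ c^-1 <= s * k by rewrite -ler_pdivrMr.
have p0 : 0 < e^-1 `^ c^-1 by rewrite powR_gt0// invr_gt0.
have sk0 := lt_le_trans p0 sk.
rewrite powRN -[leRHS]invrK lef_pV2 ?posrE ?invr_gt0// ?powR_gt0//.
have -> : e^-1 = (e^-1 `^ c^-1) `^ c.
  by rewrite -powRrM mulVf ?gt_eqF// powRr1// invr_ge0 ltW.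
by rewrite ge0_ler_powR ?nnegrE ?(ltW c0) ?(ltW p0) ?(ltW sk0).
Qed.

Lemma adm_large : exists2 s0, 0 < s0 & forall s, s0 <= s -> adm s.
Proof.
have q0 : 0 < 2 * k * n1 omega + 1.
  by rewrite ltr_wpDl// !mulr_ge0// ?n1_ge0// ltW.
have e0 : 0 < 2^-1 / (2 * k * n1 omega + 1) by rewrite divr_gt0.
have [s0 s00 h] := powR_small (divr_gt0 alpha0 k0) e0.
exists s0 => // s ss0; split; first exact: lt_le_trans ss0.
have := h _ ss0; rewrite ler_pdivlMr// mulrC; apply: le_trans.
by rewrite ler_wpM2r ?powR_ge0// lerDl.
Qed.

Lemma wn_eterm m g : exists2 B, 0 <= B & forall s n, adm s -> 0 < m ->
  (wn s (eterm m g n) <= (B * (s * k) `^ (- (m / k)) / 2 ^+ n)%:E)%E.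
Proof.
have [B B0 hB] := pf_bound k0 g; exists B => // s n [s0 hs] m0.
have sk0 : 0 < s * k by rewrite mulr_gt0.
have z0 : 0 < alpha * n%:R + m by rewrite ltr_wpDl// mulr_ge0// ltW.
apply: le_trans (wnZ _ _ _) _; first by case: (Ls_cpowker s0 z0).
rewrite wn_cpowker// -EFinM lee_fin.
have -> : (s * k) `^ (- ((alpha * n%:R + m) / k)) =
   ((s * k) `^ (- (alpha / k))) ^+ n * (s * k) `^ (- (m / k)).
  rewrite -powR_mulrn ?powR_ge0// -powRrM -powRD; last by apply/implyP => _; rewrite gt_eqF.
  by congr (_ `^ _); field; rewrite gt_eqF.
set t := (s * k) `^ (- (alpha / k)) in hs *.
set u := (s * k) `^ (- (m / k)).
have t0 : 0 <= t by exact: powR_ge0.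
have u0 : 0 <= u by exact: powR_ge0.
have hc : n1 (cf g n) <= B * (2 * k * n1 omega) ^+ n.
  apply: le_trans (n1M _ _) _; rewrite n1_real exprMn mulrA.
  by apply: ler_pM => //; [exact: n1_ge0|exact: n1X].
rewrite mulrA (mulrAC B u) ler_wpM2r//.
apply: le_trans (ler_wpM2r (exprn_ge0 n t0) hc) _.
rewrite -[leLHS]mulrA -[X in B * X]exprMn -exprVn ler_wpM2l//.
apply: lerXn2r => //; rewrite nnegrE ?invr_ge0//.
by rewrite !mulr_ge0// ?n1_ge0// ltW.
Qed.

Lemma nneseries_half (u : nat -> \bar R) (a : R) : 0 <= a ->
  (forall n, 0 <= u n)%E -> (forall n, u n <= (a / 2 ^+ n)%:E)%E ->
  (\sum_(0 <= n <oo) u n <= (2 * a)%:E)%E.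
Proof.
move=> a0 u0 ua; apply: lime_le; first exact: is_cvg_nneseries.
apply: nearW => N; apply: (@le_trans _ _ (\sum_(0 <= i < N) (a / 2 ^+ i)%:E)%E).
  by apply: lee_sum => i _; exact: ua.
rewrite sumEFin lee_fin; suff -> : \sum_(0 <= i < N) a / 2 ^+ i = 2 * a - 2 * a / 2 ^+ N.
  by rewrite lerBlDr lerDl divr_ge0 ?exprn_ge0 ?mulr_ge0.
elim: N => [|N ih]; first by rewrite big_geq// expr0 divr1 subrr.
rewrite big_nat_recr//= ih exprS; field.
by rewrite expf_neq0.
Qed.

Lemma Ls_eterm s m g n : adm s -> 0 < m -> Ls s (eterm m g n).
Proof.
move=> [s0 _] m0; apply: LsZ; apply: Ls_cpowker => //.
by rewrite ltr_wpDl// mulr_ge0// ltW.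
Qed.

Lemma sum_eterm m g : exists2 B, 0 <= B & forall s, adm s -> 0 < m ->
  (\sum_(0 <= n <oo) wn s (eterm m g n) <= (B * (s * k) `^ (- (m / k)))%:E)%E.
Proof.
have [B B0 h] := wn_eterm m g; exists (2 * B); first by rewrite mulr_ge0.
move=> s ads m0; rewrite -mulrA; apply: nneseries_half.
- by rewrite mulr_ge0 ?powR_ge0.
- by move=> n; exact: wn_ge0.
- by move=> n; exact: h.
Qed.

Lemma sum_eterm_lty s m g : adm s -> 0 < m ->
  (\sum_(0 <= n <oo) wn s (eterm m g n) < +oo)%E.
Proof.
by move=> ads m0; have [B B0 h] := sum_eterm m g; apply: le_lt_trans (h _ ads m0) _; rewrite ltry.
Qed.

Lemma Ls_mlker s m g : adm s -> 0 < m -> Ls s (mlker m g).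
Proof.
move=> ads m0; apply: Ls_aesum; last exact: sum_eterm_lty.
by move=> n; exact: Ls_eterm.
Qed.

(** The factor (s k)^(- m / k) makes the norm tend to 0 as [s] grows. *)
Lemma wn_mlker m g : exists2 B, 0 <= B & forall s, adm s -> 0 < m ->
  (wn s (mlker m g) <= (B * (s * k) `^ (- (m / k)))%:E)%E.
Proof.
have [B B0 h] := sum_eterm m g; exists B => // s ads m0.
apply: le_trans (h _ ads m0).
have LF n : Ls s (eterm m g n) by exact: Ls_eterm.
apply: le_trans (aesum_tail LF (sum_eterm_lty g ads m0) 0).
apply: wn_le; [by case: (Ls_mlker g ads m0)| |by move=> x; rewrite big_geq// subr0].
by apply: cmeasB; [case: (Ls_mlker g ads m0)|apply: cmeas_sum => i; case: (LF i)].
Qed.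

(** The Cauchy product of the two series: power kernels of orders
    [alpha * i + m1] and [alpha * j + m2] convolve to one that depends on [i + j]
    only, and the coefficients are summed by [chu_vandermonde]. *)
Lemma conv_mlker s m1 g1 m2 g2 : adm s -> 0 < m1 -> 0 < m2 ->
  {ae mu, forall x, conv (mlker m1 g1) (mlker m2 g2) x = mlker (m1 + m2) (g1 + g2) x}.
Proof.
move=> ads m10 m20; have m0 := addr_gt0 m10 m20; have [s0 _] := ads.
apply: (@conv_aesum _ s); try by [move=> n; exact: Ls_eterm|exact: sum_eterm_lty].
move=> n.
have z0 (i : nat) m : 0 < m -> 0 < alpha * i%:R + m.
  by move=> h; rewrite ltr_wpDl// mulr_ge0// ltW.
have T i j : {ae mu, forall x, conv (eterm m1 g1 i) (eterm m2 g2 j) x =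
    cf g1 i * cf g2 j * cpowker (alpha * (i + j)%:R + (m1 + m2)) x}.
  have L1 := Ls_cpowker s0 (z0 i _ m10); have L2 := Ls_cpowker s0 (z0 j _ m20).
  apply: aeS2 (convZl (cf g1 i) L1 (LsZ (cf g2 j) L2)) (convZr (cf g2 j) L1 L2) => x e1 e2.
  apply: etrans e1 _; rewrite -mulrA; congr (_ * _).
  apply: etrans e2 _; congr (_ * _).
  rewrite (conv_cpowker x (z0 i _ m10) (z0 j _ m20)); congr cpowker.
  by rewrite natrD; ring.
apply: aeS (ae_all_seq (index_iota 0 n.+1) (fun i => T i (n - i)%N)) => x h.
rewrite {1}/eterm cf_add mulr_suml big_seq [RHS]big_seq; apply: eq_bigr => i iN.
have E : (i + (n - i))%N = n by rewrite subnKC//; move: iN; rewrite mem_index_iota ltnS.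
by have := h _ iN; rewrite E => ->.
Qed.

(** Only the first Pochhammer symbol of exponent 0 is nonzero. *)
Lemma mlker_k0 s : adm s -> {ae mu, forall x, mlker k 0 x = if 0 < x then (k^-1)%:C else 0}.
Proof.
move=> ads.
have LF n : Ls s (eterm k 0 n) by exact: Ls_eterm.
apply: aeS (aesum_ae LF (sum_eterm_lty 0 ads k0)) => x; rewrite /mlker => ->.
have -> : (if 0 < x then (k^-1)%:C else 0) = eterm k 0 0 x.
  rewrite /eterm /cf /pf poch0 fact0 divr1 expr0 !mul1r mulr0 add0r /cpowker.
  by case: ifPn => x0; [rewrite powkerk|rewrite /powker (negbTE x0)].
apply: (@cvg_lim R[i]^o) => //; apply: cvg_near_cst.
exists 1%N => // -[//|n] _; rewrite /series/= big_nat_recl//= big1 ?addr0//.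
by move=> i _; rewrite /eterm /cf /pf poch_zeroS !mul0r.
Qed.

(** The kernel is a series of powers of x, from which the common power factors
    out at each point of absolute convergence. *)
Lemma mlker_ml s m g : adm s -> 0 < m -> {ae mu, forall x, 0 < x ->
  ((x `^ (m / k - 1)) / k)%:C *
     kmittag_leffler k alpha m g (omega * (x `^ (alpha / k))%:C) = mlker m g x}.
Proof.
move=> ads m0.
have LF n : Ls s (eterm m g n) by exact: Ls_eterm.
apply: aeS2 (aesum_ae LF (sum_eterm_lty g ads m0)) (aesum_summable LF (sum_eterm_lty g ads m0)).
move=> x rE sx x0; rewrite /mlker rE.
pose c : R := (x `^ (m / k - 1)) / k.
have c0 : c != 0 by rewrite mulf_neq0 ?invr_eq0 ?gt_eqF// powR_gt0.
have cC0 : c%:C != 0 :> R[i] by rewrite eq_complex/= negb_and c0.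
set u := fun n : nat => (kpochhammer k g n / kgamma k (alpha * n%:R + m))%:C *
      ((omega * (x `^ (alpha / k))%:C) ^+ n / (n`!)%:R).
have uE n : u n = c%:C^-1 * eterm m g n x.
  apply: (mulfI cC0); rewrite mulVKf// /u /eterm /cf /cpowker /pf /powker x0.
  have -> : x `^ ((alpha * n%:R + m) / k - 1) = x `^ (m / k - 1) * (x `^ (alpha / k)) ^+ n.
    rewrite -powR_mulrn ?powR_ge0// -powRrM -powRD; last by apply/implyP => _; rewrite gt_eqF.
    by congr (_ `^ _); field; rewrite gt_eqF.
  have -> : (n`!)%:R = ((n`!)%:R : R)%:C by rewrite rmorph_nat.
  rewrite /c exprMn -!rmorphXn/= !rmorphM/= !fmorphV/= !rmorphM/=.
  have kg : kgamma k (alpha * n%:R + m) != 0.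
    have : k * kgamma k (alpha * n%:R + m) != 0.
      by rewrite gt_eqF// kgamma_gt0// ltr_wpDl// mulr_ge0// ltW.
    by rewrite mulf_eq0 negb_or => /andP[].
  have H (r : R) : r != 0 -> r%:C != 0 :> R[i] by move=> r0; rewrite eq_complex/= negb_and r0.
  field.
  by rewrite !fmorph_eq0 kg gt_eqF//= fct_neq0.
have -> : kmittag_leffler k alpha m g (omega * (x `^ (alpha / k))%:C) =
    csum (fun n => c%:C^-1 * eterm m g n x).
  by congr csum; apply/funext => n; exact: uE.
by rewrite csumZ// mulVKf.
Qed.
End mlkernel.

(** * Increasing absolutely continuous functions *)
Section absolute_continuity.
Context {R : realType}.
Local Notation mu := (@lebesgue_measure R).
Implicit Types (p q : R * R) (s : seq (R * R)).

(** The open intervals with end points [p] and [q] do not overlap; degenerate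
    intervals are allowed. *)
Definition disj p q := Num.min p.2 q.2 <= Num.max p.1 q.1.

Definition oriented p := p.1 <= p.2.

(** Absolute continuity on the whole line. Intervals are listed in a sequence, so
    that families can be extended and concatenated in inductions; the non-strict
    bound survives passage to suprema. *)
Definition acl (h : R -> R) := forall e, 0 < e -> exists2 d, 0 < d &
  forall s, all oriented s -> pairwise disj s ->
    \sum_(p <- s) (p.2 - p.1) < d -> \sum_(p <- s) `|h p.2 - h p.1| <= e.

Lemma disjP p q : (forall x, p.1 < x < p.2 -> q.1 < x < q.2 -> False) -> disj p q.
Proof.
move=> h; rewrite /disj leNgt; apply/negP => hlt.
pose x := (Num.max p.1 q.1 + Num.min p.2 q.2) / 2.
have [] := midf_lt hlt; rewrite -/x gt_max lt_min => /andP[a b] /andP[c d].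
by apply: (h x); rewrite ?a ?b ?c ?d.
Qed.

Lemma acl_continuous h : acl h -> continuous h.
Proof.
move=> ac x; apply/cvgrPdist_le => e e0; have [d d0 hd] := ac _ e0.
near=> y.
have yx : `|x - y| < d by near: y; apply: cvgr_dist_lt => //; exact: cvg_id.
have [xy|/ltW yx'] := leP x y.
  have := hd [:: (x, y)]; rewrite /= !big_seq1 /oriented/= xy distrC => -> //.
  by move: yx; rewrite distrC ger0_norm// subr_ge0.
have := hd [:: (y, x)]; rewrite /= !big_seq1 /oriented/= yx' => -> //.
by move: yx; rewrite ger0_norm// subr_ge0.
Unshelve. all: by end_near. Qed.

Section monotone.
Variable h : R -> R.
Hypotheses (nd : {homo h : x y / x <= y}) (ac : acl h).

Let rc := right_continuousW (acl_continuous ac).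
Let h1 := h.
HB.instance Definition _ := isCumulative.Build R _ R h1 nd rc.
Let hc : cumulative R R := h1.

Let nu : {measure set (measurableTypeR R) -> \bar R} := lebesgue_stieltjes_measure hc.

Let nuE a b : a <= b -> nu `]a, b]%classic = (h b - h a)%:E.
Proof.
move=> ab; transitivity (lebesgue_stieltjes_measure hc `]a, b]%classic); first by [].
rewrite /lebesgue_stieltjes_measure /measure_extension measurable_mu_extE/=.
  by rewrite wlength_itv_bnd.
exact: is_ocitv.
Qed.

Let nu_dom : nu `<< mu.
Proof.
apply/null_content_dominatesP => N mN N0; apply/eqP; rewrite -measure_le0.
apply/lee_addgt0Pr => e e0; rewrite add0e.
have [d d0 hd] := ac e0.
have [|U [oU NU Ud]] := @lebesgue_regularity_outer R N d mN _ d0; first by rewrite [X in (X < _)%E]N0 ltry.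
have mU : measurable U := open_measurable oU.
have {}Ud : (mu U < d%:E)%E.
  rewrite -(setDUK NU); apply: le_lt_trans (measureU2 _ _ _) _ => //; first exact: measurableD.
  by rewrite [X in (X + _)%E]N0 add0e.
pose I := open_disjoint_itv oU.
have mI i : measurable (I i) by apply: open_measurable; exact: open_disjoint_itv_open.
have UI : U = \bigcup_i I i := open_disjoint_itv_bigcup oU.
have tI : trivIset [set: nat] I := @open_disjoint_itv_trivIset R U oU.
have IU i : I i `<=` U by rewrite UI => x Ix; exists i.
(* Each component of the open set is an interval (p.1, p.2), or empty. *)
have P i : exists p, [/\ oriented p, forall x, p.1 < x < p.2 -> I i x,
    mu (I i) = (p.2 - p.1)%:E & (nu (I i) <= (h p.2 - h p.1)%:E)%E].
  have [I0|I0] := eqVneq (I i) set0.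
    exists (0, 0); split; [by rewrite /oriented/=| | |] => /=.
    - by move=> x /andP[/lt_trans xx /xx]; rewrite ltxx.
    - by rewrite I0 measure0 subrr.
    - by rewrite I0 measure0 subrr.
  have fin : (mu (I i) < +oo)%E.
    apply: (@le_lt_trans _ _ (mu U)); first by apply: le_measure; [apply/mem_set; exact: mI|exact/mem_set|exact: IU].
    exact: lt_trans Ud (ltry _).
  have E : I i = [set` Rhull (I i)].
    by rewrite RhullK// inE; exact: open_disjoint_itv_is_interval.
  have oI : open (I i) := @open_disjoint_itv_open R U oU i.
  move: E fin; case: (Rhull (I i)) => -[ba a|ba] [bb b|bb] E fin; first last.
  - by move: fin I0; rewrite E lebesgue_measure_itv; case: ba bb {E} => [] [] //=;
      rewrite set_itv_ge ?eqxx.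
  - by move: fin I0; rewrite E lebesgue_measure_itv; case: ba {E} => //=;
      [rewrite ltNyr|rewrite set_itv_ge ?eqxx].
  - by move: fin I0; rewrite E lebesgue_measure_itv; case: bb {E} => //=;
      [rewrite set_itv_ge ?eqxx|rewrite ltry].
  have [ab|ab] := leP a b; last first.
    move: I0; rewrite E set_itv_ge ?eqxx//.
    by case: (ba); case: (bb); rewrite bnd_simp -?leNgt -?ltNge// ltW.
  exists (a, b); split; [by rewrite /oriented/=| | |] => /=.
  - move=> x /andP[ax xb]; rewrite E /= itv_boundlr; apply/andP; split.
      by case: (ba); rewrite bnd_simp// ltW.
    by case: (bb); rewrite bnd_simp// ltW.
  - rewrite E lebesgue_measure_itv/= lte_fin; move: ab; rewrite le_eqVlt => /orP[/eqP ->|->//].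
    by rewrite ltxx subrr.
  - rewrite -(nuE ab); apply: le_measure.
    + apply/mem_set; exact: mI.
    + apply/mem_set; exact: measurable_itv.
    move=> x Ix /=.
    have : x \in Interval (BSide ba a) (BSide bb b) by move: Ix; rewrite E.
    rewrite itv_boundlr => /andP[ax xb]; rewrite in_itv/=; apply/andP; split; last first.
      by move: xb; case: (bb); rewrite bnd_simp// => /ltW.
    have {}ax : a <= x by move: ax; case: (ba); rewrite bnd_simp// => /ltW.
    rewrite lt_neqAle ax andbT; apply/negP => /eqP xa.
    move: Ix; rewrite -xa => Ia; have := oI; rewrite openE => /(_ _ Ia)/=.
    move=> /nbhs_ballP[r/= r0] /(_ (a - r / 2)) /=.
    rewrite /ball/= opprB addrC subrK ger0_norm ?divr_ge0 ?(ltW r0)//.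
    have hr : r / 2 < r by rewrite ltr_pdivrMr// ltr_pMr// ltr1n.
    move=> /(_ hr); rewrite E /= itv_boundlr => /andP[+ _].
    have : a - r / 2 < a by rewrite ltrBlDr ltrDl divr_gt0.
    by move=> k; case: (ba); rewrite bnd_simp => k';
      [have := lt_le_trans k k'|have := lt_trans k k']; rewrite ltxx.
have mU' (m : {measure set (measurableTypeR R) -> \bar R}) :
    m U = (\sum_(0 <= i <oo) m (I i))%E.
  rewrite [in LHS]UI measure_bigcup//; last by move=> i _; exact: mI.
  by apply: eq_eseriesl => i; rewrite in_setT.
have [pp ppP] : exists pp : nat -> R * R, forall i,
    [/\ oriented (pp i), forall x, (pp i).1 < x < (pp i).2 -> I i x,
    mu (I i) = ((pp i).2 - (pp i).1)%:E & (nu (I i) <= (h (pp i).2 - h (pp i).1)%:E)%E].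
  by exists (fun i => sval (cid (P i))) => i; exact: svalP (cid (P i)).
have NU' : (nu N <= nu U)%E.
  by apply: le_measure => //; apply/mem_set; [exact: mN|exact: mU].
apply: (le_trans NU').
rewrite mU'; apply: lime_le.
  by apply: is_cvg_nneseries => n _ _; exact: measure_ge0.
apply: nearW => n.
pose s := [seq pp i | i <- iota 0 n].
have sE (F : R * R -> R) : \sum_(p <- s) F p = \sum_(0 <= i < n) F (pp i).
  by rewrite /s big_map /index_iota subn0.
apply: (@le_trans _ _ (\sum_(0 <= i < n) (h (pp i).2 - h (pp i).1)%:E)%E).
  by apply: lee_sum => i _; have [] := ppP i.
rewrite sumEFin lee_fin.
have := hd s; rewrite !sE => H.
apply: le_trans (H _ _ _); clear H.
- by apply: ler_sum => i _; exact: ler_norm.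
- by apply/allP => p /mapP[i _ ->]; have [] := ppP i.
- rewrite pairwise_map; apply/(pairwiseP 0%N) => i j; rewrite !inE !size_iota => iN jN ij.
  rewrite !nth_iota// !add0n/=; apply: disjP => x xi xj.
  have [_ Ii _ _] := ppP i; have [_ Ij _ _] := ppP j.
  have : (I i `&` I j) !=set0 by exists x; split; [exact: Ii|exact: Ij].
  by move=> /tI - /(_ Logic.I Logic.I) E; move: ij; rewrite E ltnn.
- rewrite -lte_fin; apply: le_lt_trans Ud; rewrite -sumEFin.
  rewrite mU'; apply: (@le_trans _ _ (\sum_(0 <= i < n) mu (I i))%E).
    by apply: lee_sum => i _; have [_ _ ->] := ppP i.
  by apply: nneseries_lim_ge => i _ _; exact: measure_ge0.
Qed.

(** The Lebesgue-Stieltjes measure of an increasing absolutely continuous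
    function is absolutely continuous: a null set is covered by an open set of
    small measure, whose components are intervals with a small total increment.
    The Radon-Nikodym theorem then provides the density. *)
Lemma monotone_ac_density (b : R) : 0 <= b -> exists2 f : R -> R,
  mu.-integrable setT (EFin \o f) &
  forall x, 0 <= x <= b -> h x - h 0 = \int[mu]_(t in `]0, x]) f t.
Proof.
move=> b0.
have mD : measurable (`]0, b]%classic : set (measurableTypeR R)) by [].
have fin : (nu `]0%R, b]%classic < +oo)%E by rewrite nuE// ltry.
pose nub : {finite_measure set (measurableTypeR R) -> \bar R} := mfrestr mD fin.
have dom : nub `<< mu.
  move=> N N0 A mA AN; apply/eqP; rewrite -measure_le0 /nub /= /mfrestr /mrestr.
  apply: (@le_trans _ _ (nu A)).
    apply: le_measure; rewrite ?inE//; first exact: measurableI.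
  by rewrite (nu_dom N0).
have [f [f0 ffin If fE]] := radon_nikodym_sigma_finite dom.
exists (fine \o f).
  by apply: eq_integrable If => // x _ /=; rewrite fineK.
move=> x /andP[x0 xb]; have m : measurable (`]0, x]%classic : set (measurableTypeR R)) by [].
have := fE _ m; rewrite /nub /= /mfrestr /mrestr setIidl; last first.
  by apply: subset_itvl; rewrite bnd_simp.
rewrite nuE// => E; rewrite /Rintegral.
under eq_integral do rewrite /= fineK//.
by rewrite -E.
Qed.
End monotone.
End absolute_continuity.

(** * Absolutely continuous functions are integrals *)
Section total_variation.
Context {R : realType}.
Local Notation mu := (@lebesgue_measure R).
Local Notation TV := (@total_variation R).
Implicit Types (p q : R * R) (s : seq (R * R)) (a b : R).

Lemma disj_sub p q p' q' : disj p q -> p.1 <= p'.1 -> p'.2 <= p.2 ->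
  q.1 <= q'.1 -> q'.2 <= q.2 -> disj p' q'.
Proof.
rewrite /disj => h a1 a2 b1 b2; apply: (@le_trans _ _ (Num.min p.2 q.2)).
  by rewrite le_min !ge_min a2 b2 orbT.
apply: le_trans h _.
by rewrite ge_max !le_max a1 b1 orbT.
Qed.

(** The intervals of the partition [a :: t]. *)
Definition steps a (t : seq R) : seq (R * R) := [seq (x.2, x.1) | x <- zip t (a :: t)].

Lemma steps_cons a x t : steps a (x :: t) = (a, x) :: steps x t.
Proof. by []. Qed.

Lemma stepsP a (t : seq R) : path <%O a t ->
  [/\ all oriented (steps a t),
      all (fun q => (a <= q.1) && (q.2 <= last a t)) (steps a t),
      pairwise disj (steps a t) &
      \sum_(q <- steps a t) (q.2 - q.1) = last a t - a].
Proof.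
elim: t a => [|x t ih] a /=; first by move=> _; rewrite big_nil subrr.
move=> /andP[ax xt]; have [i1 i2 i3 i4] := ih _ xt.
have xl : x <= last x t.
  by elim: (t) (x) xt => //= y u ihu z /andP[zy yu]; exact: le_trans (ltW zy) (ihu _ yu).
rewrite steps_cons; split => /=.
- by rewrite /oriented /= ltW.
- rewrite lexx xl/=; apply: sub_all i2 => q /andP[xq ->]; rewrite andbT.
  exact: le_trans (ltW ax) xq.
- rewrite i3 andbT; apply: sub_all i2 => q /andP[xq _].
  by rewrite /disj /= ge_min le_max xq orbT.
- by rewrite big_cons i4 /= addrC addrA subrK.
Qed.

Lemma variation_steps a b (g : R -> R) (t : seq R) : itv_partition a b t ->
  variation a b g t = \sum_(q <- steps a t) `|g q.2 - g q.1|.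
Proof. by move=> abt; rewrite variation_zip// /steps big_map. Qed.

(** Absolute continuity is inherited by the variation, with the same modulus:
    replacing each interval by a partition of it does not change the total
    length. *)
Lemma acl_total_variation (g : R -> R) (e d : R) :
  (forall s, all oriented s -> pairwise disj s ->
    \sum_(p <- s) (p.2 - p.1) < d -> \sum_(p <- s) `|g p.2 - g p.1| <= e) ->
  forall s, all oriented s -> pairwise disj s -> \sum_(p <- s) (p.2 - p.1) < d ->
    (\sum_(p <- s) TV p.1 p.2 g <= e%:E)%E.
Proof.
move=> H s os ds ls.
(* The intervals of [L2] are refined one at a time; those of [L1] are already
   refined and contribute increments instead of variations. *)
suff W L2 L1 : all oriented (L1 ++ L2) -> pairwise disj (L1 ++ L2) ->
    \sum_(p <- L1 ++ L2) (p.2 - p.1) < d ->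
    ((\sum_(p <- L1) `|g p.2 - g p.1|)%:E + \sum_(p <- L2) TV p.1 p.2 g <= e%:E)%E.
  by have := W s [::] os ds ls; rewrite big_nil add0e.
elim: L2 L1 => [|p L2 ih] L1.
  by rewrite cats0 big_nil adde0 lee_fin; exact: H.
rewrite all_cat pairwise_cat allrel_consr/= => /andP[os1 /andP[osp os2]].
move=> /and4P[/andP[d1p d12] dd1 dp2 dd2] len.
rewrite big_cons.
have tv0 : (0 <= \sum_(q <- L2) TV q.1 q.2 g)%E.
  rewrite big_seq; apply: sume_ge0 => q qL; apply: total_variation_ge0.
  by move/allP: os2 => /(_ _ qL).
have key (t : seq R) : itv_partition p.1 p.2 t ->
    ((\sum_(q <- L1) `|g q.2 - g q.1|)%:E + ((variation p.1 p.2 g t)%:E +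
      \sum_(q <- L2) TV q.1 q.2 g) <= e%:E)%E.
  move=> tP; rewrite variation_steps// addeA -EFinD -big_cat.
  have [pt /eqP lt] := tP; have [s1 s2 s3 s4] := stepsP pt; rewrite lt in s2 s4.
  apply: ih.
  - by rewrite !all_cat os1 s1 os2.
  - rewrite pairwise_cat pairwise_cat dd1 s3 dd2 !andbT; apply/andP; split.
      rewrite allrel_catl d12/=; apply/allrelP => q r qs rL.
      move/allP : s2 => /(_ _ qs)/andP[h1 h2].
      by move/allP : dp2 => /(_ _ rL) h; apply: (disj_sub h).
    apply/allrelP => q r qL rs; move/allP : s2 => /(_ _ rs)/andP[h1 h2].
    by move/allP : d1p => /(_ _ qL) h; apply: (disj_sub h).
  - move: len; rewrite !big_cat/= big_cons s4; apply: le_lt_trans.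
    by rewrite addrA.
set c := \sum_(q <- L1) _ in key *; set D := (\sum_(q <- L2) _)%E in tv0 key *.
have Dfin : D \is a fin_num.
  rewrite ge0_fin_numE//; have [pp|pp] := eqVneq p.1 p.2.
    have := key [::]; rewrite /itv_partition /= pp eqxx variation_nil add0e => /(_ (conj isT isT)) k.
    rewrite ltNge leye_eq; apply/negP => /eqP E; move: k; rewrite E addey//.
  have lt : p.1 < p.2 by rewrite lt_neqAle pp.
  have := key [:: p.2] (itv_partition1 lt) => k.
  by rewrite ltNge leye_eq; apply/negP => /eqP E; move: k; rewrite E addey// addey.
rewrite addeCA -leeBrDr ?fin_numD//.
rewrite /total_variation; apply: ge_ereal_sup => _ [_ [t tP <-] <-].
by rewrite leeBrDr ?fin_numD// addeCA; exact: key.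
Qed.

(** The retraction of the line onto [0, b]; composing with it extends a function
    on the interval to the line. *)
Definition clamp (b x : R) := Num.min (Num.max x 0) b.

Lemma clamp_in b x : 0 <= b -> 0 <= clamp b x <= b.
Proof. by move=> b0; rewrite /clamp le_min b0 le_max lexx orbT ge_min lexx orbT. Qed.

Lemma clamp_id b x : 0 <= x <= b -> clamp b x = x.
Proof. by move=> /andP[x0 xb]; rewrite /clamp (max_idPl x0) (min_idPl xb). Qed.

Lemma clamp_nd b : {homo clamp b : x y / x <= y}.
Proof.
by move=> x y xy; rewrite /clamp le_min !ge_min !ge_max !le_max xy !lexx /= !orbT.
Qed.

Lemma clamp_lip b x y : x <= y -> clamp b y - clamp b x <= y - x.
Proof.
move=> xy; rewrite /clamp /Num.min /Num.max.
by case: (ltP y 0) => ?; case: (ltP x 0) => ?; do ?case: ltP => ?; lra.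
Qed.

Lemma clamp_disj b p q : disj p q ->
  disj (clamp b p.1, clamp b p.2) (clamp b q.1, clamp b q.2).
Proof.
rewrite /disj/=; have mono := @clamp_nd b.
move=> h.
have -> : Num.min (clamp b p.2) (clamp b q.2) = clamp b (Num.min p.2 q.2).
  by case: (leP p.2 q.2) => pq; [apply/min_idPl|apply/min_idPr]; apply: mono => //; exact: ltW.
have -> : Num.max (clamp b p.1) (clamp b q.1) = clamp b (Num.max p.1 q.1).
  by case: (leP p.1 q.1) => pq; [apply/max_idPr|apply/max_idPl]; apply: mono => //; exact: ltW.
exact: mono.
Qed.

(** The real counterpart of [abs_continuous], with the non-strict bound of
    [acl]. *)
Definition ac_on (b : R) (g : R -> R) := forall e, 0 < e -> exists2 d, 0 < d &
  forall (n : nat) (u v : 'I_n -> R),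
    (forall i, 0 <= u i /\ u i <= v i /\ v i <= b) ->
    trivIset [set: 'I_n] (fun i => [set x : R | u i < x < v i]) ->
    \sum_(i < n) (v i - u i) < d ->
    \sum_(i < n) `|g (v i) - g (u i)| <= e.

Lemma ac_on_acl b g : 0 <= b -> ac_on b g -> acl (g \o clamp b).
Proof.
move=> b0 ac e e0; have [d d0 H] := ac _ e0; exists d => // s os ds ls.
pose c (p : R * R) := (clamp b p.1, clamp b p.2).
pose z : R * R := (0, 0).
have := H (size s) (fun i => clamp b (nth z s i).1) (fun i => clamp b (nth z s i).2).
have E (F : R * R -> R) : \sum_(p <- s) F p = \sum_(i < size s) F (nth z s i).
  by rewrite (big_nth z) big_mkord.
rewrite (E (fun p => `|(g \o clamp b) p.2 - (g \o clamp b) p.1|)) /=; apply.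
- move=> i; have /andP[-> _] := clamp_in (nth z s i).1 b0.
  have /andP[_ ->] := clamp_in (nth z s i).2 b0; split => //; split => //.
  by apply: clamp_nd; move/allP: os; apply; exact: mem_nth.
- apply/trivIsetP => i j _ _ ij; rewrite -subset0 => x /= [xi xj].
  wlog lt : i j ij xi xj / (i < j)%N.
    move=> W; case: (ltngtP i j) => [||/val_inj] h.
    + exact: (W i j).
    + by apply: (W j i) => //; rewrite eq_sym.
    + by rewrite h eqxx in ij.
  have := (pairwiseP z ds) i j; rewrite !inE => /(_ (ltn_ord i) (ltn_ord j) lt).
  move=> /(@clamp_disj b _ _); rewrite /disj /= leNgt => /negP; apply.
  move: xi xj => /andP[x1 x2] /andP[x3 x4].
  rewrite lt_min !gt_max (lt_trans x1 x2) (lt_trans x3 x4).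
  by rewrite (lt_trans x3 x2) (lt_trans x1 x4).
- apply: le_lt_trans ls; rewrite (E (fun p => p.2 - p.1)); apply: ler_sum => i _.
  by apply: clamp_lip; move/allP: os; apply; exact: mem_nth.
Qed.

Lemma acl_sub (f g : R -> R) : acl f -> acl g -> acl (fun x => f x - g x).
Proof.
move=> af ag e e0; have e20 : 0 < e / 2 by rewrite divr_gt0.
have [d1 d10 h1] := af _ e20; have [d2 d20 h2] := ag _ e20.
exists (Num.min d1 d2) => [|s os ds]; first by rewrite lt_min d10.
rewrite lt_min => /andP[l1 l2].
apply: (@le_trans _ _ (\sum_(p <- s) (`|f p.2 - f p.1| + `|g p.2 - g p.1|))).
  apply: ler_sum => p _; apply: le_trans (ler_normB _ _).
  by rewrite le_eqVlt; apply/orP; left; apply/eqP; congr `|_|; ring.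
rewrite big_split/= [leRHS](splitr e); apply: lerD; [exact: h1|exact: h2].
Qed.

(** Jordan's decomposition: the variation from 0 and its difference with the
    function are both increasing and absolutely continuous. *)
Lemma ac_density b g : 0 < b -> ac_on b g -> exists2 f : R -> R,
  mu.-integrable setT (EFin \o f) &
  forall x, 0 <= x <= b -> g x - g 0 = \int[mu]_(t in `]0, x]) f t.
Proof.
move=> b0 ac; have b0' := ltW b0.
pose G := g \o clamp b; have aG : acl G := ac_on_acl b0' ac.
have tvfin x : 0 <= x <= b -> TV 0 x G \is a fin_num.
  have [d d0 hd] := aG 1 ltr01.
  have tv := acl_total_variation hd.
  have small y z : y <= z -> z - y < d -> (TV y z G < +oo)%E.
    move=> yz zyd; apply: le_lt_trans (ltry 1).
    by have := tv [:: (y, z)]; rewrite /= !big_seq1 /oriented/= yz; exact.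
  pose k := d / 2; have k0 : 0 < k by rewrite divr_gt0.
  have kd : k < d by rewrite /k ltr_pdivrMr// ltr_pMr// ltr1n.
  (* The variation is finite on steps of length below [d], hence on finitely
     many of them. *)
  suff W n y : 0 <= y -> y <= n%:R * k -> (TV 0 y G < +oo)%E.
    move=> /andP[x0 xb]; rewrite ge0_fin_numE ?total_variation_ge0//.
    apply: (W (Num.bound (x / k))) => //.
    by rewrite -ler_pdivrMr// ltW// archi_boundP// divr_ge0// ltW.
  elim: n y => [|n ih] y y0.
    rewrite mul0r => y1; have -> : y = 0 by apply/eqP; rewrite eq_le y1.
    by rewrite total_variationxx ltry.
  move=> yn; have [yk|yk] := leP y k.
    by apply: small => //; rewrite subr0; exact: le_lt_trans kd.
  have z0 : 0 <= y - k by rewrite subr_ge0 ltW.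
  have zy : y - k <= y by rewrite gerBl ltW.
  rewrite (total_variationD G z0 zy); apply: lte_add_pinfty.
    by apply: ih => //; move: yn; rewrite -natr1 mulrDl mul1r; lra.
  by apply: small => //; rewrite opprB addrC subrK.
pose v x := fine (TV 0 (clamp b x) G).
have vE x y : x <= y -> (v y - v x)%:E = TV (clamp b x) (clamp b y) G.
  move=> xy; have /andP[x0 xb] := clamp_in x b0'; have cxy := @clamp_nd b _ _ xy.
  have yin := clamp_in y b0'; have xin := clamp_in x b0'.
  have := total_variationD G x0 cxy.
  rewrite EFinB /v !fineK ?tvfin// => ->.
  by rewrite addeAC subee ?add0e// tvfin.
have ndv : {homo v : x y / x <= y}.
  move=> x y xy; rewrite -subr_ge0 -lee_fin vE// total_variation_ge0//.
  exact: clamp_nd.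
have Gc x : G (clamp b x) = G x by rewrite /G/= (clamp_id (clamp_in x b0')).
have av : acl v.
  move=> e e0; have [d d0 hd] := aG _ e0; exists d => // s os ds ls.
  rewrite -lee_fin -sumEFin.
  pose s' := [seq (clamp b p.1, clamp b p.2) | p <- s].
  apply: (@le_trans _ _ (\sum_(p <- s') TV p.1 p.2 G)%E).
    rewrite /s' big_map big_seq [leRHS]big_seq; apply: lee_sum => p ps.
    have osp : p.1 <= p.2 by move/allP: os => /(_ _ ps).
    by rewrite -vE// ger0_norm// subr_ge0 ndv.
  apply: (acl_total_variation hd).
  - by rewrite all_map; apply: sub_all os => p; rewrite /oriented /=; exact: clamp_nd.
  - rewrite pairwise_map; apply: sub_pairwise ds => p q; exact: clamp_disj.
  - apply: le_lt_trans ls; rewrite big_map big_seq [leRHS]big_seq; apply: ler_sum => p ps.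
    by apply: clamp_lip; move/allP: os => /(_ _ ps).
have ndw : {homo (fun x => v x - G x) : x y / x <= y}.
  move=> x y xy.
  have : G y - G x <= v y - v x.
    rewrite -lee_fin vE// -(Gc x) -(Gc y).
    apply: (le_trans _ (total_variation_ge G (@clamp_nd b _ _ xy))).
    by rewrite lee_fin ler_norm.
  by lra.
have [f1 i1 F1] := monotone_ac_density ndv av b0'.
have [f2 i2 F2] := monotone_ac_density ndw (acl_sub av aG) b0'.
exists (fun x => f1 x - f2 x).
  by apply: eq_integrable (integrableB measurableT i1 i2) => // x _; rewrite /= EFinB.
move=> x xb; have := F1 _ xb; have := F2 _ xb.
rewrite RintegralB//; last 2 first.
- exact: integrableS i1.
- exact: integrableS i2.
move=> <- <-; rewrite /G/= !clamp_id//; last by rewrite lexx.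
by ring.
Qed.
End total_variation.

(** * Differentiation of integrals and convolution with a step *)
Section ftc.
Context {R : realType}.
Local Notation mu := (@lebesgue_measure R).

Definition primitive (f : R -> R) (y : R) : R := \int[mu]_(t in `]0, y]) f t.

Lemma integrable_FTC1 (f : R -> R) : mu.-integrable setT (EFin \o f) ->
  {ae mu, forall x, 0 < x ->
     derivable (primitive f) x 1 /\ derive1 (primitive f) x = f x}.
Proof.
move=> If.
have h1 y : mu.-integrable [set` Interval (BRight 0) (BRight y)] (EFin \o f).
  exact: integrableS If.
have h2 : locally_integrable setT f by apply: open_integrable_locally => //; exact: openT.
apply: aeS (FTC1 h1 h2) => x + x0; apply.
by rewrite lte_fin.
Qed.

(** Lebesgue's form of the fundamental theorem for an absolutely continuous
    function; the derivative at an interior point does not see values of the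
    function outside [(0, b]]. *)
Lemma ac_ftc b (g : R -> R) : 0 < b -> ac_on b g -> exists f : R -> R,
  [/\ mu.-integrable setT (EFin \o f),
  forall x, 0 <= x <= b -> g x - g 0 = primitive f x &
  {ae mu, forall x, 0 < x < b ->
    forall G : R -> R, (forall y, 0 < y <= b -> G y = g y) -> derive1 G x = f x}].
Proof.
move=> b0 ac; have [f If fE] := ac_density b0 ac.
exists f; split => //.
apply: aeS (integrable_FTC1 If) => x H /andP[x0 xb] G Gg.
have [dF <-] := H x0; set F := primitive f in dF *.
have near_G : \forall y \near x, G y = cst (g 0) y + F y.
  near=> y; have y0 : 0 < y by near: y; exact: lt_nbhsr.
  have yb : y < b by near: y; exact: lt_nbhsl.
  have E : g y - g 0 = F y by apply: fE; rewrite (ltW y0) (ltW yb).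
  by rewrite Gg ?y0 ?(ltW yb)// -E /cst addrC subrK.
rewrite !derive1E (@near_eq_derive _ _ _ G (cst (g 0) \+ F)) ?oner_neq0//.
by rewrite deriveD// derive_cst add0r.
Unshelve. all: by end_near. Qed.

(** The integral is continuous in its upper end, so it vanishes identically, and
    its derivative is the integrand almost everywhere. *)
Lemma integral_itv_eq0 b (f : R -> R) : mu.-integrable setT (EFin \o f) ->
  {ae mu, forall x, 0 < x < b -> primitive f x = 0} ->
  {ae mu, forall x, 0 < x < b -> f x = 0}.
Proof.
move=> If F0; have [b0|b0] := leP b 0.
  by apply: ae_all => x /andP[x0 xb]; have := lt_trans x0 xb; rewrite ltNge b0.
pose F := primitive f.
have cF : {in `]0, b[, continuous F}.
  have FE : F = fun x => parameterized_integral mu 0 x f.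
    apply/funext => x; rewrite /F /primitive /parameterized_integral.
    rewrite (@Rintegral_itv_obnd_cbnd _ 0 (BRight x))//.
    exact: integrableS If.
  suff /(continuous_within_itvP F b0)[] : {within `[0, b], continuous F} by [].
  rewrite FE; apply: parameterized_integral_continuous; first exact: ltW.
  exact: integrableS If.
have F00 x : 0 < x < b -> F x = 0.
  move=> xb; apply: contrapT => Fx0.
  have /(cF _) cx : x \in `]0, b[ by rewrite in_itv.
  have nF : \forall y \near x, F y != 0.
    have : `|F x| > 0 by rewrite normr_gt0; apply/eqP.
    move=> h; near=> y.
    have : `|F x - F y| < `|F x| by near: y; apply: cvgr_dist_lt.
    by apply: contraTneq => ->; rewrite subr0 ltxx.
  have nb : \forall y \near x, 0 < y < b.
    move/andP: xb => [x0 xb]; near=> y; apply/andP; split; near: y.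
      exact: lt_nbhsr.
    exact: lt_nbhsl.
  have : \forall y \near x, F y != 0 /\ 0 < y < b by apply: filterI.
  move=> /nbhs_ballP[r /= r0 br].
  have [Z [mZ Z0 sZ]] := F0.
  have : (mu (ball x r) <= mu Z)%E.
    apply: le_measure; rewrite ?inE//; first exact: measurable_ball.
    move=> y /br[Fy yb]; apply: sZ => /= h.
    by move: Fy; rewrite /F h// eqxx.
  rewrite Z0 (lebesgue_measure_ball _ (ltW r0)) lee_fin leNgt => /negP; apply.
  by rewrite mulrn_wgt0.
apply: aeS (integrable_FTC1 If) => x H xb.
have [x0 _] := andP xb; have [_ <-] := H x0.
rewrite derive1E (@near_eq_derive _ _ _ _ (cst 0)) ?oner_neq0//.
  by rewrite derive_cst.
have [_ xb'] := andP xb; near=> y; apply: F00; apply/andP; split; near: y.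
  exact: lt_nbhsr.
exact: lt_nbhsl.
Unshelve. all: by end_near. Qed.

End ftc.

Section heaviside.
Context {R : realType}.
Local Notation mu := (@lebesgue_measure R).
Local Notation Re := complex.Re.
Local Notation Im := complex.Im.
Variable k : R.
Hypothesis k0 : 0 < k.

Definition cpatch (D : set R) (y : R -> R[i]) (t : R) : R[i] :=
  if t \in D then y t else 0.

Lemma Re_cpatch D y t : Re (cpatch D y t) = ((fun t => Re (y t)) \_ D) t.
Proof. by rewrite /cpatch patchE; case: ifP. Qed.

Lemma Im_cpatch D y t : Im (cpatch D y t) = ((fun t => Im (y t)) \_ D) t.
Proof. by rewrite /cpatch patchE; case: ifP. Qed.

Lemma integrable_patch D (u : R -> R) : measurable D ->
  mu.-integrable D (EFin \o u) -> mu.-integrable setT (EFin \o (u \_ D)).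
Proof.
move=> mD /(integrable_mkcond _ mD); apply: eq_integrable => // x _.
by rewrite /= !patchE; case: ifP.
Qed.

Lemma cL1P (y : R -> R[i]) : mu.-integrable setT (EFin \o (fun t => Re (y t))) ->
  mu.-integrable setT (EFin \o (fun t => Im (y t))) -> cL1 y.
Proof.
move=> I1 I2.
have m1 : measurable_fun setT (fun t => Re (y t)).
  by apply/measurable_EFinP; exact: measurable_int I1.
have m2 : measurable_fun setT (fun t => Im (y t)).
  by apply/measurable_EFinP; exact: measurable_int I2.
split => //.
under eq_integral do rewrite /n1 EFinD.
rewrite ge0_integralD//; last 2 first.
- by apply/measurable_EFinP; exact: measurableT_comp.
- by apply/measurable_EFinP; exact: measurableT_comp.
by apply: lte_add_pinfty; [case/integrableP: I1|case/integrableP: I2].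
Qed.

Lemma cL1_cpatch D (y : R -> R[i]) : measurable D -> cintegrable D y -> cL1 (cpatch D y).
Proof.
move=> mD [I1 I2]; apply: cL1P.
  under eq_fun do rewrite Re_cpatch; exact: integrable_patch I1.
under eq_fun do rewrite Im_cpatch; exact: integrable_patch I2.
Qed.

Lemma Ls_cL1 s (v : R -> R[i]) : 0 <= s -> cL1 v -> causal v -> Ls s v.
Proof.
move=> s0 [mv Iv] cv; split => //.
apply: le_lt_trans Iv; apply: ge0_le_integral => //.
- by move=> x _; exact: wen_ge0.
- exact: measurable_wen.
- exact: measurable_En1.
move=> x _; rewrite /en -EFinM lee_fin; have [x0|x0] := leP x 0.
  by rewrite cv// n1_0 mulr0.
apply: ler_piMl; first exact: n1_ge0.
by rewrite /wt expR_le1 oppr_le0; apply: mulr_ge0 => //; exact: ltW.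
Qed.

Lemma cL1_trunc s b (w : R -> R[i]) : 0 <= s -> Ls s w -> cL1 (cpatch `]0, b] w).
Proof.
move=> s0 [mw cw ww].
have mp : cmeas (cpatch `]0, b] w).
  rewrite (_ : cpatch _ _ = fun t => if (0 < t) && (t <= b) then w t else 0); last first.
    by apply/funext => t; rewrite /cpatch mem_setE in_itv.
  apply: cmeas_if; [|exact: mw|exact: cmeas_cst].
  by apply: measurable_and; [exact: measurable_fun_ltr|exact: measurable_fun_ler].
split => //; apply: (@le_lt_trans _ _ ((expR (s * b))%:E * wn s w)%E).
  rewrite /wn /ewn -ge0_integralZl_EFin ?expR_ge0//.
  - apply: ge0_le_integral => //.
    + by move=> x _; rewrite lee_fin n1_ge0.
    + exact: measurable_En1.
    + by apply: measurable_funeM; exact: measurable_wen.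
    move=> x _; rewrite /cpatch mem_setE in_itv /=; case: ifP => [/andP[x0 xb]|_]; last first.
      by rewrite n1_0 mule_ge0 ?lee_fin ?expR_ge0//; exact: wen_ge0.
    rewrite /en -!EFinM lee_fin mulrA ler_peMl ?n1_ge0// /wt -expRD -expR0 ler_expR.
    by rewrite -mulrBr mulr_ge0// subr_ge0.
  - by move=> x _; exact: wen_ge0.
  - exact: measurable_wen.
by apply: lte_mul_pinfty => //; rewrite lee_fin expR_ge0.
Qed.

(** The kernel of integration divided by [k], that is, of the Prabhakar operator
    of order [k] and exponent 0. *)
Definition heav (t : R) : R[i] := if 0 < t then (k^-1)%:C else 0.

Lemma causal_heav : causal heav.
Proof. by move=> x x0; rewrite /heav ltNge x0. Qed.

Lemma conv_heav (w : R -> R[i]) x : cL1 w -> causal w ->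
  conv heav w x = (k^-1)%:C *
    (primitive (fun t => Re (w t)) x +i* primitive (fun t => Im (w t)) x).
Proof.
move=> Lw cw.
have H (u : R -> R) (F : R -> R) : mu.-integrable setT (EFin \o u) ->
    (forall t, F t = if (0 < t) && (t < x) then k^-1 * u t else 0) ->
    \int[mu]_t F t = k^-1 * primitive u x.
  move=> Iu FE.
  have mD : measurable (`]0, x]%classic : set (measurableTypeR R)) by [].
  have Ip : mu.-integrable setT (EFin \o (u \_ `]0, x])).
    by apply: integrable_patch => //; exact: integrableS Iu.
  rewrite /primitive [in RHS]Rintegral_mkcond -(RintegralZl _ measurableT Ip).
  apply: ae_Rintegral; exists [set x]; split => //; first exact: lebesgue_measure_set1.
  move=> t /= ht; apply: contrapT => tx; apply: ht => _; rewrite FE patchE mem_setE in_itv/=.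
  have -> : (t <= x) = (t < x) by rewrite le_eqVlt; case: eqP.
  by case: ifP => //; rewrite mulr0.
have hE t : heav (x - t) * w t = if (0 < t) && (t < x) then (k^-1)%:C * w t else 0.
  rewrite /heav subr_gt0; have [t0|t0] := ltP 0 t => /=; last by rewrite cw ?mulr0.
  by case: ifP => //; rewrite mul0r.
apply: complex_ext; rewrite ?ReM ?ImM /= ?mul0r ?subr0 ?addr0.
  apply: H; first exact: cL1_Re.
  by move=> t; rewrite hE; case: ifP => // _; rewrite ReM /= mul0r subr0.
apply: H; first exact: cL1_Im.
by move=> t; rewrite hE; case: ifP => // _; rewrite ImM /= mul0r addr0.
Qed.

Lemma causal_cpatch_oc b w : causal (cpatch `]0, b] w).
Proof. by move=> x x0; rewrite /cpatch mem_setE in_itv/= ltNge x0. Qed.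

(** Integration is injective; only the values before [b] enter, and there the
    function is integrable since the weight is bounded below. *)
Lemma heav_inj s b (w : R -> R[i]) : 0 <= s -> Ls s w ->
  {ae mu, forall x, 0 < x < b -> conv heav w x = 0} ->
  {ae mu, forall x, 0 < x < b -> w x = 0}.
Proof.
move=> s0 Lw H; have Lt := cL1_trunc b s0 Lw; have [_ cw _] := Lw.
have cv x : 0 < x < b -> conv heav w x = conv heav (cpatch `]0, b] w) x.
  move=> /andP[x0 xb]; apply: conv_local => //.
  - exact: causal_heav.
  - exact: causal_heav.
  - exact: causal_cpatch_oc.
  - exact: ae_all.
  apply: ae_all => t tx; rewrite /cpatch mem_setE in_itv/=.
  have [t0|t0] := ltP 0 t; last by rewrite cw.
  by rewrite ltW// (lt_trans tx).
have kn0 : (k^-1)%:C != 0 :> R[i] by rewrite eq_complex/= negb_and invr_eq0 gt_eqF.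
have H1 : {ae mu, forall x, 0 < x < b -> primitive (fun t => Re (cpatch `]0, b] w t)) x = 0}.
  apply: aeS H => x + xb => /(_ xb); rewrite cv// conv_heav//; last exact: causal_cpatch_oc.
  by move=> /eqP; rewrite mulf_eq0 (negbTE kn0)/= eq_complex/= => /andP[/eqP].
have H2 : {ae mu, forall x, 0 < x < b -> primitive (fun t => Im (cpatch `]0, b] w t)) x = 0}.
  apply: aeS H => x + xb => /(_ xb); rewrite cv// conv_heav//; last exact: causal_cpatch_oc.
  by move=> /eqP; rewrite mulf_eq0 (negbTE kn0)/= eq_complex/= => /andP[_ /eqP].
apply: aeS2 (integral_itv_eq0 (cL1_Re Lt) H1) (integral_itv_eq0 (cL1_Im Lt) H2) => x + + xb.
move=> /(_ xb) + /(_ xb); rewrite /cpatch mem_setE in_itv/=.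
by have /andP[-> xb'] := xb; rewrite (ltW xb') => h1 h2; exact: complex_ext.
Qed.

Lemma abs_continuous_ac_on b (g : R -> R[i]) (P : R[i] -> R) :
  (forall z w, P (z - w) = P z - P w) -> (forall z, `|P z|%:C <= `|z|) ->
  abs_continuous 0 b g -> ac_on b (fun t => P (g t)).
Proof.
move=> PB Pn ac e e0; have [d d0 H] := ac _ e0; exists d => // n u v uv tr ls.
rewrite -lecR; apply: le_trans (ltW (H _ _ _ uv tr ls)).
rewrite rmorph_sum/=; apply: ler_sum => i _.
by rewrite -PB Pn.
Qed.

(** The density is extended by 0 to the line, which makes it a causal function.
    The derivative is computed for every function that agrees with [g] on (0, b],
    whatever its value at 0. *)
Lemma cac_ftc b (g : R -> R[i]) : 0 < b -> abs_continuous 0 b g ->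
  exists G : R -> R[i], [/\ cL1 G, causal G,
    forall x, 0 < x <= b -> g x = g 0 + k%:C * conv heav G x &
    {ae mu, forall x, 0 < x < b -> forall h : R -> R[i],
       (forall y, 0 < y <= b -> h y = g y) -> cderive h x = G x}].
Proof.
move=> b0 ac.
have a1 : ac_on b (fun t => Re (g t)) := abs_continuous_ac_on ReB Re_le_norm ac.
have a2 : ac_on b (fun t => Im (g t)) := abs_continuous_ac_on ImB Im_le_norm ac.
have [f1 [I1 E1 D1]] := ac_ftc b0 a1.
have [f2 [I2 E2 D2]] := ac_ftc b0 a2.
pose G := cpatch `]0, +oo[ (fun t => f1 t +i* f2 t).
have LG : cL1 G by apply: cL1_cpatch => //; split; [exact: integrableS I1|exact: integrableS I2].
have cG : causal G by move=> x x0; rewrite /G /cpatch mem_setE in_itv/= ltNge x0.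
exists G; split => //.
- move=> x /andP[x0 xb]; rewrite conv_heav// mulrA.
  have -> : k%:C * (k^-1)%:C = 1 :> R[i] by rewrite -rmorphM/= mulfV ?gt_eqF.
  have P (u : R -> R) (F : R[i] -> R) : (forall t, 0 < t -> F (G t) = u t) ->
      primitive (fun t => F (G t)) x = primitive u x.
    move=> Fu; apply: eq_Rintegral => t; rewrite inE/= in_itv/= => /andP[t0 _].
    exact: Fu.
  rewrite (P f1); last by move=> t t0; rewrite /G /cpatch mem_setE in_itv/= t0.
  rewrite (P f2); last by move=> t t0; rewrite /G /cpatch mem_setE in_itv/= t0.
  have xb' : 0 <= x <= b by rewrite ltW.
  rewrite -E1// -E2// mul1r; apply: complex_ext; rewrite ?ReD ?ImD/=; ring.
- apply: aeS2 D1 D2 => x h1 h2 xb h hg; rewrite /cderive /G /cpatch mem_setE in_itv/=.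
  have /andP[-> _] := xb; rewrite /=.
  by congr (_ +i* _); [apply: h1|apply: h2] => // y yb; rewrite hg.
Qed.
End heaviside.

(** * Volterra equations of the second kind *)
Section neumann.
Context {R : realType}.
Local Notation mu := (@lebesgue_measure R).

Definition before (b : R) (w : R -> R[i]) (x : R) : R[i] := if x < b then w x else 0.

Lemma Ls_before s b w : Ls s w -> Ls s (before b w).
Proof.
move=> [mw cw ww]; have m : cmeas (before b w).
  apply: cmeas_if; [exact: measurable_fun_ltr|exact: mw|exact: cmeas_cst].
split => //.
  by move=> x x0; rewrite /before; case: ifP => // _; exact: cw.
apply: le_lt_trans ww; apply: wn_le => // x.
by rewrite /before; case: ifP => // _; rewrite n1_0 n1_ge0.
Qed.

Variables (s : R) (lambda : R[i]) (H : R -> R[i]) (q : R).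
Hypotheses (LH : Ls s H) (Hq : (wn s H <= q%:E)%E) (lq : n1 lambda * q <= 2^-1).

Let q0 : 0 <= q. Proof. by rewrite -lee_fin; apply: le_trans Hq; exact: wn_ge0. Qed.

Section series.
Variable B : nat -> R -> R[i].
Hypotheses (LB : forall n, Ls s (B n))
  (BS : forall n, {ae mu, forall x, B n.+1 x = conv H (B n) x}).

Let F n x := lambda ^+ n * B n x.

Let LF n : Ls s (F n). Proof. exact: LsZ. Qed.

Let wnBn n : (wn s (B n) <= (q ^+ n)%:E * wn s (B 0))%E.
Proof.
elim: n => [|n ih]; first by rewrite expr0 mul1e.
rewrite (wn_ae _ (BS n)); have [mH _ _] := LH; have [mB _ _] := LB n.
apply: le_trans (wn_conv _ mH mB) _; rewrite exprS EFinM -muleA.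
by apply: lee_pmul => //; exact: wn_ge0.
Qed.

(** The terms are dominated by a geometric series of ratio 1/2. *)
Lemma neumann_sum : (\sum_(0 <= n <oo) wn s (F n) < +oo)%E.
Proof.
pose a := fine (wn s (B 0)).
have aE : wn s (B 0) = a%:E by rewrite fineK// wn_fin.
have a0 : 0 <= a by rewrite fine_ge0// wn_ge0.
apply: (@le_lt_trans _ _ (2 * a)%:E); last by rewrite ltry.
apply: nneseries_half => // [n|n]; first exact: wn_ge0.
have [mB _ _] := LB n.
apply: le_trans (wnZ _ _ mB) _.
apply: (@le_trans _ _ ((n1 lambda ^+ n)%:E * ((q ^+ n)%:E * a%:E))%E).
  apply: lee_pmul; [by rewrite lee_fin n1_ge0|exact: wn_ge0|by rewrite lee_fin n1X|].
  by rewrite -aE; exact: wnBn.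
rewrite -!EFinM lee_fin mulrA -exprMn mulrC ler_wpM2l// -exprVn.
by apply: lerXn2r => //; rewrite nnegrE ?invr_ge0// mulr_ge0// n1_ge0.
Qed.

Definition neumann : R -> R[i] := aesum F.

Lemma Ls_neumann : Ls s neumann.
Proof. exact: Ls_aesum LF neumann_sum. Qed.

Lemma neumann_summable :
  {ae mu, forall x, csummable (fun n => lambda ^+ n * B n x)}.
Proof. exact: aesum_summable LF neumann_sum. Qed.

Lemma neumannE :
  {ae mu, forall x, neumann x = csum (fun n => lambda ^+ n * B n x)}.
Proof. exact: aesum_ae LF neumann_sum. Qed.

Let S N x := \sum_(0 <= n < N) F n x.
Let LS N : Ls s (S N). Proof. exact: Ls_sum. Qed.

Let SS N : {ae mu, forall x, S N.+1 x = B 0 x + lambda * conv H (S N) x}.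
Proof.
have T n : {ae mu, forall x, F n.+1 x = lambda * conv H (F n) x}.
  apply: aeS2 (BS n) (convZr (lambda ^+ n) LH (LB n)) => x e1 e2.
  by rewrite /F e1 [X in _ = lambda * X]e2 exprS mulrA.
apply: aeS2 (conv_sumr (index_iota 0 N) LF LH) (ae_all_seq (index_iota 0 N) T) => x e1 e2.
rewrite /S big_nat_recl// /F expr0 mul1r; congr (_ + _).
rewrite -/F [X in _ = _ * X]e1 mulr_sumr big_seq [RHS]big_seq.
by apply: eq_bigr => n /e2.
Qed.

(** The partial sums satisfy the equation up to an index shift, and the
    remainders go to zero in the weighted norm. *)
Lemma neumann_fixpoint :
  {ae mu, forall x, neumann x = B 0 x + lambda * conv H neumann x}.
Proof.
have LY := Ls_neumann.
pose D x := neumann x - (B 0 x + lambda * conv H neumann x).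
have LD : Ls s D by apply: LsB => //; apply: LsD => //; apply: LsZ; exact: Ls_conv.
suff : wn s D = 0%E.
  move=> /(wn_eq0 (let: And3 m _ _ := LD in m)); apply: aeS => x /eqP.
  by rewrite subr_eq0 => /eqP.
suff W e : 0 < e -> (wn s D <= (e + e)%:E)%E.
  apply/eqP; rewrite eq_le wn_ge0 andbT; apply/lee_addgt0Pr => e e0; rewrite add0e.
  by rewrite {1}(splitr e); apply: W; rewrite divr_gt0.
move=> e0; have [N hN] := aesum_tail_cvg neumann_sum e0.
pose r M x := neumann x - S M x.
have Lr M : Ls s (r M) := LsB LY (LS M).
have wr M : (N <= M)%N -> (wn s (r M) <= e%:E)%E.
  move=> NM; apply: le_trans (aesum_tail LF neumann_sum M) _; apply: ltW; exact: hN.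
rewrite (@wn_ae _ _ _ (fun x => r N.+1 x - lambda * conv H (r N) x)); last first.
  apply: aeS2 (SS N) (convBr LH LY (LS N)) => x e1 e2.
  by rewrite /D [conv H (r N) x]e2 /r e1; ring.
have [mH _ _] := LH; have [mr _ _] := Lr N; have [mr1 _ _] := Lr N.+1.
have mc := cmeas_conv mH mr.
have mlc : cmeas (fun x => lambda * conv H (r N) x).
  by apply: cmeasM => //; exact: cmeas_cst.
apply: (le_trans (wnB s mr1 mlc)).
rewrite EFinD; apply: leeD; first exact: wr.
apply: le_trans (wnZ _ _ mc) _.
apply: (@le_trans _ _ ((n1 lambda)%:E * (q%:E * e%:E))%E).
  apply: lee_pmul => //; first by rewrite lee_fin n1_ge0.
    exact: wn_ge0.
  apply: le_trans (wn_conv _ mH mr) _.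
  by apply: lee_pmul; [exact: wn_ge0|exact: wn_ge0|exact: Hq|exact: wr].
rewrite -!EFinM lee_fin mulrA ler_piMl ?(ltW e0)//.
by apply: le_trans lq _; rewrite invf_le1// ler1n.
Qed.
End series.

(** Uniqueness for the Volterra equation: truncating at [b] does not affect the
    convolution before [b], so the truncated solution has norm at most half its
    own norm. *)
Lemma volterra_unique b w : Ls s w ->
  {ae mu, forall x, x < b -> w x = lambda * conv H w x} ->
  {ae mu, forall x, x < b -> w x = 0}.
Proof.
move=> Lw E; have [mH cH _] := LH; have [_ cw _] := Lw.
have Lb := Ls_before b Lw; have [mb cb wb] := Lb.
have Lc := LsZ lambda (Ls_conv LH Lb); have [mc _ _] := Lc.
have h : (wn s (before b w) <= (2^-1)%:E * wn s (before b w))%E.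
  rewrite {1}(@wn_ae _ _ _ (before b (fun x => lambda * conv H (before b w) x))); last first.
    apply: aeS E => x E; rewrite /before; case: ifP => // xb; rewrite E//.
    congr (_ * _); apply: conv_local => //; first exact: ae_all.
    by apply: ae_all => t tx; rewrite /before (lt_trans tx).
  apply: (@le_trans _ _ (wn s (fun x => lambda * conv H (before b w) x))).
    apply: wn_le => //; first by case: (Ls_before b Lc).
    by move=> x; rewrite /before; case: ifP => // _; rewrite n1_0 n1_ge0.
  apply: le_trans (wnZ _ _ (cmeas_conv mH mb)) _.
  apply: (@le_trans _ _ ((n1 lambda)%:E * (q%:E * wn s (before b w)))%E).
    apply: lee_pmul => //; first by rewrite lee_fin n1_ge0.
      exact: wn_ge0.
    apply: le_trans (wn_conv _ mH mb) _.
    by apply: lee_pmul => //; exact: wn_ge0.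
  rewrite muleA -EFinM; apply: lee_pmul => //; last exact: wn_ge0.
  by rewrite lee_fin mulr_ge0// n1_ge0.
have w0 : wn s (before b w) = 0%E.
  move: h; rewrite -[wn _ _](fineK (wn_fin Lb)) -EFinM lee_fin => h.
  have := fine_ge0 (wn_ge0 s (before b w)); move: h.
  by move=> h1 h2; congr EFin; lra.
apply: aeS (wn_eq0 mb w0) => x + xb.
by rewrite /before xb.
Qed.
End neumann.

(** * The Prabhakar operator as a convolution *)
Section prabhakar.
Context {R : realType}.
Local Notation leb := (@lebesgue_measure R).
Variables (k alpha : R) (omega : R[i]) (s : R).
Hypotheses (k0 : 0 < k) (alpha0 : 0 < alpha) (ads : adm k alpha omega s).
Local Notation E := (mlker k alpha omega).

(** The orders for which the operator is a convolution, together with the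
    convention for the identity. *)
Definition valid_order (m g : R) := 0 < m \/ (m = 0 /\ g = 0).

(** The causal form of the operator: convolution with the series kernel, or the
    identity when both parameters vanish. *)
Definition prab (m g : R) (f : R -> R[i]) : R -> R[i] :=
  if (m == 0) && (g == 0) then f else conv (E m g) f.

Lemma prab_conv m g f : 0 < m -> prab m g f = conv (E m g) f.
Proof. by move=> m0; rewrite /prab gt_eqF. Qed.

Lemma prab_id f : prab 0 0 f = f.
Proof. by rewrite /prab eqxx. Qed.

Lemma LsE m g : 0 < m -> Ls s (E m g).
Proof. by move=> m0; apply: Ls_mlker. Qed.

Lemma Ls_prab m g f : valid_order m g -> Ls s f -> Ls s (prab m g f).
Proof.
move=> [m0|[-> ->]] Lf; last by rewrite prab_id.
by rewrite prab_conv//; apply: Ls_conv => //; exact: LsE.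
Qed.

Lemma prabB m g u v : valid_order m g -> Ls s u -> Ls s v ->
  {ae leb, forall x, prab m g (fun t => u t - v t) x = prab m g u x - prab m g v x}.
Proof.
move=> [m0|[-> ->]] Lu Lv; last by apply: ae_all => x; rewrite !prab_id.
rewrite !prab_conv//; exact: (convBr (LsE g m0) Lu Lv).
Qed.

Lemma prabZ m g c u : valid_order m g -> Ls s u ->
  {ae leb, forall x, prab m g (fun t => c * u t) x = c * prab m g u x}.
Proof.
move=> [m0|[-> ->]] Lu; last by apply: ae_all => x; rewrite !prab_id.
rewrite !prab_conv//; exact: (convZr c (LsE g m0) Lu).
Qed.

Lemma prab_local b m g f f' : valid_order m g -> causal f -> causal f' ->
  {ae leb, forall t, t < b -> f t = f' t} ->
  {ae leb, forall x, x < b -> prab m g f x = prab m g f' x}.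
Proof.
move=> [m0|[-> ->]] cf cf' ff'; last by rewrite !prab_id.
rewrite !prab_conv//; apply: ae_all => x xb.
have [_ cE _] := LsE g m0.
apply: conv_local => //; first exact: ae_all.
by apply: aeS ff' => t h tx; apply: h; exact: lt_trans xb.
Qed.

(** Orders and exponents add, because they do for the kernels. *)
Lemma prab_comp a ga c gc f : valid_order a ga -> valid_order c gc -> Ls s f ->
  {ae leb, forall x, prab a ga (prab c gc f) x = prab (a + c) (ga + gc) f x}.
Proof.
move=> [a0|[-> ->]] vc Lf; last by apply: ae_all => x; rewrite prab_id !add0r.
move: vc => [c0|[-> ->]]; last by apply: ae_all => x; rewrite prab_id !addr0.
have La := LsE ga a0; have Lc := LsE gc c0.
rewrite !prab_conv ?addr_gt0//; apply: aeS (convA La Lc Lf) => x e.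
apply: etrans e _; apply: conv_ae; last exact: ae_all.
exact: (conv_mlker k0 alpha0 ga gc ads a0 c0).
Qed.

Lemma prab_E a ga m g : valid_order a ga -> 0 < m ->
  {ae leb, forall x, prab a ga (E m g) x = E (a + m) (ga + g) x}.
Proof.
move=> [a0|[-> ->]] m0; last by apply: ae_all => x; rewrite prab_id !add0r.
by rewrite prab_conv//; exact: (conv_mlker k0 alpha0 ga g ads a0 m0).
Qed.

Lemma prab_heav f x : prab k 0 f x = conv (heav k) f x.
Proof.
rewrite prab_conv//; apply: conv_ae; last exact: ae_all.
exact: (mlker_k0 k0 alpha0 ads).
Qed.

(** On (0, b) the operator uses values of [f] on (0, b) only, and the integrand
    agrees almost everywhere with that of a convolution of causal functions. *)
Lemma kprabhakar_prab b m g f f0 : valid_order m g -> causal f0 ->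
  {ae leb, forall t, 0 < t < b -> f t = f0 t} ->
  {ae leb, forall x, 0 < x < b -> kprabhakar k alpha m omega g f x = prab m g f0 x}.
Proof.
move=> [m0|[-> ->]] cf0 ff0; last first.
  by apply: aeS ff0 => x h xb; rewrite prab_id /kprabhakar eqxx/=; exact: h.
rewrite prab_conv// /kprabhakar gt_eqF//=; apply: ae_all => x /andP[x0 xb].
have [_ cE _] := LsE g m0.
pose h (t : R) : R[i] := ((x - t) `^ (m / k - 1) / k)%:C *
  kmittag_leffler k alpha m g (omega * ((x - t) `^ (alpha / k))%:C) * f t.
have hE : {ae leb, forall t,
    (if t \in `]0, x[%classic then h t else 0) = E m g (x - t) * f0 t}.
  apply: aeS2 (ae_reflect x (mlker_ml k0 alpha0 g ads m0)) ff0 => t e1 e2.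
  rewrite mem_setE in_itv/=; have [t0|t0] := ltP 0 t => /=; last by rewrite cf0 ?mulr0.
  have [tx|tx] := ltP t x; last by rewrite cE ?mul0r// subr_le0.
  by rewrite /h e1 ?subr_gt0// e2// t0 (lt_trans tx).
rewrite /cintegral /conv /cint /cintegral; congr (_ +i* _).
  rewrite Rintegral_mkcond; apply: ae_Rintegral; apply: aeS hE => t <- _.
  by rewrite patchE; case: ifP.
rewrite Rintegral_mkcond; apply: ae_Rintegral; apply: aeS hE => t <- _.
by rewrite patchE; case: ifP.
Qed.
End prabhakar.

(** * The Cauchy problem *)
Section cauchy.
Context {R : realType}.
Local Notation leb := (@lebesgue_measure R).
Variables (k mu nu alpha gamma delta K : R) (omega lambda : R[i]).
Hypotheses (k0 : 0 < k) (mu0 : 0 < mu) (muk : mu < k) (nu0 : 0 <= nu)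
  (nu1 : nu <= 1) (alpha0 : 0 < alpha).
Variables (s q : R).
Hypothesis ads : adm k alpha omega s.
Local Notation E := (mlker k alpha omega).
Local Notation P := (prab k alpha omega).
Local Notation H := (E (2 * mu) (delta + gamma)).
Hypotheses (Hq : (wn s H <= q%:E)%E) (lq : n1 lambda * q <= 2^-1).

(** The half line is a countable union of bounded intervals. *)
Lemma ae_pos (Q : R -> Prop) : (forall N : nat, {ae leb, forall x, 0 < x < N.+1%:R -> Q x}) ->
  {ae leb, forall x, 0 < x -> Q x}.
Proof.
move=> h; have : {ae leb, forall x, forall N : nat, 0 < x < N.+1%:R -> Q x}.
  exact: ae_foralln.
apply: aeS => x hx x0; apply: (hx (Num.bound x)); rewrite x0/=.
apply: lt_trans (archi_boundP (ltW x0)) _; by rewrite ltr_nat.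
Qed.

Let s0 : 0 <= s. Proof. by have [/ltW] := ads. Qed.
Let LE m g : 0 < m -> Ls s (E m g). Proof. exact: LsE. Qed.
Let LP m g f : valid_order m g -> Ls s f -> Ls s (P m g f). Proof. exact: Ls_prab. Qed.

(** The operator of order [k - a] and exponent [- ga] composes with the one at
    hand to integration divided by [k], which is injective. *)
Lemma prab_inj b a ga w : valid_order a ga -> a < k -> Ls s w ->
  {ae leb, forall x, x < b -> P a ga w x = 0} ->
  {ae leb, forall x, x < b -> w x = 0}.
Proof.
move=> va ak Lw Pw0.
have ka0 : 0 < k - a by rewrite subr_gt0.
have vk : valid_order (k - a) (- ga) by left.
have [_ cw _] := Lw; have [_ cP _] := LP va Lw.
have cz : causal (fun=> 0 : R[i]) by [].
have h1 := prab_local k0 alpha0 ads vk cP cz Pw0.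
have h2 := prab_comp k0 alpha0 ads vk va Lw.
rewrite (subrK a k) (addNr ga) in h2.
have h3 : {ae leb, forall x, 0 < x < b -> conv (heav k) w x = 0}.
  apply: aeS2 h1 h2 => x e1 e2 /andP[_ xb].
  rewrite -(prab_heav k0 alpha0 ads).
  apply: etrans (esym e2) _; apply: etrans (e1 xb) _.
  by rewrite prab_conv//; exact: conv0r.
apply: aeS (heav_inj k0 s0 Lw h3) => x h xb.
have [x0|x0] := ltP 0 x; last exact: cw.
by apply: h; rewrite x0.
Qed.

Let a := (1 - nu) * (k - mu).
Let ga := - (gamma * (1 - nu)).
Let c := nu * (k - mu).
Let gc := - (gamma * nu).

Let km0 : 0 < k - mu. Proof. by rewrite subr_gt0. Qed.

Lemma valid_inner : valid_order a ga.
Proof.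
have := nu1; rewrite le_eqVlt => /orP[/eqP n1|n1].
  by right; rewrite /a /ga n1 subrr mul0r mulr0 oppr0.
by left; rewrite mulr_gt0// subr_gt0.
Qed.

Lemma valid_outer : valid_order c gc.
Proof.
have := nu0; rewrite le_eqVlt => /orP[/eqP n1|n1].
  by right; rewrite /c /gc -n1 mul0r mulr0 oppr0.
by left; rewrite mulr_gt0.
Qed.

Lemma inner_lt : a < k.
Proof.
apply: (@le_lt_trans _ _ (k - mu)); last by rewrite ltrBlDr ltrDl.
by rewrite ler_piMl ?(ltW km0)// gerBl.
Qed.

(** The difference of the two sides is annihilated by the inner operator, which
    is injective: it maps the kernel of complementary order to [heav], equal to
    1/k on the positive half line, and the second summand to the integral of [G]. *)
Lemma inner_inverse b u G : Ls s u -> Ls s G ->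
  {ae leb, forall x, 0 < x < b -> P a ga u x = K%:C + k%:C * conv (heav k) G x} ->
  {ae leb, forall x, x < b ->
    u x = (K * k)%:C * E (k - a) (- ga) x + k%:C * P (k - a) (- ga) G x}.
Proof.
move=> Lu LG hu.
have va := valid_inner; have ka0 : 0 < k - a by rewrite subr_gt0 inner_lt.
have vk : valid_order (k - a) (- ga) by left.
have L1 := LsZ (K * k)%:C (LE (- ga) ka0).
have L2 := LsZ k%:C (LP vk LG).
have Lw := LsB Lu (LsD L1 L2).
suff W : {ae leb, forall x, x < b -> u x -
     ((K * k)%:C * E (k - a) (- ga) x + k%:C * P (k - a) (- ga) G x) = 0}.
  by apply: aeS W => x h xb; apply/eqP; rewrite -subr_eq0; apply/eqP; exact: h.
have [_ cP _] := LP va Lw.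
apply: (prab_inj va inner_lt Lw).
have e1 := prabB k0 alpha0 ads va Lu (LsD L1 L2).
have e2 := prabB k0 alpha0 ads va (LsD L1 L2) L2.
have e3 := prabZ k0 alpha0 ads (K * k)%:C va (LE (- ga) ka0).
have e4 := prabZ k0 alpha0 ads k%:C va (LP vk LG).
have e5 := prab_E k0 alpha0 ads (- ga) va ka0.
have e6 := prab_comp k0 alpha0 ads va vk LG.
have e7 := mlker_k0 k0 alpha0 ads.
have D : (fun t => (K * k)%:C * E (k - a) (- ga) t + k%:C * P (k - a) (- ga) G t -
   k%:C * P (k - a) (- ga) G t) = fun t => (K * k)%:C * E (k - a) (- ga) t.
  by apply/funext => t; rewrite addrK.
rewrite D in e2.
apply: aeS2 (ae_and e1 e2) (ae_and (ae_and e3 e4) (ae_and (ae_and e5 e6)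
   (ae_and e7 hu))) => x [{}e1 {}e2] [[{}e3 {}e4] [[{}e5 {}e6] [{}e7 {}hu]]] xb.
have [x0|x0] := ltP 0 x; last exact: cP.
have aK : a + (k - a) = k by rewrite addrC subrK.
have gK : ga + - ga = 0 by rewrite subrr.
rewrite aK gK in e5 e6.
rewrite (prab_heav k0 alpha0 ads) in e6.
rewrite x0 in e7.
have {hu} := hu; rewrite x0 xb => /(_ isT) hu.
apply: etrans e1 _; rewrite hu.
have -> : P a ga (fun t => (K * k)%:C * E (k - a) (- ga) t + k%:C * P (k - a) (- ga) G t) x =
   P a ga (fun t => (K * k)%:C * E (k - a) (- ga) t) x +
   P a ga (fun t => k%:C * P (k - a) (- ga) G t) x.
  by apply/eqP; rewrite -subr_eq; apply/eqP; exact: esym e2.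
rewrite e3 e5 e7 e4 e6.
have -> : (K * k)%:C * (k^-1)%:C = K%:C by rewrite -rmorphM/= mulfK// gt_eqF.
by rewrite subrr.
Qed.


Lemma order_sum : mu + c = k - a.
Proof. by rewrite /c /a; ring. Qed.

Lemma exponent_sum : gamma + gc = - ga.
Proof. by rewrite /gc /ga; ring. Qed.

Let va := valid_inner.
Let vc := valid_outer.
Let vm g : valid_order mu g. Proof. by left. Qed.
Let ka0 : 0 < k - a. Proof. by rewrite subr_gt0 inner_lt. Qed.
Let mu20 : 0 < 2 * mu. Proof. by rewrite mulr_gt0. Qed.
Let LH : Ls s H. Proof. exact: LE. Qed.

(** Applying the operator of order [mu] turns the differential equation into a
    Volterra equation of the second kind, and loses nothing because that
    operator is injective. *)
Lemma equation_volterra b u G f0 : Ls s u -> Ls s G -> Ls s f0 ->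
  {ae leb, forall x, x < b ->
    u x = (K * k)%:C * E (k - a) (- ga) x + k%:C * P (k - a) (- ga) G x} ->
  {ae leb, forall x, x < b -> k%:C * P c gc G x = lambda * P mu delta u x + f0 x} <->
  {ae leb, forall x, x < b ->
    u x = (K * k)%:C * E (k - a) (- ga) x + P mu gamma f0 x + lambda * conv H u x}.
Proof.
move=> Lu LG Lf hu.
have L1 := LsZ k%:C (LP vc LG).
have L2 := LsZ lambda (LP (vm delta) Lu).
have L3 := LsD L2 Lf.
have LZ := LsB L1 L3.
pose Z x := k%:C * P c gc G x - (lambda * P mu delta u x + f0 x).
have PZ : {ae leb, forall x, x < b -> P mu gamma Z x = u x -
   ((K * k)%:C * E (k - a) (- ga) x + P mu gamma f0 x + lambda * conv H u x)}.
  have e1 := prabB k0 alpha0 ads (vm gamma) L1 L3.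
  have e2 := prabB k0 alpha0 ads (vm gamma) L3 Lf.
  have D : (fun t => lambda * P mu delta u t + f0 t - f0 t) = fun t => lambda * P mu delta u t.
    by apply/funext => t; rewrite addrK.
  rewrite D in e2.
  have e3 := prabZ k0 alpha0 ads k%:C (vm gamma) (LP vc LG).
  have e4 := prabZ k0 alpha0 ads lambda (vm gamma) (LP (vm delta) Lu).
  have e5 := prab_comp k0 alpha0 ads (vm gamma) vc LG.
  have e6 := prab_comp k0 alpha0 ads (vm gamma) (vm delta) Lu.
  rewrite order_sum exponent_sum in e5.
  have mm : mu + mu = 2 * mu by ring.
  rewrite mm (addrC gamma delta) (prab_conv _ _ _ _ _ mu20) in e6.
  apply: aeS2 (ae_and e1 e2) (ae_and (ae_and e3 e4) (ae_and (ae_and e5 e6) hu))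
    => x [{}e1 {}e2] [[{}e3 {}e4] [[{}e5 {}e6] {}hu]] xb.
  apply: etrans e1 _.
  have -> : P mu gamma (fun t => lambda * P mu delta u t + f0 t) x =
     lambda * conv H u x + P mu gamma f0 x.
    by rewrite -e6 -e4 e2 subrK.
  rewrite e3 e5 hu//.
  by move: (E _ _ x) (P _ _ _ x) (P _ _ _ x) (conv _ _ x) => ? ? ? ?; ring.
split=> h.
  have hZ : {ae leb, forall x, x < b -> Z x = 0}.
    by apply: aeS h => x h xb; rewrite /Z h// subrr.
  have [_ cZ _] := LZ.
  have cz : causal (fun=> 0 : R[i]) by [].
  have h1 := prab_local k0 alpha0 ads (vm gamma) cZ cz hZ.
  apply: aeS2 PZ h1 => x e1 e2 xb; apply/eqP; rewrite -subr_eq0 -e1// e2//.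
  by apply/eqP; rewrite prab_conv//; exact: conv0r.
have PZ0 : {ae leb, forall x, x < b -> P mu gamma Z x = 0}.
  by apply: aeS2 PZ h => x e1 e2 xb; rewrite e1// e2// subrr.
apply: aeS (prab_inj (vm gamma) muk LZ PZ0) => x h0 xb.
by apply/eqP; rewrite -subr_eq0; apply/eqP; exact: h0.
Qed.

Variables (f : R -> R[i]).
Hypothesis If : cintegrable `[0, +oo[ f.
Let f0 := cpatch `]0, +oo[ f.

Let f0E t : 0 < t -> f t = f0 t.
Proof. by move=> t0; rewrite /f0 /cpatch mem_setE in_itv/= t0. Qed.

Let Lf0 : Ls s f0.
Proof.
apply: Ls_cL1 => //; last by move=> x x0; rewrite /f0 /cpatch mem_setE in_itv/= ltNge x0.
apply: cL1_cpatch => //; have [I1 I2] := If.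
have sub : (`]0, +oo[%classic : set R) `<=` `[0, +oo[%classic.
  by move=> x /=; rewrite !in_itv/= !andbT => /ltW.
by split; [exact: integrableS I1|exact: integrableS I2].
Qed.

Let mh n : R := nu * (k - mu) + mu * (1 + 2 * n%:R).
Let gh n : R := n%:R * (delta + gamma) - gamma * (nu - 1).
Let ms n : R := mu * (1 + 2 * n%:R).
Let gs n : R := gamma + n%:R * (delta + gamma).
Let hB n x := k%:C * E (mh n) (gh n) x.
Let sB n := conv (E (ms n) (gs n)) f0.

Let ms0 n : 0 < ms n.
Proof. by rewrite mulr_gt0// ltr_wpDr// mulr_ge0. Qed.

Let mh0 n : 0 < mh n.
Proof. by rewrite ltr_wpDl// ?ms0// mulr_ge0// ltW. Qed.

Let LhB n : Ls s (hB n). Proof. exact: (LsZ k%:C (LE (gh n) (mh0 n))). Qed.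
Let LsB' n : Ls s (sB n). Proof. exact: (Ls_conv (LE (gs n) (ms0 n)) Lf0). Qed.

Let hBS n : {ae leb, forall x, hB n.+1 x = conv H (hB n) x}.
Proof.
have e1 := conv_mlker k0 alpha0 (delta + gamma) (gh n) ads mu20 (mh0 n).
have e2 := convZr k%:C LH (LE (gh n) (mh0 n)).
have me : 2 * mu + mh n = mh n.+1 by rewrite /mh -natr1; ring.
have ge : delta + gamma + gh n = gh n.+1 by rewrite /gh -natr1; ring.
rewrite me ge in e1.
apply: aeS2 e1 e2 => x e1 e2; rewrite /hB -e1; exact: esym e2.
Qed.

Let sBS n : {ae leb, forall x, sB n.+1 x = conv H (sB n) x}.
Proof.
have e1 := conv_mlker k0 alpha0 (delta + gamma) (gs n) ads mu20 (ms0 n).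
have e2 := convA LH (LE (gs n) (ms0 n)) Lf0.
have me : 2 * mu + ms n = ms n.+1 by rewrite /ms -natr1; ring.
have ge : delta + gamma + gs n = gs n.+1 by rewrite /gs -natr1; ring.
rewrite me ge in e1.
apply: aeS e2 => x e2; apply: esym; apply: etrans e2 _.
by apply: conv_ae => //; exact: ae_all.
Qed.

Lemma hom_termE : {ae leb, forall x, 0 < x -> forall n,
  hom_term k alpha omega lambda gamma delta mu nu x n = lambda ^+ n * hB n x}.
Proof.
have h n := mlker_ml k0 alpha0 (gh n) ads (mh0 n).
apply: aeS (ae_foralln h) => x hx x0 n; rewrite /hB -hx// /hom_term -mulrA; congr (_ * _).
rewrite mulrA; congr (_ * _).
by have -> : k%:C * (x `^ (mh n / k - 1) / k)%:C = (x `^ (mh n / k - 1))%:C by rewrite -rmorphM/= mulrC mulfVK ?gt_eqF.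
Qed.

Lemma source_termE : {ae leb, forall x, 0 < x -> forall n,
  source_term k alpha omega lambda gamma delta mu f x n = lambda ^+ n * sB n x}.
Proof.
have [_ cf0 _] := Lf0.
apply: ae_pos => N.
have h n : {ae leb, forall x, 0 < x < N.+1%:R ->
    kprabhakar k alpha (ms n) omega (gs n) f x = P (ms n) (gs n) f0 x}.
  have vs : valid_order (ms n) (gs n) by left; exact: ms0.
  apply: (kprabhakar_prab k0 alpha0 ads vs cf0).
  by apply: ae_all => t /andP[t0 _]; exact: f0E.
apply: aeS (ae_foralln h) => x hx xN n; rewrite /source_term; congr (_ * _).
by apply: etrans (hx n xN) _; rewrite prab_conv.
Qed.

Let Yh := neumann lambda hB.
Let Ys := neumann lambda sB.
Let Y x := K%:C * Yh x + Ys x.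

Lemma terms_summable : {ae leb, forall x, 0 < x ->
    csummable (hom_term k alpha omega lambda gamma delta mu nu x) /\
    csummable (source_term k alpha omega lambda gamma delta mu f x)}.
Proof.
have S1 := neumann_summable LH Hq lq LhB hBS.
have S2 := neumann_summable LH Hq lq LsB' sBS.
apply: aeS2 (ae_and hom_termE source_termE) (ae_and S1 S2) => x [e1 e2] [{}S1 {}S2] x0.
by rewrite (funext (e1 x0)) (funext (e2 x0)).
Qed.

Lemma solutionE : {ae leb, forall x, 0 < x -> Y x =
  K%:C * csum (hom_term k alpha omega lambda gamma delta mu nu x) +
  csum (source_term k alpha omega lambda gamma delta mu f x)}.
Proof.
have S1 := neumannE LH Hq lq LhB hBS.
have S2 := neumannE LH Hq lq LsB' sBS.
apply: aeS2 (ae_and hom_termE source_termE) (ae_and S1 S2) => x [e1 e2] [{}S1 {}S2] x0.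
by rewrite (funext (e1 x0)) (funext (e2 x0)) /Y /Yh S1 /Ys S2.
Qed.

Let LY : Ls s Y.
Proof.
apply: LsD; first apply: LsZ; first exact: (Ls_neumann LH Hq lq LhB hBS).
exact: (Ls_neumann LH Hq lq LsB' sBS).
Qed.

(** Both Neumann series satisfy the Volterra equation with their own first term
    as inhomogeneity, and the equation is linear. *)
Lemma solution_fixpoint : {ae leb, forall x, Y x =
  (K * k)%:C * E (k - a) (- ga) x + P mu gamma f0 x + lambda * conv H Y x}.
Proof.
have L1 := Ls_neumann LH Hq lq LhB hBS.
have L2 := Ls_neumann LH Hq lq LsB' sBS.
have F1 := neumann_fixpoint LH Hq lq LhB hBS.
have F2 := neumann_fixpoint LH Hq lq LsB' sBS.
have e1 := convDr LH (LsZ K%:C L1) L2.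
have e2 := convZr K%:C LH L1.
apply: aeS2 (ae_and F1 F2) (ae_and e1 e2) => x [{}F1 {}F2] [{}e1 {}e2].
have {}e1 : conv H Y x = conv H (fun t => K%:C * Yh t) x + conv H Ys x := e1.
rewrite e1 e2 /Y {1}/Yh F1 {1}/Ys F2.
have -> : hB 0 x = k%:C * E (k - a) (- ga) x.
  have e0 : mh 0 = k - a by rewrite /mh /a; ring.
  have e3 : gh 0 = - ga by rewrite /gh /ga; ring.
  by rewrite /hB e0 e3.
have -> : sB 0 x = P mu gamma f0 x.
  have pc : P mu gamma f0 = conv (E mu gamma) f0 by exact: prab_conv.
  have e0 : ms 0 = mu by rewrite /ms; ring.
  have e3 : gs 0 = gamma by rewrite /gs; ring.
  by rewrite pc /sB e0 e3.
rewrite rmorphM/=.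
by move: (E _ _ x) (P _ _ _ x) (conv _ _ x) (conv _ _ x) => ? ? ? ?; ring.
Qed.

(** A solution before [b] differs from the series by a solution of the homogeneous
    equation; conversely the convolution at x < b sees values before [b] only. *)
Lemma fixpoint_solution b u : Ls s u ->
  {ae leb, forall x, x < b ->
    u x = (K * k)%:C * E (k - a) (- ga) x + P mu gamma f0 x + lambda * conv H u x} <->
  {ae leb, forall x, x < b -> u x = Y x}.
Proof.
move=> Lu; have [_ cH _] := LH; have [_ cu _] := Lu; have [_ cY _] := LY; split => h.
  have Lw := LsB Lu LY.
  have e := convBr LH Lu LY.
  have W : {ae leb, forall x, x < b -> u x - Y x = lambda * conv H (fun t => u t - Y t) x}.
    apply: aeS2 (ae_and h solution_fixpoint) e => x [{}h hY] {}e xb; rewrite [X in _ = _ * X]e mulrBr h// [in LHS]hY.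
    by move: (E _ _ x) (P _ _ _ x) (conv _ _ x) (conv _ _ x) => ? ? ? ?; ring.
  apply: aeS (volterra_unique LH Hq lq Lw W) => x h0 xb.
  by apply/eqP; rewrite -subr_eq0; apply/eqP; exact: h0.
apply: aeS2 (h) solution_fixpoint => x hx hY xb.
have -> : conv H u x = conv H Y x.
  apply: conv_local => //; first exact: ae_all.
  by apply: aeS h => t ht tx; apply: ht; exact: lt_trans xb.
by rewrite hx.
Qed.


Variables (y : R -> R[i]).
Local Notation inner := (khilfer_inner k alpha omega gamma mu nu y).
Hypotheses (dom : khilfer_domain k alpha omega gamma mu nu y)
  (lim0 : inner x @[x --> 0^'+] --> (K%:C : R[i]^o)).

(** Right continuity at 0, through the extension to the line by [clamp]. *)
Lemma ac_on_right b (h : R -> R) : 0 < b -> ac_on b h -> h x @[x --> 0^'+] --> h 0.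
Proof.
move=> b0 ac; have ch := acl_continuous (ac_on_acl (ltW b0) ac).
have c0 : (h \o clamp b) x @[x --> 0^'+] --> h (clamp b 0).
  by apply: cvg_at_right_filter; exact: ch.
rewrite clamp_id ?lexx ?ltW// in c0.
apply: cvg_trans c0; apply: near_eq_cvg; near=> x.
by rewrite /= clamp_id//; apply/andP; split; apply: ltW; near: x; [exact: nbhs_right_gt|exact: nbhs_right_lt].
Unshelve. all: by end_near. Qed.

(** The extension by continuity at 0 and the inner integral have the same limit. *)
Lemma boundary_value b g : 0 < b -> abs_continuous 0 b g ->
  (forall x, 0 < x <= b -> g x = inner x) -> g 0 = K%:C.
Proof.
move=> b0 ac gE; have /ccvgP[l1 l2] := lim0.
have W (F : R[i] -> R) : (forall z w, F (z - w) = F z - F w) ->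
    (forall z, `|F z|%:C <= `|z|) ->
    F (inner x) @[x --> 0^'+] --> F K%:C -> F (g 0) = F K%:C.
  move=> FB Fn l.
  have cv := ac_on_right b0 (abs_continuous_ac_on FB Fn ac).
  apply: (@cvg_unique _ (@norm_hausdorff _ _) (F (g x) @[x --> 0^'+])) => //.
  apply: cvg_trans l; apply: near_eq_cvg; near=> x.
  rewrite gE//; apply/andP; split; [|apply: ltW]; near: x; [exact: nbhs_right_gt|exact: nbhs_right_lt].
apply: complex_ext; first exact: (W _ ReB Re_le_norm l1).
exact: (W _ ImB Im_le_norm l2).
Unshelve. all: by end_near. Qed.

(** Truncating [y] after [b] gives a member of the convolution algebra and changes
    neither side of the equation before [b]. *)
Lemma equation_solution_local b : 0 < b ->
  {ae leb, forall x, 0 < x < b ->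
     khilfer_prabhakar k alpha omega gamma mu nu y x =
     lambda * kprabhakar k alpha mu omega delta y x + f x} <->
  {ae leb, forall x, 0 < x < b -> y x = Y x}.
Proof.
move=> b0; have [Iy [g ac gE]] := dom b0.
have g0 := boundary_value b0 ac gE.
have [G [LG cG FG DG]] := cac_ftc k0 b0 ac.
pose u := cpatch `]0, b] y.
have uE t : 0 < t < b -> y t = u t.
  by move=> /andP[t0 tb]; rewrite /u /cpatch mem_setE in_itv/= t0 (ltW tb).
have cu : causal u by exact: causal_cpatch_oc.
have Lu : Ls s u.
  apply: Ls_cL1 => //; apply: cL1_cpatch => //; have [I1 I2] := Iy.
  have sub : (`]0, b]%classic : set R) `<=` `[0, b]%classic.
    by move=> x /=; rewrite !in_itv/= => /andP[/ltW -> ->].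
  by split; [exact: integrableS I1|exact: integrableS I2].
have LGs : Ls s G by exact: Ls_cL1.
have yu : {ae leb, forall t, 0 < t < b -> y t = u t} by exact: ae_all.
have [_ cf0 _] := Lf0; have [_ cY _] := LY.
have hu : {ae leb, forall x, 0 < x < b -> P a ga u x = K%:C + k%:C * conv (heav k) G x}.
  apply: aeS (kprabhakar_prab k0 alpha0 ads va cu yu) => x e xb.
  have xb' : 0 < x <= b by have /andP[-> /ltW->] := xb.
  by rewrite -e// -[kprabhakar _ _ _ _ _ _ _]/(inner x) -gE// FG// g0.
have hinv := inner_inverse Lu LGs hu.
have eqv := equation_volterra Lu LGs Lf0 hinv.
have fix_ := fixpoint_solution b Lu.
have dE : {ae leb, forall t, 0 < t < b -> cderive inner t = G t}.
  by apply: aeS DG => t h tb; apply: h => // z zb; rewrite gE.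
have lE : {ae leb, forall x, 0 < x < b ->
    khilfer_prabhakar k alpha omega gamma mu nu y x = k%:C * P c gc G x}.
  by apply: aeS (kprabhakar_prab k0 alpha0 ads vc cG dE) => x h xb; rewrite -h.
have rE := kprabhakar_prab k0 alpha0 ads (vm delta) cu yu.
have [_ cPG _] := LP vc LGs; have [_ cPu _] := LP (vm delta) Lu.
split=> h.
  have h1 : {ae leb, forall x, x < b -> k%:C * P c gc G x = lambda * P mu delta u x + f0 x}.
    apply: aeS2 (ae_and lE rE) h => x [e1 e2] {}h xb.
    have [x0|x0] := ltP 0 x; last by rewrite cPG// cPu// cf0// !mulr0 addr0.
    have xb' : 0 < x < b by rewrite x0.
    by rewrite -e1// -e2// -f0E//; exact: h.
  apply: aeS (fix_.1 (eqv.1 h1)) => x hx xb; rewrite uE// hx//.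
  by case/andP: xb.
have h1 : {ae leb, forall x, x < b -> u x = Y x}.
  apply: aeS h => x h xb.
  have [x0|x0] := ltP 0 x; last by rewrite cu// cY.
  by rewrite -uE ?x0//; apply: h; rewrite x0.
apply: aeS2 (ae_and lE rE) (eqv.2 (fix_.2 h1)) => x [e1 e2] {}h xb; have /andP[x0 xb'] := xb.
by rewrite e1// e2// f0E//; exact: h.
Qed.

Lemma equation_solution :
  {ae leb, forall x, 0 < x ->
     khilfer_prabhakar k alpha omega gamma mu nu y x =
     lambda * kprabhakar k alpha mu omega delta y x + f x} <->
  {ae leb, forall x, 0 < x -> y x =
     K%:C * csum (hom_term k alpha omega lambda gamma delta mu nu x) +
     csum (source_term k alpha omega lambda gamma delta mu f x)}.
Proof.
split=> h.
  suff hY : {ae leb, forall x, 0 < x -> y x = Y x}.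
    by apply: aeS2 hY solutionE => x e1 e2 x0; rewrite e1// e2.
  apply: ae_pos => N; apply/(equation_solution_local (ltr0Sn R N)).
  by apply: aeS h => x h /andP[x0 _]; exact: h.
apply: ae_pos => N; apply/(equation_solution_local (ltr0Sn R N)).
by apply: aeS2 h solutionE => x e1 e2 /andP[x0 _]; rewrite e1// e2.
Qed.
End cauchy.

Section parameter.
Context {R : realType}.
Variables (k mu alpha gamma delta : R) (omega lambda : R[i]).
Hypotheses (k0 : 0 < k) (mu0 : 0 < mu) (alpha0 : 0 < alpha).

(** The norm bound of [wn_mlker] tends to 0 as [s] grows, so a steep weight makes
    the Volterra operator a contraction. *)
Lemma contraction_parameter : exists s q, [/\ adm k alpha omega s,
  (wn s (mlker k alpha omega (2 * mu) (delta + gamma)) <= q%:E)%E & n1 lambda * q <= 2^-1].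
Proof.
have [s1 s10 h1] := adm_large omega k0 alpha0.
have mu20 : 0 < 2 * mu by rewrite mulr_gt0.
have [B B0 hB] := wn_mlker omega k0 alpha0 (2 * mu) (delta + gamma).
pose d := n1 lambda * B + 1.
have d0 : 0 < d by rewrite ltr_wpDl// mulr_ge0// n1_ge0.
have e0 : 0 < 2^-1 / d by rewrite divr_gt0.
have [s2 s20 h2] := powR_small k0 (divr_gt0 mu20 k0) e0.
pose s := Num.max s1 s2.
have ads : adm k alpha omega s by apply: h1; rewrite le_max lexx.
exists s, (B * (2^-1 / d)); split => //.
  apply: le_trans (hB _ ads mu20) _; rewrite lee_fin ler_wpM2l//.
  by apply: h2; rewrite le_max lexx orbT.
by rewrite mulrA mulrCA ler_piMr// ler_pdivrMr// mul1r /d lerDl ler01.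
Qed.
End parameter.

Theorem theorem4p1 (R : realType) (k mu nu alpha gamma delta K : R)
    (omega lambda : R[i]) (f : R -> R[i]) :
  0 < k -> 0 < mu -> mu < 1 -> mu < k -> 0 <= nu -> nu <= 1 -> 0 < alpha ->
  0 <= gamma -> 0 <= delta -> 0 <= K ->
  cintegrable `[0, +oo[ f ->
  {ae @lebesgue_measure R, forall x : R, 0 < x ->
    csummable (hom_term k alpha omega lambda gamma delta mu nu x) /\
    csummable (source_term k alpha omega lambda gamma delta mu f x)} /\
  forall y : R -> R[i],
    khilfer_domain k alpha omega gamma mu nu y ->
    khilfer_inner k alpha omega gamma mu nu y x @[x --> 0^'+] -->
      (K%:C : R[i]^o) ->
    {ae @lebesgue_measure R, forall x : R, 0 < x ->
       khilfer_prabhakar k alpha omega gamma mu nu y x =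
       lambda * kprabhakar k alpha mu omega delta y x + f x} <->
    {ae @lebesgue_measure R, forall x : R, 0 < x ->
       y x =
       K%:C * csum (hom_term k alpha omega lambda gamma delta mu nu x)
       + csum (source_term k alpha omega lambda gamma delta mu f x)}.
Proof.
move=> k0 mu0 mu1 muk nu0 nu1 alpha0 gamma0 delta0 K0 If.
have [s [q [ads Hq lq]]] := contraction_parameter gamma delta omega lambda k0 mu0 alpha0.
split.
  exact: (terms_summable k0 mu0 muk nu0 alpha0 ads Hq lq If).
move=> y dom lim.
exact: (equation_solution k0 mu0 muk nu0 nu1 alpha0 ads Hq lq If dom lim).
Qed.
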